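(* Assume that $g$ satisfies hypotheses $(H_1)$ and $(H_2)$ (stated in the context). Then there exists $\omega_*>0$ such that for every $\omega\in(0,\omega_* )$ the only solutions $(X,Y,\lambda)\in H^1(\mathbb{R})^2\times\mathbb{C}$ of the system $$L_-X=\lambda Y,\qquad L_+Y=\lambda X$$ are $X=Y=0$ (with any $\lambda\in\mathbb{C}$), or $\lambda=0$, $X\in\mathrm{span}(\phi_\omega)$ and $Y\in\mathrm{span}(\phi_\omega')$.
   Context: Let $g:[0,+\infty)\to\mathbb{R}$ and $G(s)=\int_0^s g$. $(H_1)$: $g\in C^5((0,+\infty))\cap C^1([0,+\infty))$; $g^{(k)}(s)=o(s^{1-k})$ as $s\to0^+$ for every integer $0\le k\le5$; and $g$ is not identically $0$ near $0$. For $\omega>0$ small, $\phi_\omega\in H^1(\mathbb{R})$ denotes the unique nontrivial, even, nonnegative solution vanishing at infinity of $\phi_\omega''=\omega\phi_\omega-\phi_\omega^3+\phi_\omega g(\phi_\omega^2)$ (it exists for all small $\omega>0$). Put $\varepsilon_\omega=\sup_{0\le s\le3\omega}|sg''(s)|$ (with $sg''(s)$ read as $0$ at $s=0$); under $(H_1)$, $\varepsilon_\omega$ is finite and nonzero for small $\omega>0$. $(H_2)$: $\displaystyle\lim_{\omega\to0^+}\frac{1}{\varepsilon_\omega^2\sqrt\omega}\int_{\mathbb{R}}\left(-3g(\phi_\omega^2)+\phi_\omega^2g'(\phi_\omega^2)+4\frac{G(\phi_\omega^2)}{\phi_\omega^2}\right)dx=+\infty.$ The operators are $$L_+=-\partial_x^2+\omega-3\phi_\omega^2+g(\phi_\omega^2)+2\phi_\omega^2g'(\phi_\omega^2),\qquad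 L_-=-\partial_x^2+\omega-\phi_\omega^2+g(\phi_\omega^2).$$ Functions are complex-valued and the system is understood in the sense of distributions. *)

(* Defs.v *)
(* MathComp-Analysis development, over an arbitrary realType R. *)
From HB Require Import structures.
From mathcomp Require Import all_boot all_order all_algebra.
From mathcomp Require Import all_classical all_reals all_analysis.
From mathcomp.real_closed Require Import complex.

Set Implicit Arguments.
Unset Strict Implicit.
Unset Printing Implicit Defensive.

Import Order.TTheory GRing.Theory Num.Theory.
Import numFieldNormedType.Exports.

Local Open Scope ring_scope.
Local Open Scope complex_scope.
Local Open Scope classical_set_scope.

Notation leb R := (@lebesgue_measure R).

(* A function g : [0, +oo[ -> R is represented by a total function of which
   only the values on [0, +oo[ are ever used: the two-sided derivatives
   g^`(k) s below are taken at s > 0, or multiplied by s. *)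

(* The library has only two-sided derivatives, so the derivative at 0 is
   written as the limit of the right difference quotient. *)
Definition C1_nonneg (R : realType) (g : R -> R) : Prop :=
  {within `[0, +oo[, continuous g} /\
  exists h : R -> R,
    [/\ {within `[0, +oo[, continuous h},
        (forall s : R, 0 < s -> is_derive s (1 : R) g (h s))
      & (s^-1 * (g s - g 0)) @[s --> 0^'+] --> h 0].

Definition C5_pos (R : realType) (g : R -> R) : Prop :=
  (forall (k : nat) (s : R), (k < 5)%N -> 0 < s -> derivable g^`(k) s 1) /\
  (forall s : R, 0 < s -> {for s, continuous g^`(5)}).

Definition hyp_H1 (R : realType) (g : R -> R) : Prop :=
  [/\ C5_pos g,
      C1_nonneg g,
      (forall k : nat, (k <= 5)%N ->
         (g^`(k) : R -> R^o) =o_ (0^'+) (fun s : R => s ^ (1 - k%:Z) : R^o))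
    & (forall d : R, 0 < d -> exists2 s : R, 0 <= s < d & g s != 0)].

Definition primitive (R : realType) (g : R -> R) (s : R) : R :=
  \int[leb R]_(t in `[0, s]) g t.

Definition eps (R : realType) (g : R -> R) (w : R) : R :=
  sup [set `|s * (g^`(2) s)%classic| | s in `[0, 3 * w]].

(* Under hyp_H1 a ground state is positive everywhere, by uniqueness for the
   Cauchy problem, so the convention x / 0 = 0 plays no role. *)
Definition hyp_H2 (R : realType) (g : R -> R) (phi : R -> R -> R) : Prop :=
  ((eps g w ^+ 2 * Num.sqrt w)^-1 *
   \int[leb R]_x (- 3 * g (phi w x ^+ 2)
                  + phi w x ^+ 2 * (g^`())%classic (phi w x ^+ 2)
                  + 4 * (primitive g (phi w x ^+ 2) / phi w x ^+ 2)))
    @[w --> 0^'+] --> +oo.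

(* Real test functions suffice to test complex-valued distributions, complex
   test functions being complex combinations of real ones. *)
Definition test_function (R : realType) (psi : R -> R) : Prop :=
  (forall (n : nat) (x : R), derivable psi^`(n) x 1) /\
  compact (closure [set x | psi x != 0]).

Definition weak_derivative (R : realType) (u v : R -> R) : Prop :=
  forall psi : R -> R, test_function psi ->
    \int[leb R]_x (u x * (psi^`())%classic x) = - \int[leb R]_x (v x * psi x).

(* Elements of L^2 and H^1 are given by representatives; equality is a.e. *)
Definition sobolev_H1 (R : realType) (u : R -> R) : Prop :=
  u \in Lfun (leb R) 2%:E /\
  exists2 v : R -> R, v \in Lfun (leb R) 2%:E & weak_derivative u v.

Definition sobolev_H1C (R : realType) (u : R -> R[i]) : Prop :=
  sobolev_H1 (fun x => complex.Re (u x)) /\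
  sobolev_H1 (fun x => complex.Im (u x)).

(* The H^1 solutions of the equation have a unique C^2 representative: phi is
   that representative, so the equation is required pointwise. *)
Definition ground_state (R : realType) (g : R -> R) (w : R) (phi : R -> R) :
    Prop :=
  [/\ sobolev_H1 phi,
      (forall x, derivable phi x 1 /\ derivable phi^`() x 1),
      (forall x, phi^`(2) x =
         w * phi x - phi x ^+ 3 + phi x * g (phi x ^+ 2)),
      [/\ (exists x, phi x != 0),
          (forall x, phi (- x) = phi x)
        & (forall x, 0 <= phi x)]
    & phi x @[x --> +oo] --> (0 : R) /\ phi x @[x --> -oo] --> (0 : R)].

Definition pairing (R : realType) (u : R -> R[i]) (psi : R -> R) : R[i] :=
  (\int[leb R]_x (complex.Re (u x) * psi x)) +i*
  (\int[leb R]_x (complex.Im (u x) * psi x)).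

(* The distribution (- d^2/dx^2 + V) u. *)
Definition schrodinger (R : realType) (V : R -> R) (u : R -> R[i])
    (psi : R -> R) : R[i] :=
  - pairing u psi^`(2) + pairing (fun x => (V x)%:C * u x) psi.

Definition Lplus (R : realType) (g : R -> R) (w : R) (phi : R -> R) :=
  schrodinger (fun x => w - 3 * phi x ^+ 2 + g (phi x ^+ 2)
                        + 2 * phi x ^+ 2 * (g^`())%classic (phi x ^+ 2)).

Definition Lminus (R : realType) (g : R -> R) (w : R) (phi : R -> R) :=
  schrodinger (fun x => w - phi x ^+ 2 + g (phi x ^+ 2)).

Definition eigen_system (R : realType) (g : R -> R) (w : R) (phi : R -> R)
    (X Y : R -> R[i]) (lam : R[i]) : Prop :=
  forall psi : R -> R, test_function psi ->
    Lminus g w phi X psi = lam * pairing Y psi /\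
    Lplus g w phi Y psi = lam * pairing X psi.

Definition ae_span (R : realType) (f : R -> R) (u : R -> R[i]) : Prop :=
  exists c : R[i], {ae leb R, forall x, u x = c * (f x)%:C}.

(* Main.v *)
Require Import Defs.
From mathcomp Require Import all_boot all_order all_algebra.
From mathcomp Require Import all_classical all_reals all_analysis.
From mathcomp Require Import measurable_realfun.
From mathcomp Require Import ring lra.
From mathcomp.real_closed Require Import complex.

Set Implicit Arguments.
Unset Strict Implicit.
Unset Printing Implicit Defensive.

Import Order.TTheory GRing.Theory Num.Theory.
Import numFieldNormedType.Exports.

Local Open Scope ring_scope.
Local Open Scope classical_set_scope.

(** Write p for phi_w, s = p^2, b = p'/p, and ep for the number eps g w.  Let
    S u = u' - b u, so that S p = 0 and L_- is the product of S with its
    adjoint.  For a solution (X, Y, lam), put P = lam Y, Q = lam X and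

      Z = S^2 X,        U = 2 (Y p'' - Y' p') / p - Q.

    Since p' solves L_+ p' = 0, differentiating these formulas shows that they
    form a Darboux transformation: (U, Z) solves a new system

      - U'' + (w + h + k) U = lam Z,     - Z'' + (w + h - k) Z = lam U,

    in which the potentials h and k are O(ep s) instead of O(s), and h is
    exactly the integrand of hypothesis (H2): h = - 3 g(s) + s g'(s) + 4 G(s)/s
    (lemmas [zop'_der] and [uop'_der]).  The bounds on h, k and their first
    derivatives come from integrating |s g''(s)| <= ep once and twice from 0
    (record [near0] and lemma [pots_bound]) and from the decay
    s <= 3 w / (1 + w x^2/4)^2, which follows from the convexity of 1/p
    (lemma [decay]).  All the proof then uses of h and k is listed in the
    record [repulsive].

    The new system has no nonzero solution with square integrable values and
    first derivatives.  If lam is not real, multiplying by the conjugates and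
    integrating gives two identities, whose combination says that a positive
    definite form of (U, Z) vanishes ([system_vanish_complex]).  If lam is
    real, replacing (U, Z) by U + Z and U - Z reduces to lam >= 0 and to

      z'' = (h + w - lam) z + k y,      y'' = (h + w + lam) y + k z.

    The y equation is elliptic and controls y by z.  The virial identity, with
    multiplier x d/dx, does not see lam: it bounds
    2 int z'^2 - int x h' z^2 by terms in y and k.  Replacing z by z(0) in the
    integral of x h' z^2 costs terms bounded by int z'^2, and
    - int x h' = int h, which (H2) makes larger than any given multiple of
    ep^2 sqrt w, while all the errors in z(0)^2 are O(ep^2 sqrt w).  Hence
    z' = 0, z(0) = 0 and y = 0 ([virial_step], [virial_vanish]).  Boundary
    terms are discarded along radii r for which r times the squares at r and
    - r is small; such radii exist because 1/x is not integrable at infinity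
    ([integrable_recurrent]).

    Finally U = Z = 0 is undone by elementary ODE arguments: if lam <> 0 it
    forces S Q = 0, then P = 0 and Q = 0; if lam = 0 it forces S X = 0 and
    makes Y proportional to p' ([classify]).

    The passage between the distributional system for complex functions and
    real classical ODEs is a du Bois-Reymond argument: testing against
    plateau functions with mollified edges, the Lebesgue differentiation
    theorem shows that a function with a locally integrable weak derivative
    is almost everywhere a primitive of it ([weak_increment],
    [weak_continuous], [eigen_classical], [eigen_of_classical]). *)

(** * Derivatives and integrals of continuous functions *)

Definition dat (R : realType) (f : R -> R) (x d : R) : Prop :=
  is_derive x (1 : R) f d.

Definition der (R : realType) (f f' : R -> R) : Prop :=
  forall x, dat f x (f' x).

Section calculus.
Variable R : realType.
Implicit Types (f g : R -> R) (x a b c d : R).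

Lemma dat_eq f x d d' : dat f x d -> d = d' -> dat f x d'.
Proof. by move=> ? <-. Qed.

Lemma dat_cst c x : dat (fun=> c) x 0.
Proof. exact: is_derive_cst. Qed.

Lemma dat_id x : dat (fun y => y) x 1.
Proof. exact: is_derive_id. Qed.

Lemma datD f g x d e : dat f x d -> dat g x e ->
  dat (fun y => f y + g y) x (d + e).
Proof. move=> df dg; exact: is_deriveD. Qed.

Lemma datN f x d : dat f x d -> dat (fun y => - f y) x (- d).
Proof. move=> df; exact: is_deriveN. Qed.

Lemma datM f g x d e : dat f x d -> dat g x e ->
  dat (fun y => f y * g y) x (f x * e + g x * d).
Proof. move=> df dg; exact: is_deriveM. Qed.

Lemma datX f n x d : dat f x d ->
  dat (fun y => f y ^+ n) x (n%:R * f x ^+ n.-1 * d).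
Proof.
move=> df; have := is_deriveX n df.
by rewrite (_ : f ^+ n = fun y => f y ^+ n)//; apply/funext => y; rewrite fctE.
Qed.

Lemma datV f x d : f x != 0 -> dat f x d ->
  dat (fun y => (f y)^-1) x (- d / f x ^+ 2).
Proof.
move=> f0 df; apply: dat_eq (is_deriveV f0 df) _.
by rewrite /GRing.scale /= mulrC mulrN mulNr.
Qed.

Lemma dat_comp f g x d e : dat f (g x) d -> dat g x e ->
  dat (fun y => f (g y)) x (d * e).
Proof. move=> df dg; exact: (@is_derive1_comp _ f g). Qed.

Lemma dat_unique f x d e : dat f x d -> dat f x e -> d = e.
Proof. by move=> [_ <-] [_ <-]. Qed.

Lemma dat_near f g x d : (\near x, f x = g x) -> dat f x d -> dat g x d.
Proof. exact: near_eq_is_derive. Qed.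

Lemma dat_derivable f x d : dat f x d -> derivable f x 1.
Proof. by case. Qed.

Lemma dat_derive1 f x d : dat f x d -> (f^`())%classic x = d.
Proof. by move=> [_ <-]; rewrite derive1E. Qed.

Lemma derivable_dat f x : derivable f x 1 -> dat f x ((f^`())%classic x).
Proof. by move=> /derivableP; rewrite derive1E. Qed.

Lemma dat_cont f x d : dat f x d -> {for x, continuous f}.
Proof.
by move=> [h _]; exact/differentiable_continuous/derivable1_diffP.
Qed.

Lemma der_cont f f' : der f f' -> continuous f.
Proof. by move=> h x; exact: dat_cont (h x). Qed.

Lemma der_derive1 f f' : der f f' -> (f^`())%classic = f'.
Proof. by move=> h; apply/funext => x; exact: dat_derive1 (h x). Qed.

Lemma cont_cst c : continuous (fun _ : R => c).
Proof. by move=> x; exact: cst_continuous. Qed.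

Lemma cont_id : continuous (fun x : R => x).
Proof. by move=> x; exact: cvg_id. Qed.

Lemma contD f g : continuous f -> continuous g ->
  continuous (fun x => f x + g x).
Proof. by move=> cf cg x; apply: cvgD; [exact: cf|exact: cg]. Qed.

Lemma contN f : continuous f -> continuous (fun x => - f x).
Proof. by move=> cf x; apply: cvgN; exact: cf. Qed.

Lemma contM f g : continuous f -> continuous g ->
  continuous (fun x => f x * g x).
Proof. by move=> cf cg x; apply: cvgM; [exact: cf|exact: cg]. Qed.

Lemma contX f n : continuous f -> continuous (fun x => f x ^+ n).
Proof.
move=> cf; elim: n => [|n ih]; first by under eq_fun do rewrite expr0; exact: cont_cst.
by under eq_fun do rewrite exprS; exact: contM.
Qed.

Lemma contV f : (forall x, f x != 0) -> continuous f ->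
  continuous (fun x => (f x)^-1).
Proof. by move=> f0 cf x; apply: cvgV; [exact: f0|exact: cf]. Qed.

Lemma cont_comp f g : continuous f -> continuous g ->
  continuous (fun x => f (g x)).
Proof. by move=> cf cg x; apply: continuous_comp; [exact: cg|exact: cf]. Qed.

Lemma cont_norm f : continuous f -> continuous (fun x => `|f x|).
Proof. by move=> cf x; apply: cvg_norm; exact: cf. Qed.

Lemma MVT_le f f' a b : a <= b ->
  (forall x, a <= x <= b -> dat f x (f' x)) ->
  exists2 c, a <= c <= b & f b - f a = f' c * (b - a).
Proof.
move=> ab h.
have h' : forall x, x \in `]a, b[%R -> is_derive x (1:R) f (f' x).
  move=> x; rewrite in_itv /= => /andP[ax xb].
  by apply: h; rewrite !ltW.
have [|c cab e] := MVT_segment ab h'.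
  apply: derivable_within_continuous => x; rewrite in_itv /= => xab.
  by case: (h x xab).
by exists c => //; move: cab; rewrite in_itv.
Qed.

Lemma der_ge0_le f f' a b : a <= b ->
  (forall x, a <= x <= b -> dat f x (f' x)) ->
  (forall x, a <= x <= b -> 0 <= f' x) -> f a <= f b.
Proof.
move=> ab h h0; have [c cab e] := MVT_le ab h.
by rewrite -subr_ge0 e mulr_ge0 ?subr_ge0 ?h0.
Qed.

Lemma der0_cst f a b : der f (fun=> 0) -> f a = f b.
Proof. by move=> h; apply: is_derive_0_is_cst. Qed.

End calculus.

(** Differentiation of explicit expressions: the shape of the expression selects
    the rule, and the derivatives of its atoms are looked up among the
    hypotheses.  [ddat] leaves the comparison with the expected derivative to
    [ring]. *)
Ltac dat_leaf :=
  match goal with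
  | H : der ?f _ |- dat ?f _ _ => apply: H
  | H : der ?f _ |- dat (fun y => ?f y) _ _ => apply: H
  | H : dat ?f _ _ |- dat ?f _ _ => refine H
  | H : dat ?f _ _ |- dat (fun y => ?f y) _ _ => refine H
  end.
Ltac dat_step := lazymatch goal with
  | |- dat (fun y => y) _ _ => apply: dat_id
  | |- dat (fun y => _ + _) _ _ => apply: datD
  | |- dat (fun y => - _) _ _ => apply: datN
  | |- dat (fun y => _ * _) _ _ => apply: datM
  | |- dat (fun y => _ ^+ _) _ _ => apply: datX
  | |- dat (fun y => (_)^-1) _ _ => first [simple apply dat_cst | apply: datV]
  | |- dat GRing.inv _ _ => apply: (@datV _ (fun y => y))
  | |- dat GRing.opp _ _ => apply: (@datN _ (fun y => y))
  | |- dat (GRing.mul ?c) _ _ => apply: (@datM _ (fun=> c) (fun y => y))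
  | |- dat (GRing.add ?c) _ _ => apply: (@datD _ (fun=> c) (fun y => y))
  | |- _ => first [dat_leaf | simple apply dat_cst]
  end.
Ltac ddat := apply: dat_eq; [repeat dat_step | try (rewrite /=; ring)].

Ltac cont_leaf :=
  match goal with
  | H : continuous ?f |- continuous ?f => exact H
  | H : continuous ?f |- continuous (fun y => ?f y) => exact H
  end.
Ltac cont_step := lazymatch goal with
  | |- continuous (fun y => y) => apply: cont_id
  | |- continuous (fun y => _ + _) => apply: contD
  | |- continuous (fun y => - _) => apply: contN
  | |- continuous (fun y => _ * _) => apply: contM
  | |- continuous (fun y => _ ^+ _) => apply: contX
  | |- continuous (fun y => `|_|) => apply: cont_norm
  | |- continuous (GRing.mul ?c) => apply: (@contM _ (fun=> c) (fun y => y))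
  | |- continuous (GRing.add ?c) => apply: (@contD _ (fun=> c) (fun y => y))
  | |- _ => first [cont_leaf | simple apply cont_cst]
  end.
Ltac ccont := repeat cont_step.

Section integral.
Variable R : realType.
Implicit Types (f g : R -> R) (x a b c d : R).

(** The signed integral from 0 to x: one of the two intervals is empty or
    reduced to a point. *)
Definition prim f x : R :=
  \int[leb R]_(t in `[0, x]) f t - \int[leb R]_(t in `[x, 0]) f t.

Lemma cont_itv_integrable f a b : continuous f ->
  (leb R).-integrable `[a, b] (EFin \o f).
Proof.
move=> cf; apply: continuous_compact_integrable; first exact: segment_compact.
exact: continuous_subspaceT.
Qed.

Lemma prim_der f : continuous f -> der (prim f) f.
Proof.
move=> cf x.
pose a := Num.min x 0 - 1.
have ax : a < x by rewrite /a; case: (leP x 0) => ?; lra.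
have a0 : a < 0 by rewrite /a; case: (leP x 0) => ?; lra.
pose F y := \int[leb R]_(t in `[a, y]) f t.
have dF : dat F x (f x).
  have xx : x < x + 1 by lra.
  have [h1 h2] := continuous_FTC1_closed xx (@cont_itv_integrable f a (x + 1) cf) ax (cf x).
  by rewrite -h2; exact: derivable_dat.
apply: (@dat_near _ (fun y => F y - F 0)); last first.
  by apply: dat_eq; [apply: datD; [exact: dF|apply: dat_cst]|rewrite addr0].
have : \forall y \near x, a < y by exact: lt_nbhsr.
apply: filterS => y ay; rewrite /prim /F.
have key u v : a < u -> u <= v ->
   \int[leb R]_(t in `[a, v]) f t - \int[leb R]_(t in `[a, u]) f t =
   \int[leb R]_(t in `[u, v]) f t.
  move=> au uv.
  rewrite Rintegral_itvB ?bnd_simp//; last 2 first.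
    exact: cont_itv_integrable.
    by rewrite ltW.
  by rewrite Rintegral_itv_obnd_cbnd //; apply: integrableS (@cont_itv_integrable f u v cf) => //; exact: subset_itv_oc_cc.
have kz u : \int[leb R]_(t in `[u, u]) f t = 0 by rewrite set_itv1 Rintegral_set1.
case: (ltgtP 0 y) => [y0|y0|<-].
- rewrite key ?(ltW y0) // [X in _ = _ - X](_ : _ = 0) ?subr0 //.
  by rewrite set_itv_ge ?Rintegral_set0 // bnd_simp -ltNge.
- rewrite -opprB key ?(ltW y0) // [X in _ = X - _](_ : _ = 0) ?sub0r //.
  by rewrite set_itv_ge ?Rintegral_set0 // bnd_simp -ltNge.
- by rewrite kz !subrr.
Qed.

(** Increments of a primitive rather than integrals over [a, b]: the calculus
    rules then hold for all a and b, with no integrability side conditions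
    besides continuity, and follow from those for derivatives. *)
Definition Int a b f := prim f b - prim f a.

Lemma IntE f F a b : continuous f -> der F f -> Int a b f = F b - F a.
Proof.
move=> cf dF; rewrite /Int.
suff : prim f b - F b = prim f a - F a by move=> h; lra.
apply: (@der0_cst _ (fun x => prim f x - F x)) => x.
have dp := prim_der cf.
by ddat.
Qed.

Lemma Int_le a b f g : a <= b -> continuous f -> continuous g ->
  (forall x, a <= x <= b -> f x <= g x) -> Int a b f <= Int a b g.
Proof.
move=> ab cf cg fg; rewrite /Int.
suff : prim g a - prim f a <= prim g b - prim f b by move=> h; lra.
have dp := prim_der cf; have dq := prim_der cg.
apply: (@der_ge0_le _ (fun x => prim g x - prim f x) (fun x => g x - f x)) => //.
  by move=> x _; ddat.
by move=> x xab; rewrite subr_ge0 fg.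
Qed.

Lemma Int_ge0 a b f : a <= b -> continuous f ->
  (forall x, a <= x <= b -> 0 <= f x) -> 0 <= Int a b f.
Proof.
move=> ab cf f0; rewrite subr_ge0; apply: (@der_ge0_le _ (prim f) f a b ab) => //.
by move=> x _; exact: prim_der.
Qed.

Lemma IntD a b f g : continuous f -> continuous g ->
  Int a b (fun x => f x + g x) = Int a b f + Int a b g.
Proof.
move=> cf cg; have dp := prim_der cf; have dq := prim_der cg.
rewrite (@IntE _ (fun x => prim f x + prim g x)); [|exact: contD|].
  by rewrite /Int; ring.
by move=> x; ddat.
Qed.

Lemma IntZ a b c f : continuous f ->
  Int a b (fun x => c * f x) = c * Int a b f.
Proof.
move=> cf; have dp := prim_der cf.
rewrite (@IntE _ (fun x => c * prim f x)); [|by ccont|].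
  by rewrite /Int; ring.
by move=> x; ddat.
Qed.

Lemma IntN a b f : continuous f ->
  Int a b (fun x => - f x) = - Int a b f.
Proof.
move=> cf; under [X in Int _ _ X]funext do rewrite -mulN1r.
by rewrite IntZ// mulN1r.
Qed.

Lemma IntB a b f g : continuous f -> continuous g ->
  Int a b (fun x => f x - g x) = Int a b f - Int a b g.
Proof. by move=> cf cg; rewrite IntD ?IntN//; exact: contN. Qed.

Lemma IntC f a b c : Int a c f = Int a b f + Int b c f.
Proof. by rewrite /Int; ring. Qed.

Lemma Rintegral_Int f a b : a <= b -> continuous f ->
  \int[leb R]_(t in `[a, b]) f t = Int a b f.
Proof.
rewrite le_eqVlt => /predU1P[<- _|ab cf].
  by rewrite set_itv1 Rintegral_set1 /Int subrr.
have dp := prim_der cf.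
rewrite /Rintegral (@continuous_FTC2 _ f (prim f)) //.
- exact: continuous_subspaceT.
- split.
  + by move=> x _; case: (dp x).
  + by apply: cvg_at_right_filter; exact: der_cont dp a.
  + by apply: cvg_at_left_filter; exact: der_cont dp b.
- by move=> x _; rewrite (der_derive1 dp).
Qed.

End integral.

(** * Smooth plateau functions *)

Section smooth_step.
Variable R : realType.
Implicit Types (f g : R -> R) (x a b c d : R).

Lemma dat_sq f C : (forall y, `|f y| <= C * y ^+ 2) -> dat f 0 0.
Proof.
move=> h.
have f0 : f 0 = 0.
  by apply/eqP; rewrite -normr_le0 (le_trans (h 0))// expr0n mulr0.
have C0 : 0 <= C by have := h 1; rewrite expr1n mulr1; apply: le_trans.
suff cv : (fun t : R => t^-1 *: (f (t *: (1:R) + 0) - f 0)) @ 0^' --> (0 : R).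
  split; first by apply/cvg_ex; exists 0.
  exact: cvg_lim cv.
apply/cvgrPdist_le => /= e e0.
have C1 : 0 < C + 1 by lra.
near=> t.
have t0 : t != 0 by near: t; exact: nbhs_dnbhs_neq.
have te : `|t| <= e / (C + 1).
  by near: t; apply: dnbhs0_le; rewrite divr_gt0.
rewrite f0 sub0r subr0 addr0 normrN /GRing.scale /= mulr1 normrM normfV.
rewrite ler_pdivrMl ?normr_gt0// (le_trans (h t))//.
rewrite -[t ^+ 2]real_normK ?num_real// expr2 mulrA mulrC.
apply: ler_wpM2l => //.
move: te; rewrite ler_pdivlMr// => te; have := normr_ge0 t; nra.
Unshelve. all: by end_near. Qed.

(** The functions x^-i exp(-1/x) extended by 0: up to linear combinations they
    are stable under differentiation, which makes the smoothness of the bump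
    below an induction without derivatives of high order. *)
Definition flat (i : nat) x : R :=
  if 0 < x then x^-1 ^+ i * expR (- x^-1) else 0.

Lemma pow_le_exp (n : nat) x : 0 <= x -> x ^+ n <= n%:R ^+ n * expR x.
Proof.
case: n => [|n] x0; first by rewrite !expr0 mul1r -expR0 ler_expR.
have h : x / n.+1%:R <= expR (x / n.+1%:R).
  by apply: le_trans (expR_ge1Dx _); rewrite lerDr.
have n0 : 0 < n.+1%:R :> R by rewrite ltr0n.
have -> : expR x = expR (x / n.+1%:R) ^+ n.+1.
  by rewrite -expRM_natl -[_ *+ _]mulr_natl mulrCA divff ?mulr1// gt_eqF.
rewrite -exprMn; apply: lerXn2r; rewrite ?nnegrE ?mulr_ge0 ?expR_ge0//.
by rewrite -ler_pdivrMl// mulrC.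
Qed.

Lemma flat_ge0 i x : 0 <= flat i x.
Proof.
rewrite /flat; case: ifP => // x0.
by rewrite mulr_ge0 ?expR_ge0// exprn_ge0// invr_ge0 ltW.
Qed.

(** A quadratic bound at 0, enough for differentiability there, because the
    exponential dominates x^-(i+2). *)
Lemma flat_sq i x : `|flat i x| <= i.+2%:R ^+ i.+2 * x ^+ 2.
Proof.
rewrite ger0_norm ?flat_ge0// /flat; case: ifP => x0; last first.
  by rewrite mulr_ge0 ?sqr_ge0// exprn_ge0.
rewrite expRN ler_pdivrMr ?expR_gt0//.
have xi : 0 <= x^-1 by rewrite invr_ge0 ltW.
have h := @pow_le_exp i.+2 _ xi.
rewrite mulrAC -(ler_pM2r (_ : 0 < x^-1 ^+ 2)); last by rewrite exprn_gt0// invr_gt0.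
rewrite -exprD addn2 -[X in _ <= X]mulrA -exprMn divff ?gt_eqF// expr1n mulr1.
exact: h.
Qed.

Lemma dat_exp x : dat (@expR R) x (expR x).
Proof. exact: is_derive_expR. Qed.

Lemma flat_der i : der (flat i) (fun x => flat i.+2 x - i%:R * flat i.+1 x).
Proof.
move=> x; case: (ltgtP 0 x) => [x0|x0|<-].
- have e : \forall y \near x, y^-1 ^+ i * expR (- y^-1) = flat i y.
    have : \forall y \near x, 0 < y by exact: lt_nbhsr.
    by apply: filterS => y y0; rewrite /flat y0.
  apply: dat_near e _.
  have xn0 : x != 0 by rewrite gt_eqF.
  have h : dat (fun y : R => expR (- y^-1)) x (expR (- x^-1) * (x^-1 ^+ 2)).
    apply: dat_eq.
      apply: (@dat_comp _ (@expR R) (fun y => - y^-1)); [exact: dat_exp|by repeat dat_step].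
    by rewrite /=; field.
  apply: dat_eq; first by repeat dat_step.
  rewrite /= /flat x0; case: i => [|i]; first by rewrite !expr0 /=; field.
  by rewrite /= !exprS; field.
- have e : \forall y \near x, 0 = flat i y.
    have : \forall y \near x, y < 0 by exact: lt_nbhsl.
    by apply: filterS => y y0; rewrite /flat ltNge (ltW y0).
  apply: dat_near e _.
  by apply: dat_eq; [apply: dat_cst|rewrite /flat ltNge (ltW x0)/= mulr0 subr0].
- apply: dat_eq; first exact: dat_sq (flat_sq i).
  by rewrite /flat ltxx mulr0 subr0.
Qed.

(** A class of functions stable under differentiation by construction; it
    contains a bump, its primitive, and the rescaled differences of it that
    serve as test functions. *)
Inductive smooth_class : (R -> R) -> Prop :=
| smooth_bump i j : smooth_class (fun x => flat i x * flat j (1 - x))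
| smooth_lin c f g : smooth_class f -> smooth_class g ->
    smooth_class (fun x => c * f x + g x)
| smooth_affine k m f : smooth_class f -> smooth_class (fun x => f (k * x + m))
| smooth_prim f f' : der f f' -> smooth_class f' -> smooth_class f.

Lemma smooth_class_der f : smooth_class f ->
  exists2 f', der f f' & smooth_class f'.
Proof.
elim=> {f} [i j|c f g _ [f' df sf] _ [g' dg sg]|k m f _ [f' df sf]|f f' df sf _].
- pose T (p q : nat) := fun x : R => flat p x * flat q (1 - x).
  exists (fun x => j%:R * T i j.+1 x + ((-1) * T i j.+2 x +
      ((- i%:R) * T i.+1 j x + T i.+2 j x))).
    move=> x; have di := flat_der i; have dj := flat_der j.
    have h : dat (fun y => flat j (1 - y)) x (- (flat j.+2 (1 - x) - j%:R * flat j.+1 (1 - x))).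
      apply: dat_eq; first by apply: (@dat_comp _ (flat j) (fun y => 1 - y)); [exact: dj|repeat dat_step].
      by rewrite /=; ring.
    ddat. rewrite /T; ring.
  by do ! (apply: smooth_lin); exact: smooth_bump.
- exists (fun x => c * f' x + g' x); last exact: smooth_lin.
  by move=> x; ddat.
- exists (fun x => (k - 1) * f' (k * x + m) + f' (k * x + m)).
    move=> x; apply: dat_eq; first by apply: (@dat_comp _ f (fun y => k * y + m)); [exact: df|repeat dat_step].
    by rewrite /=; ring.
  by apply: smooth_lin; exact: (smooth_affine k m sf).
- by exists f'.
Qed.

Lemma smooth_class_derivable f : smooth_class f ->
  forall n x, derivable (f^`(n))%classic x 1.
Proof.
move=> sf n x; suff : smooth_class (f^`(n))%classic.
  by move=> /smooth_class_der[f' df _]; exact: dat_derivable (df x).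
elim: n => [|n ih]; first by rewrite derive1n0.
rewrite derive1nS; have [f' df sf'] := smooth_class_der ih.
by rewrite (der_derive1 df).
Qed.

Definition bump x := flat 0 x * flat 0 (1 - x).

Lemma smooth_class_bump : smooth_class bump.
Proof. exact: smooth_bump. Qed.

Lemma cont_bump : continuous bump.
Proof.
by have [f' df _] := smooth_class_der smooth_class_bump; exact: der_cont df.
Qed.

Lemma bump_ge0 x : 0 <= bump x.
Proof. by rewrite mulr_ge0 ?flat_ge0. Qed.

Lemma bump_out x : x <= 0 \/ 1 <= x -> bump x = 0.
Proof.
rewrite /bump /flat; case=> h; first by rewrite ltNge h mul0r.
by rewrite [0 < 1 - x]ltNge subr_le0 h mulr0.
Qed.

Definition bump_mass := Int 0 1 bump.

(** If the integral were zero, the nondecreasing primitive would be constant on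
    [0, 1], against the positivity of the bump at 1/2. *)
Lemma bump_mass_gt0 : 0 < bump_mass.
Proof.
rewrite /bump_mass lt_neqAle Int_ge0// ?andbT; last 2 first.
- exact: cont_bump.
- by move=> x _; exact: bump_ge0.
apply/eqP => h0.
have dp := prim_der cont_bump.
have cst x : 0 <= x <= 1 -> prim bump x = prim bump 0.
  move=> /andP[x0 x1]; apply/eqP; rewrite eq_le; apply/andP; split.
    apply: (@le_trans _ _ (prim bump 1)).
      by apply: (der_ge0_le x1 (fun y _ => dp y)) => y _; exact: bump_ge0.
    by move: h0; rewrite /Int => /eqP; rewrite eq_sym subr_eq0 => /eqP ->.
  by apply: (der_ge0_le x0 (fun y _ => dp y)) => y _; exact: bump_ge0.
have : bump (2^-1) = 0.
  apply: (@dat_unique _ (prim bump) 2^-1); first exact: dp.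
  apply: (@dat_near _ (fun=> prim bump 0)); last exact: dat_cst.
  near=> y; apply/esym/cst; apply/andP; split; apply: ltW.
    by near: y; apply: lt_nbhsr; lra.
  by near: y; apply: lt_nbhsl; lra.
apply/eqP; rewrite gt_eqF// /bump /flat.
have -> : 0 < 2^-1 :> R by lra.
have -> : 0 < 1 - 2^-1 :> R by lra.
by rewrite !expr0 !mul1r mulr_gt0 ?expR_gt0.
Unshelve. all: by end_near. Qed.

Definition step x := (Int 0 x bump) / bump_mass.
Definition dstep x := bump x / bump_mass.

Lemma step_der : der step dstep.
Proof.
by move=> x; have dp := prim_der cont_bump; rewrite /step /dstep /Int; ddat.
Qed.

Lemma cont_dstep : continuous dstep.
Proof. by apply: contM; [exact: cont_bump|exact: cont_cst]. Qed.

Lemma dstep_ge0 x : 0 <= dstep x.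
Proof. by rewrite divr_ge0 ?bump_ge0// ltW// bump_mass_gt0. Qed.

Lemma dstep_out x : x <= 0 \/ 1 <= x -> dstep x = 0.
Proof. by move=> h; rewrite /dstep bump_out// mul0r. Qed.

Lemma step_le a b : a <= b -> step a <= step b.
Proof.
move=> ab; apply: (der_ge0_le ab (fun y _ => step_der y)) => y _.
exact: dstep_ge0.
Qed.

Lemma step0 : step 0 = 0.
Proof. by rewrite /step /Int subrr mul0r. Qed.

Lemma step1 : step 1 = 1.
Proof. by rewrite /step divff// gt_eqF// bump_mass_gt0. Qed.

Lemma step_left x : x <= 0 -> step x = 0.
Proof.
move=> x0; have [c cx e] := MVT_le x0 (fun y _ => step_der y).
move: e; rewrite dstep_out ?mul0r ?step0; last by left; case/andP: cx.
by move=> h; lra.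
Qed.

Lemma step_right x : 1 <= x -> step x = 1.
Proof.
move=> x0; have [c cx e] := MVT_le x0 (fun y _ => step_der y).
move: e; rewrite dstep_out ?mul0r ?step1; last by right; case/andP: cx.
by move=> h; lra.
Qed.

Lemma step_itv x : 0 <= step x <= 1.
Proof.
apply/andP; split; case: (leP x 0) => h.
- by rewrite step_left.
- by rewrite -step0 step_le// ltW.
- by rewrite step_left// ler01.
case: (leP x 1) => h1; last by rewrite step_right// ltW.
by rewrite -step1 step_le.
Qed.

Lemma dstep_bounded : exists2 M, 0 < M & forall x, dstep x <= M.
Proof.
have [c c01 hc] := @EVT_max R dstep 0 1 ler01 (continuous_subspaceT cont_dstep).
exists (dstep c + 1); first by have := dstep_ge0 c; lra.
move=> x; case: (leP x 0) => x0.
  by rewrite dstep_out; [have := dstep_ge0 c; lra|left].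
case: (leP 1 x) => x1; first by rewrite dstep_out; [have := dstep_ge0 c; lra|right].
have hx : x \in `[0, 1]%R by rewrite in_itv /= !ltW.
by have := hc _ hx; lra.
Qed.

(** The derivative of a plateau that rises on [a, a + dl] and falls on
    [b, b + dl] is the difference of two mollifiers, so that testing a weak
    derivative on it compares averages near a and near b. *)
Definition mollifier dl a x := dstep ((x - a) / dl) / dl.
Definition plateau dl a b x := step ((x - a) / dl) - step ((x - b) / dl).

Lemma step_shift_der dl a : dl != 0 ->
  der (fun x => step ((x - a) / dl)) (mollifier dl a).
Proof.
move=> d0 x; apply: dat_eq.
  by apply: (@dat_comp _ step (fun y => (y - a) / dl)); [exact: step_der|repeat dat_step].
by rewrite /mollifier /=; field.
Qed.

Lemma plateau_der dl a b : dl != 0 ->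
  der (plateau dl a b) (fun x => mollifier dl a x - mollifier dl b x).
Proof.
move=> d0 x; apply: datD; [exact: step_shift_der|apply: datN; exact: step_shift_der].
Qed.

Lemma smooth_class_step : smooth_class step.
Proof.
apply: smooth_prim step_der _.
rewrite (_ : dstep = fun x => (bump_mass^-1 - 1) * bump x + bump x).
  by apply: smooth_lin; exact: smooth_class_bump.
by apply/funext => x; rewrite /dstep; ring.
Qed.

Lemma plateau_out dl a b x : 0 < dl -> a <= b -> x <= a \/ b + dl <= x ->
  plateau dl a b x = 0.
Proof.
move=> d0 ab; rewrite /plateau => -[h|h].
  rewrite !step_left ?subrr// pmulr_lle0 ?invr_gt0//; lra.
by rewrite !step_right ?subrr// ler_pdivlMr//; lra.
Qed.

Lemma plateau_test dl a b : 0 < dl -> a <= b -> test_function (plateau dl a b).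
Proof.
move=> d0 ab; split.
  apply: smooth_class_derivable.
  rewrite (_ : plateau dl a b = fun x => (-1) * step (dl^-1 * x + (- b / dl)) + step (dl^-1 * x + (- a / dl))).
    by apply: smooth_lin; apply: (smooth_affine _ _ smooth_class_step).
  apply/funext => x; rewrite /plateau.
  have e c : dl^-1 * x + - c / dl = (x - c) / dl by field; rewrite gt_eqF.
  by rewrite !e; ring.
apply: (@subclosed_compact _ _ `[a, b + dl]); first exact: closed_closure.
  exact: segment_compact.
apply: (@subset_trans _ (closure `[a, b + dl])).
  apply: closureS => x /=; rewrite in_itv /= => h.
  apply/andP; split; rewrite leNgt; apply/negP => h1; move: h => /eqP; apply.
    by apply: plateau_out => //; left; exact: ltW.
  by apply: plateau_out => //; right; exact: ltW.
by have <- := (closure_id `[a, b + dl]).1 (interval_closed _ _).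
Qed.

Lemma plateau_norm dl a b x : `|plateau dl a b x| <= 1.
Proof.
rewrite /plateau; have /andP[? ?] := step_itv ((x - a) / dl).
have /andP[? ?] := step_itv ((x - b) / dl).
by rewrite ler_norml; apply/andP; split; lra.
Qed.

End smooth_step.

(** * Mollification at Lebesgue points *)

Section local_integrability.
Variable R : realType.
Implicit Types (u v f g : R -> R) (x a b c d : R).

Lemma igD (D : set (measurableTypeR R)) f g : measurable D -> (leb R).-integrable D (EFin \o f) ->
  (leb R).-integrable D (EFin \o g) ->
  (leb R).-integrable D (EFin \o (fun x => f x + g x)).
Proof.
move=> mD hf hg; have := integrableD mD hf hg.
by rewrite (_ : (_ \+ _)%E = EFin \o (fun x => f x + g x)).
Qed.

Lemma igB (D : set (measurableTypeR R)) f g : measurable D -> (leb R).-integrable D (EFin \o f) ->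
  (leb R).-integrable D (EFin \o g) ->
  (leb R).-integrable D (EFin \o (fun x => f x - g x)).
Proof.
move=> mD hf hg; have := integrableB mD hf hg.
by rewrite (_ : (fun x => _ - _)%E = EFin \o (fun x => f x - g x)).
Qed.

Lemma igZ (D : set (measurableTypeR R)) f c : measurable D -> (leb R).-integrable D (EFin \o f) ->
  (leb R).-integrable D (EFin \o (fun x => c * f x)).
Proof.
move=> mD hf; have := integrableZl mD c hf.
by rewrite (_ : (fun x => _ * _)%E = EFin \o (fun x => c * f x)).
Qed.

Lemma ig_norm (D : set (measurableTypeR R)) f : (leb R).-integrable D (EFin \o f) ->
  (leb R).-integrable D (EFin \o (fun x => `|f x|)).
Proof. exact: integrable_norm. Qed.

Definition locint u := measurable_fun setT u /\
  forall a b, (leb R).-integrable `[a, b] (EFin \o u).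

Lemma cont_measurable f : continuous f -> measurable_fun setT f.
Proof. exact: continuous_measurable_fun. Qed.

Lemma cont_locint f : continuous f -> locint f.
Proof.
move=> cf; split; first exact: cont_measurable.
by move=> a b; exact: cont_itv_integrable.
Qed.

Lemma Lfun2_measurable u : u \in Lfun (leb R) 2%:E -> measurable_fun setT u.
Proof. by rewrite inE => /andP[]; rewrite inE. Qed.

Lemma Lfun2_locint u : u \in Lfun (leb R) 2%:E -> locint u.
Proof.
move=> hu; have mu := Lfun2_measurable hu; split => // a b.
have h := Lfun2_integrable_sqr hu.
have h2 : (leb R).-integrable `[a, b] (EFin \o (fun x => u x ^+ 2 + 1)).
  apply: igD => //.
    exact: integrableS h.
  by apply: cont_itv_integrable; exact: cont_cst.
apply: le_integrable h2 => //.
  by apply/measurable_EFinP; exact: measurable_funTS.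
move=> x _ /=; rewrite lee_fin [X in _ <= X]ger0_norm; last by rewrite addr_ge0 ?sqr_ge0.
rewrite -[u x ^+ 2]real_normK ?num_real//.
by have := sqr_ge0 (`|u x| - 1); have := normr_ge0 (u x); nra.
Qed.

Lemma locint_locally u : locint u -> locally_integrable [set: R] u.
Proof.
move=> [mu iu]; split => //; first exact: openT.
move=> K _ cK.
have [M [_ hM]] := compact_bounded cK.
have sK : K `<=` `[- (M + 1), M + 1].
  move=> x Kx /=; rewrite in_itv /=.
  rewrite -ler_norml; exact: (hM (M + 1) (ltr_pwDr ltr01 (lexx M)) x Kx).
have mK := compact_measurable cK.
have /integrableP[_] := iu (- (M + 1)) (M + 1).
apply: le_lt_trans; apply: ge0_subset_integral => //.
apply/measurable_EFinP; apply: measurableT_comp => //.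
exact: measurable_funTS.
Qed.

Lemma cont_bounded_itv f a b : continuous f -> [bounded f x | x in `[a, b]].
Proof.
move=> cf.
have : compact (f @` `[a, b]).
  apply: continuous_compact; last exact: segment_compact.
  exact: continuous_subspaceT.
move=> /compact_bounded [M [Mr hM]]; exists M; split => // y My x xab.
by apply: (hM y My); exists x.
Qed.

Lemma locintM u f a b : locint u -> continuous f ->
  (leb R).-integrable `[a, b] (EFin \o (fun x => u x * f x)).
Proof.
move=> [mu iu] cf.
have mab : measurable (`[a, b] : set (measurableTypeR R)) by [].
have mf : measurable_fun (`[a, b] : set (measurableTypeR R)) f.
  exact: measurable_funTS (cont_measurable cf).
have := integrableMl mab (iu a b) mf (@cont_bounded_itv f a b cf).
by rewrite (_ : (_ \* _)%E = EFin \o (fun x => u x * f x)).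
Qed.

Lemma Rintegral_supp f a b : (forall x, ~ (a <= x <= b) -> f x = 0) ->
  \int[leb R]_x f x = \int[leb R]_(x in `[a, b]) f x.
Proof.
move=> h; rewrite [RHS]Rintegral_mkcond; congr (Rintegral _ _ _).
apply/funext => x; rewrite patchE; case: ifPn => // /negP hx.
by apply: h => /= xab; apply: hx; rewrite inE /= in_itv.
Qed.

End local_integrability.

Section du_bois_reymond.
Variable R : realType.
Implicit Types (u v f g : R -> R) (x a b c d : R).

Lemma mollifier_ge0 dl a x : 0 < dl -> 0 <= mollifier dl a x.
Proof. by move=> d0; rewrite divr_ge0 ?dstep_ge0// ltW. Qed.

Lemma cont_mollifier dl a : continuous (mollifier dl a).
Proof.
apply: contM; last exact: cont_cst.
apply: (@cont_comp _ (@dstep R) (fun x => (x - a) / dl)); first exact: cont_dstep.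
by ccont.
Qed.

Lemma mollifier_out dl a x : 0 < dl -> x <= a \/ a + dl <= x ->
  mollifier dl a x = 0.
Proof.
move=> d0 h; rewrite /mollifier dstep_out ?mul0r//; case: h => h.
  by left; rewrite pmulr_lle0 ?invr_gt0//; lra.
by right; rewrite ler_pdivlMr//; lra.
Qed.

Lemma mollifier_mass dl a c d : 0 < dl -> c <= a -> a + dl <= d ->
  \int[leb R]_(x in `[c, d]) mollifier dl a x = 1.
Proof.
move=> d0 ca ad.
rewrite Rintegral_Int; [|lra|exact: cont_mollifier].
rewrite (IntE _ _ (@cont_mollifier dl a) (@step_shift_der _ dl a _)); last by rewrite gt_eqF.
rewrite step_right ?step_left ?subr0//.
  by rewrite pmulr_lle0 ?invr_gt0//; lra.
by rewrite ler_pdivlMr//; lra.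
Qed.

Lemma locint_absB u a c d : locint u ->
  (leb R).-integrable `[c, d] (EFin \o (fun x => `|u x - u a|)).
Proof.
move=> [mu iu].
have : (leb R).-integrable `[c, d] (EFin \o (fun x => u x - u a)).
  apply: igB => //.
  by apply: cont_itv_integrable; exact: cont_cst.
exact: integrable_norm.
Qed.

Lemma lebesgue_pt_avg u a : locint u -> lebesgue_pt u a ->
  forall e, 0 < e -> \forall t \near 0^'+,
    \int[leb R]_(x in ball a t) `|u x - u a| <= e * t.
Proof.
move=> lu /fine_cvgP[hfin hcv] e e0.
move/cvgrPdist_le: hcv => /(_ (e / 2)) => hcv.
near=> t.
have t0 : 0 < t by near: t; exact: nbhs_right_gt.
have h2 : `|0 - (fine \o davg u a) t| <= e / 2.
  by near: t; apply: hcv; rewrite divr_gt0.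
move: h2; rewrite sub0r normrN ger0_norm /=; last by rewrite fine_ge0// davg_ge0.
rewrite /davg /iavg /=.
rewrite (lebesgue_measure_ball _ (ltW t0)) inver.
have t20 : 0 < t *+ 2 by rewrite mulrn_wgt0.
rewrite (gt_eqF t20) fineM //; last first.
  have mb : measurable (ball a t : set (measurableTypeR R)) by exact: measurable_ball.
  apply: (integrable_fin_num mb); apply: integrableS (@locint_absB u a (a - t) (a + t) lu) => //.
  by rewrite ball_itv; exact: subset_itv_oo_cc.
rewrite /= ler_pdivrMl// => h; apply: le_trans h _.
by rewrite -[t *+ 2]mulr_natl; lra.
Unshelve. all: by end_near. Qed.

(** The mollifier is supported in [a, a + dl] and bounded by a constant over dl,
    hence dominated by the averages over balls that converge at Lebesgue
    points. *)
Lemma mollifier_cvg u a c d : locint u -> lebesgue_pt u a -> c < a -> a < d ->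
  forall e, 0 < e -> \forall dl \near 0^'+,
  `|\int[leb R]_(x in `[c, d]) (u x * mollifier dl a x) - u a| <= e.
Proof.
move=> lu lp ca ad e e0.
have [M M0 hM] := dstep_bounded R.
have [r /= r0 hr] := lebesgue_pt_avg lu lp (divr_gt0 e0 (mulr_gt0 (ltr0n R 2) M0)).
near=> dl.
have d0 : 0 < dl by near: dl; exact: nbhs_right_gt.
have d1 : dl < r / 2 by near: dl; apply: nbhs_right_lt; lra.
have d2 : dl < (d - a) / 2 by near: dl; apply: nbhs_right_lt; lra.
have d3 : dl < (a - c) / 2 by near: dl; apply: nbhs_right_lt; lra.
have [k1 k2] : c < a - dl *+ 2 /\ a + dl *+ 2 < d by rewrite -mulr_natl; split; lra.
have [k3 k4] : a - dl *+ 2 <= a /\ a + dl <= a + dl *+ 2 by rewrite -mulr_natl; split; lra.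
have dl2 : 0 < 2 * dl < r by apply/andP; split; lra.
have cm := @cont_mollifier dl a.
have mcd : measurable (`[c, d] : set (measurableTypeR R)) by [].
have iua : (leb R).-integrable `[c, d] (EFin \o (fun x => u a * mollifier dl a x)).
  by apply: cont_itv_integrable; ccont.
have ium := @locintM _ u (mollifier dl a) c d lu cm.
have -> : u a = \int[leb R]_(x in `[c, d]) (u a * mollifier dl a x).
  rewrite RintegralZl //; last exact: cont_itv_integrable.
  by rewrite mollifier_mass ?mulr1//; [exact: ltW|exact: le_trans k4 (ltW k2)].
rewrite -RintegralB//.
apply: (@le_trans _ _ (\int[leb R]_(x in `[c, d]) `|u x * mollifier dl a x - u a * mollifier dl a x|)).
  apply: le_normr_Rintegral => //.
  exact: igB.
pose B : set R := ball a (dl *+ 2).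
have mB : measurable (B : set (measurableTypeR R)) by exact: measurable_ball.
have sB : B `<=` `[c, d].
  rewrite /B ball_itv => x /=; rewrite !in_itv /= => /andP[xl xr].
  by rewrite (ltW (lt_trans k1 xl)) (ltW (lt_trans xr k2)).
have iab := @locint_absB u a c d lu.
have iab' : (leb R).-integrable `[c, d] (EFin \o (fun x => M / dl * `|u x - u a|)).
  exact: igZ.
apply: (@le_trans _ _ (\int[leb R]_(x in `[c, d]) ((fun x => M / dl * `|u x - u a|) \_ B) x)).
  apply: le_Rintegral => //.
  - by apply: ig_norm; exact: igB.
  - rewrite -restrict_EFin; apply/integrable_restrict => //.
    by apply: integrableS iab' => //; exact: measurableI.
  - move=> x _; rewrite patchE; case: ifPn => xB.
      rewrite -mulrBl normrM mulrC ler_wpM2r// ger0_norm ?mollifier_ge0//.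
      by rewrite /mollifier; apply: ler_wpM2r; [rewrite invr_ge0 ltW|exact: hM].
    rewrite mollifier_out// ?mulr0 ?subrr ?normr0//.
    move: xB; rewrite notin_setE /B ball_itv /= in_itv /= => /negP.
    rewrite negb_and -!leNgt => /orP[|] h.
      by left; exact: le_trans h k3.
    by right; exact: le_trans k4 h.
rewrite -Rintegral_mkcondr setIidr//.
rewrite RintegralZl//; last exact: integrableS iab.
have := hr (dl *+ 2); rewrite /= sub0r normrN ger0_norm; last by rewrite mulrn_wge0// ltW.
rewrite -[dl *+ 2]mulr_natl => /(_ _ _) h.
apply: (@le_trans _ _ (M / dl * (e / (2 * M) * (2 * dl)))).
  apply: ler_wpM2l; first by rewrite divr_ge0// ltW.
  by rewrite /B -[dl *+ 2]mulr_natl; apply: h; case/andP: dl2.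
by rewrite le_eqVlt; apply/orP; left; apply/eqP; field; rewrite !gt_eqF.
Unshelve. all: by end_near. Qed.

End du_bois_reymond.

(** * Continuous representatives of weakly differentiable functions *)

Section increments.
Variable R : realType.
Implicit Types (u v f g : R -> R) (x a b c d : R).

Lemma locint_dominated v (f_ : nat -> R -> R) f c d : locint v ->
  (forall n, continuous (f_ n)) -> measurable_fun setT f ->
  (forall n x, `|f_ n x| <= 1) ->
  (forall x, f_ n x @[n --> \oo] --> f x) ->
  \int[leb R]_(x in `[c, d]) (v x * f_ n x) @[n --> \oo] -->
  \int[leb R]_(x in `[c, d]) (v x * f x).
Proof.
move=> lv cf mf b1 cv.
have [mv iv] := lv.
have mcd : measurable (`[c, d] : set (measurableTypeR R)) by [].
have [|||||i1 _ h] := @dominated_convergence _ _ _ (leb R) _ mcd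
   (fun n => EFin \o (fun x => v x * f_ n x)) (EFin \o (fun x => v x * f x))
   (EFin \o (fun x => `|v x|)).
- by move=> n; have /integrableP[] := @locintM _ v (f_ n) c d lv (cf n).
- by apply/measurable_EFinP/measurable_funTS; exact: measurable_funM.
- apply: aeW => x _ /=; apply: cvg_EFin; first exact: nearW.
  by apply: cvgM; [exact: cvg_cst|exact: cv].
- exact: ig_norm.
- apply: aeW => x n _ /=; rewrite lee_fin normrM.
  by rewrite -[leRHS]mulr1; apply: ler_wpM2l.
apply: fine_cvg; move: h; rewrite fineK//; exact: integrable_fin_num.
Qed.

Lemma near_right_seq (P : R -> Prop) : (\forall t \near 0^'+, P t) ->
  \forall n \near \oo, P (n.+1%:R^-1 : R).
Proof.
move=> [e /= e0 h].
have /cvgrPdist_lt/(_ e e0) := @cvg_harmonic R.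
apply: filterS => n; rewrite /harmonic /= => hn.
by apply: h => //=; rewrite invr_gt0.
Qed.

Lemma plateau_lim v a b c d : locint v -> c < a -> a < b -> b < d ->
  \int[leb R]_(x in `[c, d]) (v x * plateau n.+1%:R^-1 a b x) @[n --> \oo] -->
  \int[leb R]_(x in `[a, b]) v x.
Proof.
move=> lv ca ab bd; have [mv iv] := lv.
pose f : R -> R := \1_(`]a, b]).
have -> : \int[leb R]_(x in `[a, b]) v x = \int[leb R]_(x in `[c, d]) (v x * f x).
  rewrite -Rintegral_itv_obnd_cbnd; last by apply: integrableS (iv a b) => //; exact: subset_itv_oc_cc.
  rewrite -[in LHS](@setIidr _ `[c, d] `]a, b]); last first.
    by move=> x /=; rewrite !in_itv /= => /andP[? ?]; apply/andP; split; lra.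
  rewrite Rintegral_mkcondr; apply: eq_Rintegral => x _.
  by rewrite patchE /f indicE; case: (x \in _); rewrite ?mulr1 ?mulr0.
have np n : 0 < n.+1%:R^-1 :> R by rewrite invr_gt0.
apply: locint_dominated => //.
- move=> n; apply: der_cont; apply: plateau_der; exact: lt0r_neq0.
- by apply: measurable_indic.
- by move=> n x; exact: plateau_norm.
move=> x; apply: cvg_near_cst.
have key y : \forall n \near \oo, step ((x - y) / n.+1%:R^-1) = (y < x)%R%:R :> R.
  case: (ltP y x) => yx; last first.
    by apply: nearW => n; rewrite step_left// pmulr_lle0 ?invr_gt0//; lra.
  have : \forall t \near 0^'+, t < x - y by apply: nbhs_right_lt; lra.
  move=> /near_right_seq; apply: filterS => n hn.
  by rewrite step_right// ler_pdivlMr// mul1r ltW.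
have := key a; have := key b; apply: filterS2 => n h1 h2.
rewrite /plateau h1 h2 /f indicE /= [_ \in _]asboolb.
by rewrite in_itv /=; case: (ltP a x) => ax; case: (leP x b) => xb; rewrite /= ?subr0 ?subrr//; lra.
Qed.

(** Test the weak derivative on plateaus over [a, b] with edges shrinking to
    zero: one side converges to the integral of v by domination, the other to
    u a - u b by mollification. *)
Lemma weak_increment u v a b : locint u -> locint v -> weak_derivative u v ->
  lebesgue_pt u a -> lebesgue_pt u b -> a < b ->
  u b - u a = \int[leb R]_(x in `[a, b]) v x.
Proof.
move=> lu lv wd la lb ab.
pose c := a - 1; pose d := b + 2.
have ca : c < a by rewrite /c; lra.
have bd : b < d by rewrite /d; lra.
have np n : 0 < n.+1%:R^-1 :> R by rewrite invr_gt0.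
have n1 n : n.+1%:R^-1 <= 1 :> R by rewrite invf_le1// ler1n.
have limv := plateau_lim lv ca ab bd.
have moll y : lebesgue_pt u y -> c < y -> y < d ->
   \int[leb R]_(x in `[c, d]) (u x * mollifier n.+1%:R^-1 y x) @[n --> \oo] --> u y.
  move=> ly cy yd; apply/cvgrPdist_le => e e0.
  have := near_right_seq (mollifier_cvg lu ly cy yd e0).
  by apply: filterS => n; rewrite distrC.
have eqn n : - (\int[leb R]_(x in `[c, d]) (v x * plateau n.+1%:R^-1 a b x)) =
  \int[leb R]_(x in `[c, d]) (u x * mollifier n.+1%:R^-1 a x) -
  \int[leb R]_(x in `[c, d]) (u x * mollifier n.+1%:R^-1 b x).
  have nn0 := lt0r_neq0 (np n).
  have tf := @plateau_test _ n.+1%:R^-1 a b (np n) (ltW ab).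
  have := wd _ tf; rewrite (der_derive1 (@plateau_der _ _ a b nn0)).
  have out x : ~ (c <= x <= d) -> x <= a \/ b + n.+1%:R^-1 <= x.
    move=> h; case: (leP x a) => xa; first by left.
    right; rewrite leNgt; apply/negP => xb; apply: h; have := n1 n.
    by move: (n.+1%:R^-1 : R) xb; rewrite /c /d => t ? ?; apply/andP; split; lra.
  rewrite (@Rintegral_supp _ _ c d) => [|x /out h]; last first.
    have m0 y : a <= y -> y <= b -> mollifier n.+1%:R^-1 y x = 0.
      by move=> ay yb; apply: mollifier_out => //; case: h => h;
        [left; exact: le_trans h ay|right; apply: le_trans h; rewrite lerD2r].
    by rewrite !m0 ?subrr ?mulr0// ltW.
  rewrite (@Rintegral_supp _ (fun x => v x * _) c d) => [<-|x /out h]; last first.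
    by rewrite plateau_out ?mulr0// ltW.
  rewrite -RintegralB//; [|exact: locintM (@cont_mollifier _ _ _)..].
  by apply: eq_Rintegral => x _; rewrite mulrBr.
have h1 := cvgB (moll a la ca (lt_trans ab bd)) (moll b lb (lt_trans ca ab) bd).
have h2 := cvgN limv.
have : u a - u b = - (\int[leb R]_(x in `[a, b]) v x).
  rewrite -(cvg_lim (@Rhausdorff R) (h1 _)) -(cvg_lim (@Rhausdorff R) (h2 _)).
  by apply: (congr1 (fun s : nat -> R => lim (s @ \oo))); apply/funext => n; rewrite -[LHS]eqn.
by move=> h; rewrite -opprB h opprK.
Qed.

Lemma locint_itvB v a b c : locint v -> a <= b -> b <= c ->
  \int[leb R]_(t in `[a, c]) v t - \int[leb R]_(t in `[a, b]) v t =
  \int[leb R]_(t in `[b, c]) v t.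
Proof.
move=> [mv iv] ab bc; rewrite Rintegral_itvB ?bnd_simp//.
by rewrite Rintegral_itv_obnd_cbnd //; apply: integrableS (iv b c) => //; exact: subset_itv_oc_cc.
Qed.

Lemma prim_from v a x : locint v -> a <= 0 -> a <= x ->
  prim v x = \int[leb R]_(t in `[a, x]) v t - \int[leb R]_(t in `[a, 0]) v t.
Proof.
move=> lv a0 ax; rewrite /prim.
have emp y z : y < z -> \int[leb R]_(t in `[z, y]) v t = 0.
  by move=> yz; rewrite set_itv_ge ?Rintegral_set0 // bnd_simp -ltNge.
case: (ltgtP 0 x) => [y0|y0|<-].
- by rewrite (emp 0 x)// subr0 locint_itvB// ltW.
- by rewrite (emp x 0)// sub0r -[RHS]opprB locint_itvB// ltW.
- by rewrite !subrr.
Qed.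

Lemma prim_increment v a b : locint v -> a <= b ->
  prim v b - prim v a = \int[leb R]_(t in `[a, b]) v t.
Proof.
move=> lv ab; pose m := Num.min a 0.
have m0 : m <= 0 by rewrite /m ge_min lexx orbT.
have ma : m <= a by rewrite /m ge_min lexx.
rewrite (prim_from lv m0 (le_trans ma ab)) (prim_from lv m0 ma).
by rewrite -(locint_itvB lv ma ab); ring.
Qed.

Lemma prim_continuous v : locint v -> continuous (prim v).
Proof.
move=> lv x; have [mv iv] := lv.
pose a := Num.min x 0 - 1; pose b := x + 1.
have ax : a < x by rewrite /a; case: (leP x 0) => ?; lra.
have a0 : a < 0 by rewrite /a; case: (leP x 0) => ?; lra.
have xb : x < b by rewrite /b; lra.
have ab : a < b by exact: lt_trans xb.
have h := parameterized_integral_continuous (ltW ab) (iv a b).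
have hx : {for x, continuous (fun y => parameterized_integral (leb R) a y v)}.
  move/(continuous_within_itvP _ ab) : h => [h1 _ _].
  by apply: h1; rewrite in_itv /= ax.
have : (fun y => parameterized_integral (leb R) a y v - parameterized_integral (leb R) a 0 v) y @[y --> x] --> prim v x.
  rewrite (prim_from lv (ltW a0) (ltW ax)).
  by apply: cvgB; [exact: hx|exact: cvg_cst].
apply: cvg_trans; apply: near_eq_cvg.
have : \forall y \near x, a < y by exact: lt_nbhsr.
by apply: filterS => y ay; rewrite /= (prim_from lv (ltW a0) (ltW ay)).
Qed.

Lemma ae_impl (P Q : R -> Prop) : (forall x, P x -> Q x) ->
  {ae leb R, forall x, P x} -> {ae leb R, forall x, Q x}.
Proof.
by move=> PQ; apply: filterS => //; exact: (ae_filter_ringOfSetsType (leb R)).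
Qed.

Lemma ae_impl2 (P Q S : R -> Prop) : (forall x, P x -> Q x -> S x) ->
  {ae leb R, forall x, P x} -> {ae leb R, forall x, Q x} ->
  {ae leb R, forall x, S x}.
Proof.
by move=> PQ; apply: filterS2 => //; exact: (ae_filter_ringOfSetsType (leb R)).
Qed.

(** The Lebesgue measure is not zero; this picks a base point among the Lebesgue
    points. *)
Lemma ae_exists (P : R -> Prop) : {ae leb R, forall x, P x} -> exists x, P x.
Proof.
move=> h; have h0 : (0 < leb R setT)%E.
  apply: (@lt_le_trans _ _ (leb R `[0, 1])); last by rewrite le_measure ?inE.
  by rewrite lebesgue_measure_itv /= lte_fin ltr01 sube0 lte_fin.
have pf := ae_properfilter_algebraOfSetsType h0.
exact: (@filter_ex _ _ pf).
Qed.

Lemma weak_continuous u v : locint u -> locint v -> weak_derivative u v ->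
  exists ut : R -> R, [/\ continuous ut, {ae leb R, forall x, u x = ut x} &
    forall a b, a <= b -> ut b - ut a = \int[leb R]_(x in `[a, b]) v x].
Proof.
move=> lu lv wd.
have lp := lebesgue_differentiation (locint_locally lu).
have [a la] := ae_exists lp.
exists (fun x => u a + (prim v x - prim v a)); split.
- by apply: contD; [exact: cont_cst|apply: contD; [exact: prim_continuous|exact: cont_cst]].
- apply: ae_impl lp => x lx.
  case: (ltgtP a x) => [ax|xa|<-]; last by rewrite subrr addr0.
    by rewrite prim_increment ?(ltW ax)// -(weak_increment lu lv wd la lx ax); ring.
  by rewrite -[_ - _]opprB prim_increment ?(ltW xa)// -(weak_increment lu lv wd lx la xa); ring.
- by move=> b c bc; rewrite -(prim_increment lv bc); ring.
Qed.

End increments.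

(** * From distributions to classical equations and back *)

Section classical.
Variable R : realType.
Implicit Types (u v f g : R -> R) (x a b c d : R).

Lemma ae_integrable u f : measurable_fun setT f ->
  {ae leb R, forall x, u x = f x} ->
  (leb R).-integrable setT (EFin \o u) -> (leb R).-integrable setT (EFin \o f).
Proof.
move=> mf uf /integrableP[mu iu]; apply/integrableP; split.
  exact/measurable_EFinP.
apply: le_lt_trans iu; rewrite le_eqVlt; apply/orP; left; apply/eqP.
apply: ae_eq_integral => //.
- by apply/measurable_EFinP; apply: measurableT_comp.
- by apply/measurable_EFinP; apply: measurableT_comp => //; exact/measurable_EFinP.
- by apply: ae_impl uf => x e _ /=; rewrite e.
Qed.

Lemma ae_Rintegral (D : set (measurableTypeR R)) u f : measurable D ->
  measurable_fun setT u -> measurable_fun setT f ->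
  {ae leb R, forall x, u x = f x} ->
  \int[leb R]_(x in D) u x = \int[leb R]_(x in D) f x.
Proof.
move=> mD mu mf uf; congr fine; apply: ae_eq_integral => //.
- by apply/measurable_EFinP; exact: measurable_funTS.
- by apply/measurable_EFinP; exact: measurable_funTS.
- by apply: ae_impl uf => x e _ /=; rewrite e.
Qed.

Lemma support_derive1 (f : R -> R) :
  [set x | (f^`())%classic x != 0] `<=` closure [set x | f x != 0].
Proof.
move=> x /= hx; apply: contrapT => nx.
move/eqP: hx; apply.
have := (@closed_closure _ [set x | f x != 0]).
rewrite -openC => /(_ x nx) hn.
apply: dat_derive1; apply: (@dat_near _ (fun=> 0)); last exact: dat_cst.
apply: filterS hn => y /= hy; apply/esym/eqP; apply: contraPT hy => hy; apply.
exact: subset_closure.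
Qed.

Lemma test_function_derive (psi : R -> R) : test_function psi ->
  test_function (psi^`())%classic.
Proof.
move=> [sm cp]; split.
  by move=> n x; rewrite -derive1Sn; exact: sm.
apply: subclosed_compact cp _; first exact: closed_closure.
rewrite [X in _ `<=` X]((closure_id _).1 (@closed_closure _ _)).
exact/closureS/support_derive1.
Qed.

Lemma test_function_der (psi : R -> R) : test_function psi ->
  [/\ der psi (psi^`())%classic, der (psi^`())%classic (psi^`(2))%classic &
   continuous (psi^`(2))%classic].
Proof.
move=> [sm _]; split.
- by move=> x; apply: derivable_dat; exact: (sm 0%N).
- by move=> x; apply: derivable_dat; exact: (sm 1%N).
- by move=> x; apply: dat_cont; apply: derivable_dat; exact: (sm 2%N).
Qed.

Lemma test_function_bounded (psi : R -> R) : test_function psi ->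
  exists2 a, 0 < a & forall x, ~ (- a < x < a) -> psi x = 0.
Proof.
move=> [_ cp]; have [M [_ hM]] := compact_bounded cp.
have M1 : M < `|M| + 1 by rewrite (le_lt_trans (ler_norm M))// ltrDl.
exists (`|M| + 2) => [|x hx]; first by rewrite ltr_wpDl.
apply/eqP; apply: contrapT => /negP fx; apply: hx.
rewrite -ltr_norml; apply: (le_lt_trans (hM _ M1 x _)); last lra.
exact: subset_closure.
Qed.

Lemma der_of_increments u f : continuous f ->
  (forall a b, a <= b -> u b - u a = \int[leb R]_(x in `[a, b]) f x) ->
  der u f.
Proof.
move=> cf h x.
have e y : u y = u 0 + (prim f y - prim f 0).
  case: (leP 0 y) => y0.
    have := h _ _ y0; rewrite Rintegral_Int// /Int; lra.
  have := h _ _ (ltW y0); rewrite Rintegral_Int ?ltW// /Int; lra.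
rewrite (_ : u = fun y => u 0 + (prim f y - prim f 0)); last exact/funext.
have dp := prim_der cf; ddat.
Qed.

(** [ut] is the continuous representative of the H^1 function [u]; the increments
    are kept because they identify its derivative once v is known to be
    continuous. *)
Definition H1_rep u ut := exists v : R -> R,
  [/\ u \in Lfun (leb R) 2%:E, v \in Lfun (leb R) 2%:E, weak_derivative u v &
   [/\ continuous ut, {ae leb R, forall x, u x = ut x} &
    forall a b, a <= b -> ut b - ut a = \int[leb R]_(x in `[a, b]) v x]].

Lemma sobolev_H1_rep u : sobolev_H1 u -> exists ut, H1_rep u ut.
Proof.
move=> [lu [v lv wuv]].
have [u0 [cu0 uu0 iu0]] := weak_continuous (Lfun2_locint lu) (Lfun2_locint lv) wuv.
by exists u0, v.
Qed.

(** Read on psi', the equation says that f is a weak derivative of v = u'; so both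
    u and v have continuous representatives, of class C^2 and C^1. *)
Lemma weak_classical u u0 f : H1_rep u u0 -> continuous f ->
  (forall psi, test_function psi ->
     \int[leb R]_x (u x * (psi^`(2))%classic x) = \int[leb R]_x (f x * psi x)) ->
  exists u1, [/\ der u0 u1, der u1 f,
    (leb R).-integrable setT (EFin \o (fun x => u0 x ^+ 2)) &
    (leb R).-integrable setT (EFin \o (fun x => u1 x ^+ 2))].
Proof.
move=> [v [lu lv wuv [cu0 uu0 iu0]]] cf heq.
have wvf : weak_derivative v f.
  move=> psi tpsi; have := wuv _ (test_function_derive tpsi).
  have -> : ((psi^`())%classic^`())%classic = (psi^`(2))%classic by [].
  by rewrite heq// => ->; rewrite opprK.
have [u1 [cu1 uu1 iu1]] := weak_continuous (Lfun2_locint lv) (cont_locint cf) wvf.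
have mu := Lfun2_measurable lu; have mv := Lfun2_measurable lv.
exists u1; split => //.
- apply: der_of_increments => // a b ab; rewrite iu0//; apply: ae_Rintegral => //.
  exact: cont_measurable.
- exact: der_of_increments.
- apply: ae_integrable (Lfun2_integrable_sqr lu).
    by apply: cont_measurable; exact: contX.
  by apply: ae_impl uu0 => x ->.
- apply: ae_integrable (Lfun2_integrable_sqr lv).
    by apply: cont_measurable; exact: contX.
  by apply: ae_impl uu1 => x ->.
Qed.

Lemma H1_rep_pairing u ut (V psi : R -> R) : H1_rep u ut -> continuous V -> continuous psi ->
  \int[leb R]_x (V x * u x * psi x) = \int[leb R]_x (V x * ut x * psi x).
Proof.
move=> [v [lu _ _ [cut uut _]]] cV cp; have mu := Lfun2_measurable lu.
apply: ae_Rintegral => //.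
- by apply: measurable_funM; [apply: measurable_funM => //|]; exact: cont_measurable.
- by apply: cont_measurable; apply: contM => //; exact: contM.
- by apply: ae_impl uut => x ->.
Qed.

Lemma weak_eq_classical u ut p pt q qt (V : R -> R) (a b : R) :
  H1_rep u ut -> H1_rep p pt -> H1_rep q qt -> continuous V ->
  (forall psi, test_function psi ->
   - (\int[leb R]_x (u x * (psi^`(2))%classic x)) + \int[leb R]_x (V x * u x * psi x) =
   a * (\int[leb R]_x (p x * psi x)) + b * (\int[leb R]_x (q x * psi x))) ->
  exists u1, [/\ der ut u1, der u1 (fun x => V x * ut x - (a * pt x + b * qt x)),
    (leb R).-integrable setT (EFin \o (fun x => ut x ^+ 2)) &
    (leb R).-integrable setT (EFin \o (fun x => u1 x ^+ 2))].
Proof.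
move=> hu hp hq cV heq.
have [_ [_ _ _ [cut _ _]]] := hu; have [_ [_ _ _ [cpt _ _]]] := hp.
have [_ [_ _ _ [cqt _ _]]] := hq.
apply: (weak_classical hu).
  by apply: contD; [exact: contM|apply: contN; apply: contD; apply: contM => //; exact: cont_cst].
move=> psi tpsi; have := heq _ tpsi.
have [dp0 _ _] := test_function_der tpsi; have cp := der_cont dp0.
have c1 := @cont_cst R 1.
have e1 (f ft : R -> R) : H1_rep f ft -> \int[leb R]_x (f x * psi x) = \int[leb R]_x (ft x * psi x).
  move=> hf; have E (h : R -> R) :
      \int[leb R]_x (h x * psi x) = \int[leb R]_x (1 * h x * psi x).
    by apply: eq_Rintegral => x _; rewrite mul1r.
  by rewrite (E f) (E ft); exact: (H1_rep_pairing hf c1 cp).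
rewrite (H1_rep_pairing hu cV cp) (e1 _ _ hp) (e1 _ _ hq).
have [r r0 h0] := test_function_bounded tpsi.
have out (f : R -> R) x : ~ (- r <= x <= r) -> f x * psi x = 0.
  by move=> h; rewrite h0 ?mulr0// => /andP[? ?]; apply: h; rewrite !ltW.
have rr : - r <= r by lra.
rewrite !(@Rintegral_supp _ (fun x => _ * psi x) (- r) r); try exact: out.
rewrite !Rintegral_Int//; do ?[exact: contM | apply: contM => //; exact: contM].
  move=> h.
  have -> : Int (- r) r (fun x => (V x * ut x - (a * pt x + b * qt x)) * psi x) =
    Int (- r) r (fun x => V x * ut x * psi x) + ((- a) * Int (- r) r (fun x => pt x * psi x) +
      (- b) * Int (- r) r (fun x => qt x * psi x)).
    rewrite -!IntZ -?IntD; do ?[exact: contM | apply: contM => //; exact: contM].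
    - by congr Int; apply/funext => x; ring.
    - by ccont.
    - by ccont.
    - by ccont.
  by lra.
by apply: contM => //; ccont.
Qed.

(** Integration by parts twice; the boundary terms vanish outside the support. *)
Lemma weak_of_classical u0 u1 u2 : der u0 u1 -> der u1 u2 -> continuous u2 ->
  forall psi, test_function psi ->
     \int[leb R]_x (u0 x * (psi^`(2))%classic x) = \int[leb R]_x (u2 x * psi x).
Proof.
move=> d0 d1 c2 psi tpsi.
have tp1 := test_function_derive tpsi; have tp2 := test_function_derive tp1.
have [dp0 dp1 cp2] := test_function_der tpsi.
have [a0 a00 h0] := test_function_bounded tpsi.
have [a1 a10 h1] := test_function_bounded tp1.
have [a2 a20 h2] : exists2 a2, 0 < a2 & forall x, ~ (- a2 < x < a2) ->
    (psi^`(2))%classic x = 0 := test_function_bounded tp2.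
pose a := a0 + a1 + a2.
have out b x : b <= a -> ~ (- a <= x <= a) -> ~ (- b < x < b).
  by move=> ba h /andP[? ?]; apply: h; apply/andP; split; lra.
have b0 : a0 <= a by rewrite /a; lra.
have b2 : a2 <= a by rewrite /a; lra.
have e0 : psi a = 0 by apply: h0 => /andP[_]; rewrite /a; lra.
have e0' : psi (- a) = 0 by apply: h0 => /andP[+ _]; rewrite /a; lra.
have e1 : (psi^`())%classic a = 0 by apply: h1 => /andP[_]; rewrite /a; lra.
have e1' : (psi^`())%classic (- a) = 0 by apply: h1 => /andP[+ _]; rewrite /a; lra.
have cu := der_cont d0; have cp := der_cont dp0.
have aa : - a <= a by rewrite /a; lra.
rewrite (@Rintegral_supp _ _ (- a) a) => [|x hx]; last by rewrite h2 ?mulr0//; exact: out b2 hx.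
rewrite (@Rintegral_supp _ (fun x => _ x * psi x) (- a) a) => [|x hx]; last by rewrite h0 ?mulr0//; exact: out b0 hx.
rewrite !Rintegral_Int//; [|exact: contM|exact: contM].
apply/eqP; rewrite -subr_eq0 -IntB; [|exact: contM|exact: contM].
rewrite (@IntE _ _ (fun x => u0 x * (psi^`())%classic x - u1 x * psi x)).
- by rewrite e0 e0' e1 e1' !mulr0 !subrr.
- by apply: contD; [exact: contM|apply: contN; exact: contM].
- by move=> x; ddat.
Qed.

Lemma schrodinger_Re (V : R -> R) (u : R -> R[i]) (psi : R -> R) :
  complex.Re (schrodinger V u psi) =
  - (\int[leb R]_x (complex.Re (u x) * (psi^`(2))%classic x)) +
  \int[leb R]_x (V x * complex.Re (u x) * psi x).
Proof.
rewrite /schrodinger /pairing /=; congr (_ + _).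
apply: eq_Rintegral => x _; congr (_ * _).
by case: (u x) => p q /=; rewrite mul0r subr0.
Qed.

Lemma schrodinger_Im (V : R -> R) (u : R -> R[i]) (psi : R -> R) :
  complex.Im (schrodinger V u psi) =
  - (\int[leb R]_x (complex.Im (u x) * (psi^`(2))%classic x)) +
  \int[leb R]_x (V x * complex.Im (u x) * psi x).
Proof.
rewrite /schrodinger /pairing /=; congr (_ + _).
apply: eq_Rintegral => x _; congr (_ * _).
by case: (u x) => p q /=; rewrite mul0r addr0.
Qed.

Lemma complex_ext (c d : R[i]) :
  complex.Re c = complex.Re d -> complex.Im c = complex.Im d -> c = d.
Proof. by case: c => a b; case: d => a' b' /= -> ->. Qed.

(** The system splits into real and imaginary parts, with lam = al + i be; the
    H^1 hypotheses survive as the integrability of the sum of the squares of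
    the solutions and of their first derivatives. *)
Lemma eigen_classical (X Y : R -> R[i]) (lam : R[i]) (Vm Vp : R -> R) :
  sobolev_H1C X -> sobolev_H1C Y -> continuous Vm -> continuous Vp ->
  (forall psi, test_function psi ->
    schrodinger Vm X psi = lam * pairing Y psi /\
    schrodinger Vp Y psi = lam * pairing X psi)%C ->
  exists X1 X1' X2 X2' Y1 Y1' Y2 Y2' : R -> R,
  let al := complex.Re lam in let be := complex.Im lam in
  [/\ {ae leb R, forall x, complex.Re (X x) = X1 x} /\ {ae leb R, forall x, complex.Im (X x) = X2 x},
    {ae leb R, forall x, complex.Re (Y x) = Y1 x} /\ {ae leb R, forall x, complex.Im (Y x) = Y2 x},
    [/\ der X1 X1', der X2 X2', der Y1 Y1' & der Y2 Y2'],
    [/\ der X1' (fun x => Vm x * X1 x - (al * Y1 x + (- be) * Y2 x)),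
        der X2' (fun x => Vm x * X2 x - (al * Y2 x + be * Y1 x)),
        der Y1' (fun x => Vp x * Y1 x - (al * X1 x + (- be) * X2 x)) &
        der Y2' (fun x => Vp x * Y2 x - (al * X2 x + be * X1 x))] &
    (leb R).-integrable setT (EFin \o (fun x =>
       X1 x ^+ 2 + X1' x ^+ 2 + (X2 x ^+ 2 + X2' x ^+ 2) +
       (Y1 x ^+ 2 + Y1' x ^+ 2 + (Y2 x ^+ 2 + Y2' x ^+ 2))))].
Proof.
move=> [/sobolev_H1_rep[X1 hX1] /sobolev_H1_rep[X2 hX2]].
move=> [/sobolev_H1_rep[Y1 hY1] /sobolev_H1_rep[Y2 hY2]] cm cp heq.
case: lam heq => al be heq.
have [] := @weak_eq_classical _ _ _ _ _ _ Vm al (- be) hX1 hY1 hY2 cm.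
  move=> psi /heq[h _]; rewrite -schrodinger_Re h /=; ring.
move=> X1' [dX1 dX1' iX1 iX1'].
have [] := @weak_eq_classical _ _ _ _ _ _ Vm al be hX2 hY2 hY1 cm.
  by move=> psi /heq[h _]; rewrite -schrodinger_Im h /=; ring.
move=> X2' [dX2 dX2' iX2 iX2'].
have [] := @weak_eq_classical _ _ _ _ _ _ Vp al (- be) hY1 hX1 hX2 cp.
  by move=> psi /heq[_ h]; rewrite -schrodinger_Re h /=; ring.
move=> Y1' [dY1 dY1' iY1 iY1'].
have [] := @weak_eq_classical _ _ _ _ _ _ Vp al be hY2 hX2 hX1 cp.
  by move=> psi /heq[_ h]; rewrite -schrodinger_Im h /=; ring.
move=> Y2' [dY2 dY2' iY2 iY2'].
exists X1, X1', X2, X2', Y1, Y1', Y2, Y2'; split => //=.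
- by split; [have [? [_ _ _ []]] := hX1|have [? [_ _ _ []]] := hX2].
- by split; [have [? [_ _ _ []]] := hY1|have [? [_ _ _ []]] := hY2].
- by do ! (apply: igD => //).
Qed.

End classical.

(** * The nonlinearity near 0 *)

Section nonlinearity.
Variable R : realType.
Implicit Types (f g : R -> R) (x a b c d s t w e : R).

Definition gp g : R -> R := (g^`())%classic.
Definition gpp g : R -> R := (g^`(2))%classic.

(** Integration of a bound on f' from 0, where f is not defined as a smooth
    function: the linear bound near 0 replaces the value f 0 = 0. *)
Lemma bound_from0 f f' (M m : R -> R) (S C s0 : R) :
  (forall s, 0 < s <= S -> [/\ dat f s (f' s), dat M s (m s) & `|f' s| <= m s]) ->
  0 < s0 -> (forall t, 0 < t < s0 -> `|f t| <= C * t) ->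
  (forall t, 0 < t -> 0 <= M t) ->
  forall s, 0 < s <= S -> `|f s| <= M s.
Proof.
move=> h s00 ht M0.
have key (F F' : R -> R) : (forall s, 0 < s <= S -> dat F s (F' s) /\ `|F' s| <= m s) ->
    (forall t, 0 < t < s0 -> `|F t| <= C * t) ->
    forall s, 0 < s <= S -> F s <= M s.
  move=> hF hFt s /andP[sp sS].
  rewrite leNgt; apply/negP => lt.
  pose d := F s - M s; have d0 : 0 < d by rewrite /d; lra.
  have C1 : 0 < `|C| + 1 by have := normr_ge0 C; lra.
  pose t := Num.min (Num.min (s0 / 2) s) (d / (`|C| + 1) / 2).
  have t0 : 0 < t by rewrite !lt_min sp !divr_gt0//.
  have ts : t <= s by rewrite /t !ge_min lexx orbT.
  have ts0 : t < s0.
    by apply: (@le_lt_trans _ _ (s0 / 2)); [rewrite /t !ge_min lexx|lra].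
  have td : C * t < d.
    have : t <= d / (`|C| + 1) / 2 by rewrite /t !ge_min lexx !orbT.
    rewrite ler_pdivlMr// ler_pdivlMr// => td.
    by have := ler_norm C; nra.
  have : F s - M s <= F t - M t.
    rewrite -lerN2 !opprB.
    apply: (@der_ge0_le _ (fun y => M y - F y) (fun y => m y - F' y)) => // y /andP[ty ys].
      have ySS : 0 < y <= S by apply/andP; split; lra.
      have [h1 _] := hF y ySS; have [_ h2 _] := h y ySS; by ddat.
    have ySS : 0 < y <= S by apply/andP; split; lra.
    have [_ h1] := hF y ySS.
    by have := ler_norm (F' y); lra.
  have tt : 0 < t < s0 by rewrite t0.
  have := hFt t tt; have := ler_norm (F t); have := M0 t t0; rewrite -/d; lra.
move=> s hs; rewrite ler_norml; apply/andP; split; last first.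
  by apply: (key f f') => // y hy; have [] := h y hy.
rewrite lerNl; apply: (key (fun y => - f y) (fun y => - f' y)) => // [y hy|t tt].
  by have [h1 _ h3] := h y hy; split; [ddat|rewrite normrN].
by rewrite normrN; exact: ht.
Qed.

Lemma hyp_H1_small g : hyp_H1 g -> forall e, 0 < e ->
  exists2 s0, 0 < s0 & forall s, 0 < s < s0 ->
   [/\ `|g s| <= e * s, `|gp g s| <= e & `|s * gpp g s| <= e].
Proof.
move=> [_ _ ho _] e e0.
have k (n : nat) : (n <= 5)%N ->
    \forall s \near 0^'+, `|(g^`(n))%classic s| <= e * `|s ^ (1 - n%:Z)|.
  by move=> /ho/eqoP; exact.
have H : \forall s \near 0^'+,
   [/\ `|g s| <= e * s, `|gp g s| <= e & `|s * gpp g s| <= e].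
  near=> s.
  have s0 : 0 < s by near: s; exact: nbhs_right_gt.
  have h0 : `|(g^`(0))%classic s| <= e * `|s ^ (1 - 0%:Z)| by near: s; exact: k.
  have h1 : `|(g^`(1))%classic s| <= e * `|s ^ (1 - 1%:Z)| by near: s; exact: k.
  have h2 : `|(g^`(2))%classic s| <= e * `|s ^ (1 - 2%:Z)| by near: s; exact: k.
  split.
  - by move: h0; rewrite subr0 expr1z (gtr0_norm s0).
  - by move: h1; rewrite subrr expr0z normr1 mulr1.
  - move: h2; rewrite (_ : 1 - 2%:Z = -1)// exprN1 normfV (gtr0_norm s0).
    by rewrite normrM (gtr0_norm s0) ler_pdivlMr// mulrC.
case: H => r /= r0 hr; exists r => // s /andP[s0 sr].
by apply: hr => //=; rewrite sub0r normrN gtr0_norm.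
Unshelve. all: by end_near. Qed.

(** The even extension: it is continuous on the whole line, and agrees with g at
    the arguments s >= 0 where g is used. *)
Definition gabs g s : R := g `|s|.

Lemma hyp_H1_0 g : hyp_H1 g -> g 0 = 0.
Proof.
move=> h1; have [_ [cg _] _ _] := h1.
move/continuous_within_itvcyP : cg => [_ c0].
apply: (cvg_unique _ c0); first exact: Rhausdorff.
apply/cvgrPdist_le => /= e e0.
have [s0 s00 hs] := hyp_H1_small h1 e0.
near=> s.
have sp : 0 < s by near: s; exact: nbhs_right_gt.
have s1 : s < s0 by near: s; exact: nbhs_right_lt.
have s2 : s < 1 by near: s; exact: nbhs_right_lt.
rewrite sub0r normrN.
have [|h _ _] := hs s; first by rewrite sp.
by apply: le_trans h _; rewrite ger_pMr// ltW.
Unshelve. all: by end_near. Qed.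

Lemma hyp_H1_dat g : hyp_H1 g -> forall s, 0 < s ->
  dat g s (gp g s) /\ dat (gp g) s (gpp g s).
Proof.
move=> [[h _] _ _ _] s s0; split; apply: derivable_dat.
  exact: (h 0%N).
exact: (h 1%N).
Qed.

Lemma gabs_cont g : hyp_H1 g -> continuous (gabs g).
Proof.
move=> h1 x; have [->|x0] := eqVneq x 0.
  apply/cvgrPdist_le => e e0; rewrite /gabs normr0 (hyp_H1_0 h1).
  have [s0 s00 hs] := hyp_H1_small h1 e0.
  near=> s; rewrite sub0r normrN.
  have [->|sn] := eqVneq s 0; first by rewrite normr0 (hyp_H1_0 h1) normr0 ltW.
  have sp : 0 < `|s| by rewrite normr_gt0.
  have s1 : `|s| < s0 by near: s; exact: (@nbhs0_lt R R^o s0 s00).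
  have s2 : `|s| < 1 by near: s; exact: (@nbhs0_lt R R^o 1 ltr01).
  have [|h _ _] := hs `|s|; first by rewrite sp.
  by apply: le_trans h _; rewrite ger_pMr// ltW.
have xp : 0 < `|x| by rewrite normr_gt0.
apply: continuous_comp; first exact: norm_continuous.
by have [h _] := hyp_H1_dat h1 xp; exact: dat_cont h.
Unshelve. all: by end_near. Qed.

Lemma primitiveE g s : hyp_H1 g -> 0 <= s -> primitive g s = Int 0 s (gabs g).
Proof.
move=> h1 s0; rewrite -(Rintegral_Int s0 (gabs_cont h1)).
by apply: eq_Rintegral => t; rewrite inE /= in_itv /= => /andP[t0 _]; rewrite /gabs ger0_norm.
Qed.

Lemma primitive_dat g s : hyp_H1 g -> 0 < s -> dat (primitive g) s (g s).
Proof.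
move=> h1 s0; have dp := prim_der (gabs_cont h1).
apply: (@dat_near _ (Int 0 ^~ (gabs g))).
  have : \forall t \near s, 0 < t by exact: lt_nbhsr.
  by apply: filterS => t t0; rewrite primitiveE// ltW.
rewrite (_ : g s = gabs g s); last by rewrite /gabs gtr0_norm.
by rewrite /Int; ddat.
Qed.

(** All smallness on ]0, S] in terms of ep, a bound for |s g''(s)|.  The
    expressions in [n0_D] and [n0_E] have derivatives s g'' and s g' - g, so
    each comes from the preceding bound by integration; [n0_g] and [n0_G] are
    rough bounds that do not involve ep. *)
Record near0 g (S ep : R) : Prop := Near0 {
  n0_ep : 0 <= ep;
  n0_g : forall s, 0 < s <= S -> `|g s| <= s / 10;
  n0_G : forall s, 0 < s <= S -> `|primitive g s| <= s ^+ 2 / 20;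
  n0_gpp : forall s, 0 < s <= S -> `|s * gpp g s| <= ep;
  n0_D : forall s, 0 < s <= S -> `|s * gp g s - g s| <= ep * s;
  n0_E : forall s, 0 < s <= S -> `|s * g s - 2 * primitive g s| <= ep * s ^+ 2 / 2 }.

Lemma primitive_le g : hyp_H1 g -> forall e, 0 <= e -> forall S,
  (forall s, 0 < s <= S -> `|g s| <= e * s) ->
  forall s, 0 < s <= S -> `|primitive g s| <= e * s ^+ 2 / 2.
Proof.
move=> h1 e e0 S hS s hs; have /andP[s0 sS] := hs.
have cg := gabs_cont h1.
have ce : continuous (fun t : R => e * t) by ccont.
have I : Int 0 s (fun t => e * t) = e * s ^+ 2 / 2.
  rewrite (@IntE _ _ (fun t => e * t ^+ 2 / 2))//; first by rewrite expr0n /= mulr0 mul0r subr0.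
  by move=> t; apply: dat_eq; [repeat dat_step|rewrite /=; field].
have le t : 0 <= t <= s -> `|gabs g t| <= e * t.
  move=> /andP[t0 ts]; rewrite /gabs (ger0_norm t0).
  move: t0; rewrite le_eqVlt => /predU1P[<-|t0].
    by rewrite (hyp_H1_0 h1) normr0 mulr0.
  by apply: hS; rewrite t0 (le_trans ts).
rewrite (primitiveE h1 (ltW s0)) ler_norml -I -IntN//; apply/andP; split.
  apply: Int_le => //; [exact: ltW|exact: contN|] => t /le; rewrite ler_norml.
  by case/andP.
by apply: Int_le => //; [exact: ltW|] => t /le; rewrite ler_norml => /andP[].
Qed.

Lemma near0_of_bound g : hyp_H1 g -> exists2 S0, 0 < S0 & forall S ep,
  0 < S < S0 -> (forall s, 0 < s <= S -> `|s * gpp g s| <= ep) -> near0 g S ep.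
Proof.
move=> h1; have e0 : 0 < 10^-1 :> R by lra.
have [s0 s00 hs] := hyp_H1_small h1 e0.
exists s0 => // S ep /andP[S0 SS] hep.
have hs' s : 0 < s <= S -> 0 < s < s0 by move=> /andP[? ?]; apply/andP; split; lra.
have ep0 : 0 <= ep.
  by apply: le_trans (hep S _); [exact: normr_ge0|rewrite S0 lexx].
have hg s : 0 < s <= S -> `|g s| <= 10^-1 * s by move=> /hs'/hs[].
have hG := @primitive_le g h1 10^-1 (ltW e0) S hg.
have hD s : 0 < s <= S -> `|s * gp g s - g s| <= ep * s.
  apply: (@bound_from0 (fun s => s * gp g s - g s) (fun s => s * gpp g s) (fun s => ep * s) (fun=> ep) S 1 S) => //.
  - move=> t tS; have /andP[t0 _] := tS; have [d1 d2] := hyp_H1_dat h1 t0.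
    by split; [ddat|ddat|exact: hep].
  - move=> t /andP[t0 tS]; have tt : 0 < t < s0 by apply/andP; split; lra.
    have [k1 k2 _] := hs t tt.
    apply: le_trans (ler_normB _ _) _; rewrite normrM (gtr0_norm t0).
    by nra.
  - by move=> t t0; rewrite mulr_ge0// ltW.
split => //.
- by move=> s /hg; rewrite mulrC.
- by move=> s /hG; lra.
apply: (@bound_from0 (fun s => s * g s - 2 * primitive g s) (fun s => s * gp g s - g s) (fun s => ep * s ^+ 2 / 2) (fun s => ep * s) S S S) => //.
- move=> t tS; have /andP[t0 _] := tS; have [d1 d2] := hyp_H1_dat h1 t0.
  have d3 := primitive_dat h1 t0.
  split; [ddat| |exact: hD].
  by apply: dat_eq; [repeat dat_step|rewrite /=; field].
- move=> t /andP[t0 tS]; have tt : 0 < t <= S by rewrite t0 ltW.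
  have k1 := hg t tt; have k2 := hG t tt.
  apply: le_trans (ler_normB _ _) _; rewrite !normrM (gtr0_norm t0) (ger0_norm (ler0n R 2)).
  have : 0 <= t * (S - t) by rewrite mulr_ge0; lra.
  by nra.
- by move=> t t0; rewrite divr_ge0// mulr_ge0// sqr_ge0.
Qed.

End nonlinearity.

(** * The ground state *)

Section gronwall.
Variable R : realType.
Implicit Types (f g : R -> R) (x a b c d s t w e : R).

(** Gronwall in both directions of time: N exp(- K x) decreases and N exp(K x)
    increases. *)
Lemma gronwall_zero (N N' : R -> R) K a b x0 :
  (forall x, a <= x <= b -> dat N x (N' x)) ->
  (forall x, a <= x <= b -> `|N' x| <= K * N x) ->
  a <= x0 <= b -> N x0 = 0 -> (forall x, a <= x <= b -> N x <= 0).
Proof.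
move=> dN bN /andP[ax0 x0b] Nx0 x /andP[ax xb].
have de c y : dat (fun y => expR (c * y)) y (c * expR (c * y)).
  apply: dat_eq; first by apply: (@dat_comp _ (@expR R) (fun y => c * y)); [exact: dat_exp|repeat dat_step].
  by rewrite /=; ring.
have [xx0|x0x] := leP x0 x.
  have : N x * expR (- K * x) <= N x0 * expR (- K * x0).
    rewrite -lerN2.
    apply: (@der_ge0_le _ (fun y => - (N y * expR (- K * y)))
       (fun y => (K * N y - N' y) * expR (- K * y))) => // y /andP[y1 y2].
      have hy : a <= y <= b by apply/andP; split; lra.
      have d1 := dN y hy; have d2 := de (- K) y; by ddat.
    have hy : a <= y <= b by apply/andP; split; lra.
    rewrite mulr_ge0 ?expR_ge0// subr_ge0; exact: le_trans (ler_norm _) (bN y hy).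
  by rewrite Nx0 mul0r pmulr_lle0// expR_gt0.
have : N x * expR (K * x) <= N x0 * expR (K * x0).
  apply: (@der_ge0_le _ (fun y => N y * expR (K * y))
     (fun y => (K * N y + N' y) * expR (K * y))) => // [|y /andP[y1 y2]|y /andP[y1 y2]].
  - exact: ltW.
  - have hy : a <= y <= b by apply/andP; split; lra.
    by have d1 := dN y hy; have d2 := de K y; ddat.
  - have hy : a <= y <= b by apply/andP; split; lra.
    rewrite mulr_ge0 ?expR_ge0//.
    have := bN y hy; have := ler_norm (- N' y); rewrite normrN; lra.
by rewrite Nx0 mul0r pmulr_lle0// expR_gt0.
Qed.

(** Apply Gronwall to y^2 + y'^2 on the interval between the two points, where
    the coefficient is bounded. *)
Lemma linear_ode_zero (y y' c : R -> R) : continuous c ->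
  der y y' -> der y' (fun x => c x * y x) -> forall x0, y x0 = 0 -> y' x0 = 0 ->
  forall x, y x = 0.
Proof.
move=> cc dy dy' x0 e0 e1 x.
pose a := Num.min x0 x; pose b := Num.max x0 x.
have ab : a <= b by rewrite /a /b ge_min !le_max !lexx.
have [M Mab hM] := @EVT_max R (fun t => `|c t|) a b ab (continuous_subspaceT (cont_norm cc)).
pose K := 1 + `|c M|.
have inab t : a <= t <= b -> `|c t| <= K - 1.
  by move=> h; have := hM t; rewrite in_itv /= => /(_ h); rewrite /K; lra.
have N0 : forall t, a <= t <= b -> y t ^+ 2 + y' t ^+ 2 <= 0.
  apply: (@gronwall_zero (fun t => y t ^+ 2 + y' t ^+ 2) (fun t => 2 * (1 + c t) * (y t * y' t)) K a b x0).
  - by move=> t _; ddat.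
  - move=> t /inab ct.
    have h1 : `|1 + c t| <= K by apply: le_trans (ler_normD _ _) _; rewrite normr1; lra.
    rewrite !normrM (ger0_norm (ler0n R 2)).
    rewrite -[y t ^+ 2]real_normK ?num_real// -[y' t ^+ 2]real_normK ?num_real//.
    have := sqr_ge0 (`|y t| - `|y' t|); have := normr_ge0 (y t); have := normr_ge0 (y' t).
    have := normr_ge0 (1 + c t); move: (`|y t|) (`|y' t|) (`|1 + c t|) h1 => A B C.
    move=> CK C0 B0 A0 AB.
    have : 0 <= C * (A - B) ^+ 2 by rewrite mulr_ge0 ?sqr_ge0.
    have : 0 <= (K - C) * (A ^+ 2 + B ^+ 2) by apply: mulr_ge0; [rewrite subr_ge0|rewrite addr_ge0 ?sqr_ge0].
    nra.
  - by rewrite /a /b ge_min le_max lexx.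
  - by rewrite e0 e1 expr0n /= addr0.
have h : a <= x <= b by rewrite /a /b ge_min le_max !lexx !orbT.
have := N0 x h; have := sqr_ge0 (y' x); have := sqr_ge0 (y x) => k1 k2 k3.
by apply/eqP; rewrite -sqrf_eq0 eq_le; apply/andP; split => //; lra.
Qed.

End gronwall.

(** The situation for one small frequency w: g is controlled on ]0, 3 w], a range
    which contains all the values of p^2 by [gs_s3w]. *)
Record setting (R : realType) (g p : R -> R) (w ep : R) : Prop := Setting {
  st_H1 : hyp_H1 g;
  st_gs : ground_state g w p;
  st_w0 : 0 < w;
  st_near0 : near0 g (3 * w) ep;
  st_ep : ep <= 100^-1 ^+ 2 }.

Section ground_state.
Variable R : realType.
Variables (g p : R -> R) (w ep : R).
Implicit Types (x a b c d s t e : R).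
Hypothesis st : setting g p w ep.

Let p' : R -> R := (p^`())%classic.
Let s x := p x ^+ 2.

Lemma gs_der : der p p'.
Proof. have [h1 gs w0 nb ep1] := st; by case: gs => _ h _ _ _ x; apply: derivable_dat; case: (h x). Qed.

Lemma gs_der2 : der p' (fun x => (w - s x + gabs g (s x)) * p x).
Proof.
have [h1 gs w0 nb ep1] := st.
case: gs => _ h he _ _ x; apply: (@dat_eq _ _ x ((p^`(2))%classic x)).
  by apply: derivable_dat; case: (h x).
by rewrite he /s /gabs (ger0_norm (sqr_ge0 _)); ring.
Qed.

Lemma gs_cont : continuous p. Proof. exact: der_cont gs_der. Qed.

(** A zero would be a minimum, hence a double zero, and the uniqueness for the
    linear equation p'' = c p would give p = 0. *)
Lemma gs_gt0 x : 0 < p x.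
Proof.
have [h1 gs w0 nb ep1] := st.
case: gs => _ _ _ [[z hz] _ p0] _.
rewrite lt_neqAle p0 andbT eq_sym; apply/eqP => px0.
move/eqP: hz; apply.
have cc : continuous (fun x => w - s x + gabs g (s x)).
  have cp := gs_cont; have cs : continuous s by exact: contX.
  apply: contD; first by ccont.
  exact: (cont_comp (gabs_cont h1) cs).
apply: (linear_ode_zero cc gs_der gs_der2 px0).
apply: (@dat_unique _ p x); first exact: gs_der.
apply: (@derive1_at_min _ _ (x - 1) (x + 1)); first lra.
- by move=> t _; exact: dat_derivable (gs_der t).
- by rewrite in_itv /=; apply/andP; split; lra.
- by move=> t _; rewrite px0.
Qed.

Lemma gs_s0 x : 0 < s x. Proof. by rewrite exprn_gt0// gs_gt0. Qed.

Lemma gs_der2' : der p' (fun x => (w - s x + g (s x)) * p x).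
Proof.
have [h1 gs w0 nb ep1] := st.
move=> x; apply: dat_eq; first exact: gs_der2.
by rewrite /gabs gtr0_norm ?gs_s0.
Qed.

Lemma gs_small e : 0 < e -> exists A, forall x, A <= x -> p x <= e.
Proof.
have [h1 gs w0 nb ep1] := st.
move=> e0; case: gs => _ _ _ _ [+ _] => /cvgrPdist_le/(_ e e0)[A [_ hA]].
exists (A + 1) => x hx; have := hA x; rewrite sub0r normrN gtr0_norm ?gs_gt0//.
by apply; lra.
Qed.

Lemma gs_dG : forall x, dat (fun x => primitive g (s x)) x (g (s x) * (2 * p x * p' x)).
Proof.
have [h1 gs w0 nb ep1] := st.
move=> x; apply: (@dat_comp _ (primitive g) s); first exact: primitive_dat (gs_s0 x).
by have d := gs_der; rewrite /s; ddat.
Qed.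

Lemma gs_energy_cst x y :
  p' x ^+ 2 - w * p x ^+ 2 + p x ^+ 4 / 2 - primitive g (s x) =
  p' y ^+ 2 - w * p y ^+ 2 + p y ^+ 4 / 2 - primitive g (s y).
Proof.
have [h1 gs w0 nb ep1] := st.
apply: (@der0_cst _ (fun x => p' x ^+ 2 - w * p x ^+ 2 + p x ^+ 4 / 2 - primitive g (s x))) => z.
have d1 := gs_der; have d2 := gs_der2'; have d3 := gs_dG z.
by apply: dat_eq; [repeat dat_step|rewrite /= /s; field].
Qed.

(** The energy is constant; it is zero because p tends to 0 at infinity, and
    so does p' at suitable points c of [A, A + 1] by the mean value theorem. *)
Lemma gs_energy x : p' x ^+ 2 = s x * w - s x ^+ 2 / 2 + primitive g (s x).
Proof.
have [h1 gs w0 nb ep1] := st.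
pose E x := p' x ^+ 2 - w * p x ^+ 2 + p x ^+ 4 / 2 - primitive g (s x).
suff : E x = 0 by rewrite /E /s; lra.
have w2 : 0 < w + 2 by lra.
apply/eqP; rewrite -normr_le0; apply/ler_addgt0Pr => dl dl0; rewrite add0r.
pose e := Num.min (Num.min 1 w) (dl / (w + 2)).
have e0 : 0 < e by rewrite !lt_min ltr01 w0 divr_gt0.
have e1 : e <= 1 by rewrite /e !ge_min lexx.
have ew : e <= w by rewrite /e !ge_min lexx !orbT.
have ed : e * (w + 2) <= dl by rewrite -ler_pdivlMr// /e !ge_min lexx !orbT.
clearbody e.
have e2 : e ^+ 2 <= e by rewrite expr2 ger_pMr.
have [A hA] := gs_small e0.
have [c /andP[c1 c2] hc] := @MVT_le _ p p' A (A + 1) (ltW (ltr_pwDr ltr01 (lexx A))) (fun x _ => gs_der x).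
have -> : E x = E c by exact: gs_energy_cst.
have pc : p c <= e by exact: hA.
have pc0 := gs_gt0 c.
have p'c : `|p' c| <= e.
  have -> : p' c = p (A + 1) - p A by rewrite hc; ring.
  have A1 : A <= A + 1 by lra.
  have k1 := hA A (lexx A); have k2 := hA (A + 1) A1.
  have k3 := gs_gt0 A; have k4 := gs_gt0 (A + 1).
  by rewrite ler_norml; apply/andP; split; lra.
have sw : s c <= e ^+ 2 by apply: lerXn2r; rewrite ?nnegrE ?(ltW e0) ?(ltW pc0).
have hs : 0 < s c <= 3 * w by rewrite gs_s0 /=; lra.
have hG := n0_G nb hs.
have sqp : p' c ^+ 2 <= e ^+ 2.
  by rewrite -[p' c ^+ 2]real_normK ?num_real//; apply: lerXn2r; rewrite ?nnegrE ?(ltW e0).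
have p2 : 0 <= p' c ^+ 2 by exact: sqr_ge0.
have s2 : s c ^+ 2 <= e ^+ 2.
  by apply: lerXn2r; rewrite ?nnegrE ?(ltW e0) ?(ltW (gs_s0 c))//; lra.
have E1 : E c = p' c ^+ 2 - w * s c + s c ^+ 2 / 2 - primitive g (s c).
  by rewrite /E /s -exprM.
rewrite E1.
have := ler_norm (primitive g (s c)); have := ler_norm (- primitive g (s c)); rewrite normrN => g1 g2.
have sc0 := gs_s0 c.
have ws : 0 <= w * s c <= w * e by apply/andP; split; [rewrite mulr_ge0 ?ltW|apply: ler_wpM2l; [exact: ltW|lra]].
have s20 : 0 <= s c ^+ 2 by exact: sqr_ge0.
by case/andP: ws => ws1 ws2; rewrite ler_norml; apply/andP; split; lra.
Qed.

(** Otherwise p^2 would take the value 3 w, where the energy identity would make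
    p'^2 negative. *)
Lemma gs_s3w x : s x < 3 * w.
Proof.
have [h1 gs w0 nb ep1] := st.
rewrite ltNge; apply/negP => hx.
have m0 : 0 < Num.min 1 w by rewrite lt_min ltr01.
have [A hA] := gs_small m0.
pose y := Num.max A x + 1.
have yA : A <= y by rewrite /y -[leLHS]addr0 lerD// le_max lexx.
have yx : x <= y by rewrite /y -[leLHS]addr0 lerD// le_max lexx orbT.
have py := hA y yA.
have sy : s y <= w.
  have [q1 q2] : p y <= 1 /\ p y <= w.
    by split; apply: (le_trans py); rewrite ge_min lexx ?orbT.
  by rewrite /s; have := gs_gt0 y; nra.
have cs : continuous s by apply: contX; exact: gs_cont.
have mm : Num.min (s x) (s y) <= 3 * w <= Num.max (s x) (s y).
  by rewrite ge_min le_max hx /=; apply/andP; split => //; apply/orP; right; lra.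
have [z zz sz] := IVT yx (continuous_subspaceT cs) mm.
have hs : 0 < s z <= 3 * w by rewrite gs_s0 sz lexx.
have := n0_G nb hs; have := gs_energy z; have := sqr_ge0 (p' z); rewrite sz.
have := ler_norm (primitive g (3 * w)) => g0 g1 g2 g3.
by have : 0 < w ^+ 2 := exprn_gt0 2 w0; nra.
Qed.

Lemma gs_in x : 0 < s x <= 3 * w.
Proof. by rewrite gs_s0 ltW ?gs_s3w. Qed.

End ground_state.

(** * Logarithmic derivative and decay of the ground state *)

Section profile.
Variable R : realType.
Variables (g p : R -> R) (w ep : R).
Implicit Types (x a c d t e : R).
Hypothesis st : setting g p w ep.

Let p' : R -> R := (p^`())%classic.
Let s x := p x ^+ 2.
Let gs x := g (s x).
Let gps x := gp g (s x).
Let Gs x := primitive g (s x).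

Definition logder x : R := p' x / p x.
Let b := logder.

Lemma pne0 x : p x != 0. Proof. by rewrite gt_eqF// (gs_gt0 st). Qed.

Lemma sne0 x : s x != 0. Proof. by rewrite gt_eqF// (gs_s0 st). Qed.

Lemma p'E x : p' x = b x * p x.
Proof. by rewrite /b /logder divfK// pne0. Qed.

Lemma p_der : der p (fun x => b x * p x).
Proof. by move=> x; apply: dat_eq; [exact: (gs_der st)|rewrite -p'E]. Qed.

Lemma logder_sq x : b x ^+ 2 = w - s x / 2 + Gs x / s x.
Proof.
rewrite /b /logder expr_div_n (gs_energy st) -/(s x) -/(Gs x).
by have := sne0 x => h; field.
Qed.

Lemma logder_der : der b (fun x => - s x / 2 + gs x - Gs x / s x).
Proof.
move=> x; have d1 := gs_der st; have d2 := gs_der2' st.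
have pn := pne0 x.
apply: dat_eq.
  by rewrite /b /logder; apply: datM; [exact: d2|apply: datV; [exact: pn|exact: d1]].
have := logder_sq x; rewrite /b /logder expr_div_n -/(s x) => e.
have e' : p' x ^+ 2 = s x * (w - s x / 2 + Gs x / s x).
  by rewrite -e mulrC divfK// sne0.
rewrite /= -/p'.
transitivity ((w - p x ^+ 2 + g (p x ^+ 2)) - p' x ^+ 2 / s x).
  by rewrite /s; field.
by rewrite e' -/(s x) -/(gs x); field; exact: sne0.
Qed.

Lemma s_der : der s (fun x => 2 * b x * s x).
Proof. by move=> x; have d := p_der; rewrite /s; ddat. Qed.

Lemma gs_x_der : der gs (fun x => gps x * (2 * b x * s x)).
Proof.
move=> x; have [d _] := hyp_H1_dat (st_H1 st) (gs_s0 st x).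
exact: (@dat_comp _ g s _ _ _ d (s_der x)).
Qed.

Lemma gps_x_der : der gps (fun x => gpp g (s x) * (2 * b x * s x)).
Proof.
move=> x; have [_ d] := hyp_H1_dat (st_H1 st) (gs_s0 st x).
exact: (@dat_comp _ (gp g) s _ _ _ d (s_der x)).
Qed.

Lemma Gs_x_der : der Gs (fun x => gs x * (2 * b x * s x)).
Proof.
move=> x; have d := primitive_dat (st_H1 st) (gs_s0 st x).
exact: (@dat_comp _ (primitive g) s _ _ _ d (s_der x)).
Qed.

Lemma gpps_cont : continuous (fun x => gpp g (s x)).
Proof.
move=> x; apply: continuous_comp; first exact: der_cont s_der x.
have [[h _] _ _ _] := st_H1 st.
by apply: dat_cont; apply: derivable_dat; apply: (h 2%N) => //; exact: (gs_s0 st).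
Qed.

Lemma Gs_bound x : `|Gs x / s x| <= s x / 20.
Proof.
have h := n0_G (st_near0 st) (gs_in st x).
rewrite normrM normfV (gtr0_norm (gs_s0 st x)) ler_pdivrMr ?(gs_s0 st)//.
by apply: le_trans h _; rewrite -/(s x); lra.
Qed.

Lemma logder_dec x : - s x / 2 + gs x - Gs x / s x < 0.
Proof.
have h1 := Gs_bound x; have h2 := n0_g (st_near0 st) (gs_in st x).
have s0 := gs_s0 st x; rewrite -/(s x) in h2 s0; rewrite -/(gs x) in h2.
have := ler_norm (gs x); have := ler_norm (- (Gs x / s x)); rewrite normrN; lra.
Qed.

Lemma logder_sq_le x : b x ^+ 2 <= w.
Proof.
rewrite logder_sq; have h1 := Gs_bound x; have s0 := gs_s0 st x; rewrite -/(s x) in s0.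
by have := ler_norm (Gs x / s x); lra.
Qed.

Lemma logder_le x : `|b x| <= Num.sqrt w.
Proof.
have w0 := st_w0 st.
rewrite -(@ler_pXn2r _ 2)// ?nnegrE ?sqrtr_ge0// sqr_sqrtr ?(ltW w0)//.
by rewrite real_normK ?num_real// logder_sq_le.
Qed.

Lemma p_even x : p (- x) = p x.
Proof. by case: (st_gs st) => _ _ _ [_ h _] _; exact: h. Qed.

Lemma logder0 : b 0 = 0.
Proof.
have d := p_der 0; have dn := p_der (- 0).
have : dat p 0 (- (b 0 * p 0)).
  have -> : p = fun x => p (- x) by apply/funext => x; rewrite p_even.
  apply: dat_eq; first by apply: (@dat_comp _ p (fun x => - x)); [exact: dn|repeat dat_step].
  by rewrite /= p_even oppr0; ring.
move=> /(dat_unique d) e; have : b 0 * p 0 = 0 by lra.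
by move=> /eqP; rewrite mulf_eq0 (negbTE (pne0 0)) orbF => /eqP.
Qed.

(** The logarithmic derivative is strictly decreasing and vanishes at 0. *)
Lemma logder_neq0 x : x != 0 -> b x != 0.
Proof.
move=> x0.
have [|x0'|e] := ltgtP x 0; last by rewrite e eqxx in x0.
  move=> x0'; have [c _] := MVT_le (ltW x0') (fun y _ => logder_der y).
  rewrite logder0 sub0r => e; apply/eqP => e0; move: e; rewrite e0 oppr0 sub0r => /esym/eqP.
  by rewrite mulf_eq0 (lt_eqF (logder_dec c)) oppr_eq0 (negbTE x0).
have [c _] := MVT_le (ltW x0') (fun y _ => logder_der y).
rewrite logder0 !subr0 => e; apply/eqP => e0; move: e; rewrite e0 => /esym/eqP.
by rewrite mulf_eq0 (lt_eqF (logder_dec c)) (negbTE x0).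
Qed.

Lemma r_bound x : `|2 * Gs x / s x - gs x| <= ep * s x / 2.
Proof.
have h := n0_E (st_near0 st) (gs_in st x); have s0 := gs_s0 st x.
rewrite -/(s x) -/(gs x) -/(Gs x) in h s0.
have -> : 2 * Gs x / s x - gs x = - ((s x * gs x - 2 * Gs x) / s x).
  by field; exact: sne0.
by rewrite normrN normrM normfV (gtr0_norm s0) ler_pdivrMr//; nra.
Qed.

Lemma ep_ge0 : 0 <= ep. Proof. exact: n0_ep (st_near0 st). Qed.

(** p^2 is bounded by the square of this weight; one factor makes the errors
    integrable, the other absorbs a power of x. *)
Definition weight x := (1 + w * x ^+ 2 / 4)^-1.

Lemma weight_gt0 x : 0 < weight x.
Proof.
have w0 := st_w0 st; rewrite invr_gt0; have : 0 <= w * x ^+ 2.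
  by rewrite mulr_ge0 ?sqr_ge0// ltW.
by lra.
Qed.

(** u = 1/p satisfies u'' = (w + r) u, where r = 2 G(s)/s - g(s) is small; it is
    even, so u'' >= (w/2) u gives u >= u(0) (1 + w x^2/4) by two integrations. *)
Lemma decay x : s x <= 3 * w * weight x ^+ 2.
Proof.
wlog x0 : x / 0 <= x.
  move=> H; have [|/ltW x0] := leP 0 x; first exact: H.
  have -> : s x = s (- x) by rewrite /s p_even.
  have -> : weight x = weight (- x) by rewrite /weight sqrrN.
  by apply: H; rewrite oppr_ge0.
have w0 := st_w0 st.
pose u y := (p y)^-1; pose u' y := - b y * u y.
pose u'' y := (w + (2 * Gs y / s y - gs y)) * u y.
have u0 y : 0 < u y by rewrite invr_gt0 (gs_gt0 st).
have du : der u u'.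
  move=> y; apply: dat_eq; first by apply: datV; [exact: pne0|exact: p_der].
  by rewrite /u' /u; field; exact: pne0.
have du' : der u' u''.
  move=> y; have d1 := logder_der; apply: dat_eq; first by rewrite /u'; repeat dat_step.
  rewrite /= /u' /u''.
  transitivity ((b y ^+ 2 + (s y / 2 - gs y + Gs y / s y)) * u y); first by ring.
  by rewrite logder_sq; congr (_ * _); field; exact: sne0.
have hu'' y : w / 2 * u y <= u'' y.
  rewrite /u''; apply: ler_wpM2r; first exact: ltW.
  have := r_bound y; have := gs_in st y; rewrite -/(s y) => /andP[s1 s2].
  have := ler_norm (- (2 * Gs y / s y - gs y)); rewrite normrN.
  have := st_ep st; have := ep_ge0; nra.
have u'00 : u' 0 = 0 by rewrite /u' logder0 oppr0 mul0r.
have u'0 y : 0 <= y -> 0 <= u' y.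
  move=> y0; rewrite -u'00; apply: (der_ge0_le y0 (fun z _ => du' z)) => z _.
  by apply: le_trans (hu'' z); rewrite mulr_ge0 ?divr_ge0// ltW.
have uu0 y : 0 <= y -> u 0 <= u y.
  move=> y0; apply: (der_ge0_le y0 (fun z _ => du z)) => z /andP[z0 _]; exact: u'0.
have u'l y : 0 <= y -> w / 2 * u 0 * y <= u' y.
  move=> y0.
  have : u' 0 - w / 2 * u 0 * 0 <= u' y - w / 2 * u 0 * y.
    apply: (@der_ge0_le _ (fun y => u' y - w / 2 * u 0 * y) (fun y => u'' y - w / 2 * u 0)) => //.
      by move=> z _; ddat.
    move=> z /andP[z0 _]; rewrite subr_ge0; apply: le_trans (hu'' z).
    by apply: ler_wpM2l; [rewrite divr_ge0// ltW|exact: uu0].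
  by rewrite u'00 mulr0; lra.
have ul : u 0 * (1 + w * x ^+ 2 / 4) <= u x.
  have : u 0 - w / 4 * u 0 * 0 ^+ 2 <= u x - w / 4 * u 0 * x ^+ 2.
    apply: (@der_ge0_le _ (fun y => u y - w / 4 * u 0 * y ^+ 2) (fun y => u' y - w / 2 * u 0 * y)) => //.
      by move=> z _; apply: dat_eq; [repeat dat_step|rewrite /=; field].
    by move=> z /andP[z0 _]; rewrite subr_ge0; exact: u'l.
  by rewrite expr0n /= mulr0 subr0; lra.
have P0 := weight_gt0 x.
have ple : p x <= p 0 * weight x.
  have q0 : 0 < 1 + w * x ^+ 2 / 4 by rewrite -invr_gt0.
  have pn0 := pne0 0; have pnx := pne0 x.
  have pp : 0 < p 0 * p x by rewrite mulr_gt0 ?(gs_gt0 st).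
  have : p 0 * p x * (u 0 * (1 + w * x ^+ 2 / 4)) <= p 0 * p x * u x by rewrite ler_pM2l.
  rewrite /u (_ : p 0 * p x * (p x)^-1 = p 0); last by field.
  rewrite (_ : p 0 * p x * _ = p x * (1 + w * x ^+ 2 / 4)); last by field.
  by rewrite /weight ler_pdivlMr.
have : s x <= (p 0 * weight x) ^+ 2.
  have [a1 a2 a3] := And3 (ltW (gs_gt0 st x)) (ltW (gs_gt0 st 0)) (ltW P0).
  by apply: lerXn2r; rewrite ?nnegrE ?mulr_ge0.
move=> h; apply: (le_trans h); rewrite exprMn; apply: ler_wpM2r; first exact: sqr_ge0.
by rewrite ltW// (gs_s3w st).
Qed.

End profile.

(** * The virial argument for the transformed system *)

Section virial_tools.
Variable R : realType.
Implicit Types (f : R -> R) (x a b c d t : R).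

Lemma amgm_abs (z th t : R) : 0 < t -> `|2 * z * th| <= t * z ^+ 2 + th ^+ 2 / t.
Proof.
move=> t0; have tn : t != 0 by rewrite gt_eqF.
have : 0 <= (t * z - th) ^+ 2 / t by rewrite divr_ge0 ?sqr_ge0// ltW.
have : 0 <= (t * z + th) ^+ 2 / t by rewrite divr_ge0 ?sqr_ge0// ltW.
have -> : (t * z + th) ^+ 2 / t = t * z ^+ 2 + 2 * z * th + th ^+ 2 / t by field.
have -> : (t * z - th) ^+ 2 / t = t * z ^+ 2 - 2 * z * th + th ^+ 2 / t by field.
by move=> h1 h2; rewrite ler_norml; apply/andP; split; lra.
Qed.

(** Cauchy-Schwarz for the increment of f: integrate (f' - q)^2 >= 0, where q is
    the mean slope. *)
Lemma Int_cs (f f' : R -> R) a b : a <= b -> der f f' -> continuous f' ->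
  (f b - f a) ^+ 2 <= (b - a) * Int a b (fun x => f' x ^+ 2).
Proof.
rewrite le_eqVlt => /predU1P[<- _ _|ab df cf]; first by rewrite !subrr expr0n mul0r.
have ba : 0 < b - a by lra.
have bn : b - a != 0 by rewrite gt_eqF.
pose q := (f b - f a) / (b - a).
have c2 : continuous (fun x => f' x ^+ 2) by ccont.
have cq : continuous (fun x => (2 * q) * f' x - q ^+ 2) by ccont.
have h : Int a b (fun x => (2 * q) * f' x - q ^+ 2) <= Int a b (fun x => f' x ^+ 2).
  apply: Int_le => //; first exact: ltW.
  by move=> x _; have := sqr_ge0 (f' x - q); nra.
move: h; rewrite (@IntE _ _ (fun x => (2 * q) * f x - q ^+ 2 * x)) => [|//|x]; last by ddat.
rewrite (_ : _ - _ = (f b - f a) ^+ 2 / (b - a)); last by rewrite /q; field.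
by rewrite ler_pdivrMr// mulrC.
Qed.

Lemma Int_cs0 (f f' : R -> R) r x : `|x| <= r -> der f f' -> continuous f' ->
  (f x - f 0) ^+ 2 <= `|x| * Int (- r) r (fun x => f' x ^+ 2).
Proof.
rewrite ler_norml => /andP[xr rx] df cf.
have c2 : continuous (fun x => f' x ^+ 2) by ccont.
have pos a b : a <= b -> 0 <= Int a b (fun x => f' x ^+ 2).
  by move=> ab; apply: Int_ge0 => // y _; exact: sqr_ge0.
have [x0|/ltW x0] := leP 0 x.
  rewrite (ger0_norm x0); apply: le_trans (Int_cs x0 df cf) _; rewrite subr0.
  apply: ler_wpM2l => //; rewrite (IntC _ (- r) 0 r) (IntC _ 0 x r).
  have r0 : - r <= 0 by lra.
  by have := pos _ _ rx; have := pos _ _ r0; lra.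
rewrite (ler0_norm x0) -[f x - f 0]opprB sqrrN.
apply: le_trans (Int_cs x0 df cf) _; rewrite sub0r.
apply: ler_wpM2l; first by rewrite oppr_ge0.
rewrite (IntC _ (- r) 0 r) (IntC _ (- r) x 0).
have r0 : 0 <= r by lra.
by have := pos _ _ xr; have := pos _ _ r0; lra.
Qed.

Lemma Int_sub f r r' : continuous f -> (forall x, 0 <= f x) -> 0 <= r -> r <= r' ->
  Int (- r) r f <= Int (- r') r' f.
Proof.
move=> cf f0 r0 rr.
rewrite (IntC _ (- r') (- r) r') (IntC _ (- r) r r').
have h1 : 0 <= Int (- r') (- r) f by apply: Int_ge0 => //; rewrite lerN2.
have h2 : 0 <= Int r r' f by apply: Int_ge0.
lra.
Qed.

Lemma Int_eq0 f : continuous f -> (forall x, 0 <= f x) ->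
  (forall r, 0 <= r -> Int (- r) r f <= 0) -> forall x, f x = 0.
Proof.
move=> cf f0 h x.
have dp := prim_der cf.
have mono a b : a <= b -> prim f a <= prim f b.
  by move=> ab; apply: (der_ge0_le ab (fun y _ => dp y)) => y _.
have cst y : prim f y = prim f 0.
  have := h `|y| (normr_ge0 y); rewrite /Int => e.
  have y1 := ler_norm y; have y2 : - `|y| <= y by rewrite lerNl -normrN ler_norm.
  have n0 := normr_ge0 y; have n1 : - `|y| <= 0 by lra.
  have := mono _ _ y1; have := mono _ _ y2; have := mono _ _ n0; have := mono _ _ n1; lra.
apply: (@dat_unique _ (prim f) x); first exact: dp.
by rewrite (_ : prim f = fun=> prim f 0); [exact: dat_cst|exact/funext].
Qed.

End virial_tools.

Section virial.
Variable R : realType.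

(** What is used of the potentials h and k, with m = sqrt w and an integrable
    weight W.  Besides size and decay, a bound with an extra factor |x| allows
    for the growth (z x - z 0)^2 <= |x| int z'^2; the last field says that h is
    repulsive on average, with a constant 600^2 that dominates the numerical
    constants of the error terms. *)
Record repulsive (h h' k k' W : R -> R) (w m ep : R) : Prop := Repulsive {
  rp_m : 0 < m;
  rp_w : w = m ^+ 2;
  rp_ep0 : 0 < ep;
  rp_ep : ep <= 100^-1 ^+ 2;
  rp_dh : der h h';
  rp_dk : der k k';
  rp_ch : continuous h';
  rp_ck : continuous k';
  rp_cW : continuous W;
  rp_W0 : forall x, 0 <= W x;
  rp_W1 : forall x, W x <= 1;
  rp_IW : forall r, 0 <= r -> Int (- r) r W <= 8 / m;
  rp_h : forall x, `|h x| <= w / 4;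
  rp_k : forall x, `|k x| <= w / 4;
  rp_h1 : forall x, `|x * h' x| <= 24 * ep * w * W x;
  rp_h2 : forall x, `|x| * `|x * h' x| <= 96 * ep * m * W x;
  rp_k1 : forall x, k x ^+ 2 <= 21 * ep ^+ 2 * w ^+ 2 * W x;
  rp_k2 : forall x, `|x| * k x ^+ 2 <= 21 * ep ^+ 2 * (w * m) * W x;
  rp_k3 : forall x, (x * k' x) ^+ 2 <= 225 * ep ^+ 2 * w ^+ 2 * W x;
  rp_k4 : forall x, `|x| * (x * k' x) ^+ 2 <= 225 * ep ^+ 2 * (w * m) * W x;
  rp_int : exists A, forall r, A <= r ->
     600 ^+ 2 * ep ^+ 2 * m <= - Int (- r) r (fun x => x * h' x) }.

Variables (h h' k k' W : R -> R) (w m ep : R).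
Hypothesis rp : repulsive h h' k k' W w m ep.

(** The split z = z(0) + (z - z(0)) in an error term: the first part uses a plain
    bound on the coefficient q, the second the bound with a factor |x|. *)
Lemma sqr_split (q x z0 th N B1 B2 : R) : 0 <= q -> th ^+ 2 <= `|x| * N -> 0 <= N ->
  q <= B1 -> `|x| * q <= B2 ->
  q * (z0 + th) ^+ 2 <= 2 * z0 ^+ 2 * B1 + 2 * N * B2.
Proof.
move=> q0 hth N0 h1 h2.
have e1 : (z0 + th) ^+ 2 <= 2 * z0 ^+ 2 + 2 * th ^+ 2.
  by have := sqr_ge0 (z0 - th); nra.
have e2 : q * (z0 + th) ^+ 2 <= q * (2 * z0 ^+ 2 + 2 * (`|x| * N)).
  by apply: ler_wpM2l => //; lra.
apply: le_trans e2 _.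
have e3 : 0 <= z0 ^+ 2 by exact: sqr_ge0.
have e4 : z0 ^+ 2 * q <= z0 ^+ 2 * B1 by exact: ler_wpM2l.
have e5 : N * (`|x| * q) <= N * B2 by exact: ler_wpM2l.
by nra.
Qed.

Variables (z z' y y' : R -> R) (lam : R).
Hypothesis lam0 : 0 <= lam.
Hypothesis dz : der z z'.
Hypothesis dz' : der z' (fun x => (h x - (lam - w)) * z x + k x * y x).
Hypothesis dy : der y y'.
Hypothesis dy' : der y' (fun x => (h x + (lam + w)) * y x + k x * z x).

Let f x := z x ^+ 2 + z' x ^+ 2 + (y x ^+ 2 + y' x ^+ 2).
(* Constant in the bound of the boundary terms by f. *)
Let B := 2 + 3 * w + lam.

Let c2 (N : R) := 21 * ep ^+ 2 * (2 * z 0 ^+ 2 * w + 2 * N * m).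
(* e is the derivative of y y', and F that of the virial functional T. *)
Let e x := y' x ^+ 2 + (h x + (lam + w)) * y x ^+ 2 + k x * z x * y x.
Let F x := 2 * z' x ^+ 2 + 2 * y' x ^+ 2 - x * h' x * (z x ^+ 2 + y x ^+ 2) -
  2 * (x * k' x) * (z x * y x).
Let T x := x * z' x ^+ 2 + z x * z' x + (x * y' x ^+ 2 + y x * y' x) -
  x * (h x - (lam - w)) * z x ^+ 2 - x * (h x + (lam + w)) * y x ^+ 2 -
  2 * x * k x * (z x * y x).
(* The parameter of the inequality 2 z0 th <= t z0^2 + th^2/t.  The cross term
   leaves t ep sqrt w z0^2, to be dominated by 600^2 ep^2 sqrt w z0^2, and
   (ep/t) int z'^2, to be dominated by int z'^2: so t is a large multiple
   of ep. *)
Let t := 40 ^+ 2 * ep.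
Let c1 (N : R) := 24 * ep * w * (t * z 0 ^+ 2) + (1 + t^-1) * (96 * ep * m * N) +
  225 * ep ^+ 2 * (2 * z 0 ^+ 2 * w + 2 * N * m).

Lemma elliptic_pointwise (x N : R) : 0 <= N -> (z x - z 0) ^+ 2 <= `|x| * N ->
  w / 4 * y x ^+ 2 - c2 N * W x <= e x.
Proof.
have lam0' := lam0; have [m0 wE e0 e1 dh dk ch ck cW W0 W1 IW bh bk bh1 bh2 bk1 bk2 bk3 bk4 _] := rp.
have w0 : 0 < w by rewrite wE exprn_gt0.
have wn : w != 0 by rewrite gt_eqF.
move=> N0 hx; rewrite /e.
have q0 : 0 <= k x ^+ 2 by exact: sqr_ge0.
have := sqr_split (z 0) q0 hx N0 (bk1 x) (bk2 x); rewrite addrC subrK => s1.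
have s2 : k x ^+ 2 * z x ^+ 2 / w <= c2 N * W x.
  rewrite ler_pdivrMr// /c2; apply: le_trans s1 _; rewrite le_eqVlt; apply/orP; left; apply/eqP; ring.
have w20 : 0 < w / 2 by lra.
have := amgm_abs (y x) (k x * z x) w20.
rewrite (_ : (k x * z x) ^+ 2 / (w / 2) = 2 * (k x ^+ 2 * z x ^+ 2 / w)); last by field.
rewrite ler_norml => /andP[am _].
have := bh x; rewrite ler_norml => /andP[bh' _].
have y2 : 0 <= y x ^+ 2 by exact: sqr_ge0.
have y'2 : 0 <= y' x ^+ 2 by exact: sqr_ge0.
have : 0 <= (h x + w / 2 + lam) * y x ^+ 2 by rewrite mulr_ge0//; lra.
lra.
Qed.

Lemma virial_boundary (a : R) : 1 <= `|a| -> `|T a| <= `|a| * (B * f a).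
Proof.
have lam0' := lam0; have [m0 wE e0 e1 dh dk ch ck cW W0 W1 IW bh bk bh1 bh2 bk1 bk2 bk3 bk4 _] := rp.
have w0 : 0 < w by rewrite wE exprn_gt0.
have wn : w != 0 by rewrite gt_eqF.
move=> a1.
have t1 : `|a * z' a ^+ 2| = `|a| * z' a ^+ 2 by rewrite normrM [`|_ ^+ 2|]ger0_norm ?sqr_ge0.
have t2 : `|a * y' a ^+ 2| = `|a| * y' a ^+ 2 by rewrite normrM [`|_ ^+ 2|]ger0_norm ?sqr_ge0.
have pr (u v : R) : `|u * v| <= (u ^+ 2 + v ^+ 2) / 2.
  by have := sqr_ge0 (u - v); have := sqr_ge0 (u + v); rewrite ler_norml => ? ?; apply/andP; split; nra.
have wh (u v : R) : `|u * v| <= `|a| * ((u ^+ 2 + v ^+ 2) / 2).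
  by apply: le_trans (pr u v) _; rewrite ler_peMl// divr_ge0// addr_ge0 ?sqr_ge0.
have bhm : `|h a - (lam - w)| <= 3 / 2 * w + lam.
  have := bh a; rewrite !ler_norml => /andP[? ?]; apply/andP; split; lra.
have bhp : `|h a + (lam + w)| <= 3 / 2 * w + lam.
  have := bh a; rewrite !ler_norml => /andP[? ?]; apply/andP; split; lra.
have t3 : `|a * (h a - (lam - w)) * z a ^+ 2| <= `|a| * ((3 / 2 * w + lam) * z a ^+ 2).
  rewrite normrM [`|a * _|]normrM -mulrA (ger0_norm (sqr_ge0 _)).
  by apply: ler_wpM2l => //; apply: ler_wpM2r => //; exact: sqr_ge0.
have t4 : `|a * (h a + (lam + w)) * y a ^+ 2| <= `|a| * ((3 / 2 * w + lam) * y a ^+ 2).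
  rewrite normrM [`|a * _|]normrM -mulrA (ger0_norm (sqr_ge0 _)).
  by apply: ler_wpM2l => //; apply: ler_wpM2r => //; exact: sqr_ge0.
have t5 : `|2 * a * k a * (z a * y a)| <= `|a| * (w * ((z a ^+ 2 + y a ^+ 2) / 2)).
  rewrite (_ : 2 * a * k a * _ = a * ((2 * k a) * (z a * y a))); last by ring.
  rewrite [`|a * _|]normrM; apply: ler_wpM2l => //; rewrite normrM.
  apply: ler_pM => //; rewrite normrM (ger0_norm (ler0n R 2)); have := bk a; lra.
have S : `|T a| <= `|a| * z' a ^+ 2 + `|a| * ((z a ^+ 2 + z' a ^+ 2) / 2) +
     (`|a| * y' a ^+ 2 + `|a| * ((y a ^+ 2 + y' a ^+ 2) / 2)) +
     `|a| * ((3 / 2 * w + lam) * z a ^+ 2) + `|a| * ((3 / 2 * w + lam) * y a ^+ 2) +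
     `|a| * (w * ((z a ^+ 2 + y a ^+ 2) / 2)).
  rewrite /T; do 3 (apply: le_trans (ler_normB _ _) _; apply: lerD => //).
  apply: le_trans (ler_normD _ _) _; apply: lerD.
  - by apply: le_trans (ler_normD _ _) _; rewrite t1 lerD2l wh.
  - by apply: le_trans (ler_normD _ _) _; rewrite t2 lerD2l wh.
apply: (le_trans S).
rewrite -!mulrDr; apply: ler_wpM2l => //; rewrite /f /B.
have := sqr_ge0 (z a); have := sqr_ge0 (y a); have := sqr_ge0 (z' a); have := sqr_ge0 (y' a).
move: (z a ^+ 2) (y a ^+ 2) (z' a ^+ 2) (y' a ^+ 2) => p1 p2 p3 p4 k4 k3 k2 k1.
have q1 : 0 <= w * p1 by rewrite mulr_ge0// ltW.
have q2 : 0 <= w * p2 by rewrite mulr_ge0// ltW.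
have q3 : 0 <= w * p3 by rewrite mulr_ge0// ltW.
have q4 : 0 <= w * p4 by rewrite mulr_ge0// ltW.
have q5 : 0 <= lam * p3 by exact: mulr_ge0.
have q6 : 0 <= lam * p4 by exact: mulr_ge0.
lra.
Qed.

(** Pointwise lower bound of the virial density: - x h' z^2 becomes
    - x h' z(0)^2, and the terms in y cost 2 w y^2, which the ellipticity of
    the y equation controls afterwards. *)
Lemma virial_pointwise (x N : R) : 0 <= N -> (z x - z 0) ^+ 2 <= `|x| * N ->
  2 * z' x ^+ 2 + (- z 0 ^+ 2) * (x * h' x) + (- (2 * w)) * y x ^+ 2 +
  (- c1 N) * W x <= F x.
Proof.
have lam0' := lam0; have [m0 wE e0 e1 dh dk ch ck cW W0 W1 IW bh bk bh1 bh2 bk1 bk2 bk3 bk4 _] := rp.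
have w0 : 0 < w by rewrite wE exprn_gt0.
have wn : w != 0 by rewrite gt_eqF.
set z0 := z 0 => N0 hx; have z02 : 0 <= z0 ^+ 2 by exact: sqr_ge0.
have t0 : 0 < t by rewrite mulr_gt0// exprn_gt0// ltr0n.
have q0 : 0 <= (x * k' x) ^+ 2 by exact: sqr_ge0.
have := sqr_split z0 q0 hx N0 (bk3 x) (bk4 x); rewrite addrC subrK => s1.
have am := amgm_abs (y x) (x * k' x * z x) w0.
have am2 := amgm_abs z0 (z x - z0) t0.
have s2 : (x * k' x * z x) ^+ 2 / w <= 225 * ep ^+ 2 * (2 * z0 ^+ 2 * w + 2 * N * m) * W x.
  rewrite ler_pdivrMr// exprMn; apply: le_trans s1 _.
  by rewrite le_eqVlt; apply/orP; left; apply/eqP; ring.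
have A1 := bh1 x; have A2 := bh2 x.
have y2 : 0 <= y x ^+ 2 by exact: sqr_ge0.
have y'2 : 0 <= y' x ^+ 2 by exact: sqr_ge0.
have g1 : `|x * h' x| * y x ^+ 2 <= w * y x ^+ 2.
  apply: ler_wpM2r => //; apply: le_trans A1 _.
  have e24 : 24 * ep <= 1 by lra.
  apply: (@le_trans _ _ (24 * ep * w)); last by rewrite ler_piMl// ltW.
  by rewrite ler_piMr// mulr_ge0 ?(ltW w0)// mulr_ge0// ltW.
have g2 : `|x * h' x| * (t * z0 ^+ 2) <= 24 * ep * w * W x * (t * z0 ^+ 2).
  by apply: ler_wpM2r => //; rewrite mulr_ge0// ltW.
have g3 : `|x * h' x| * (z x - z0) ^+ 2 <= 96 * ep * m * W x * N.
  apply: (@le_trans _ _ (`|x * h' x| * (`|x| * N))); first by apply: ler_wpM2l.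
  by rewrite mulrA [_ * `|x|]mulrC; apply: ler_wpM2r.
have tV : 0 < t^-1 by rewrite invr_gt0.
have g4 : `|x * h' x| * ((z x - z0) ^+ 2 / t) <= t^-1 * (96 * ep * m * W x * N).
  by rewrite mulrA [_ * t^-1]mulrC; apply: ler_wpM2l => //; exact: ltW.
have hz : x * h' x * z x ^+ 2 <= z0 ^+ 2 * (x * h' x) + `|x * h' x| * (t * z0 ^+ 2) +
   `|x * h' x| * ((z x - z0) ^+ 2 / t) + `|x * h' x| * (z x - z0) ^+ 2.
  have -> : x * h' x * z x ^+ 2 = z0 ^+ 2 * (x * h' x) + x * h' x * (2 * z0 * (z x - z0)) +
     x * h' x * (z x - z0) ^+ 2 by ring.
  have n1 : x * h' x * (z x - z0) ^+ 2 <= `|x * h' x| * (z x - z0) ^+ 2.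
    by apply: ler_wpM2r; [exact: sqr_ge0|exact: ler_norm].
  have n2 : x * h' x * (2 * z0 * (z x - z0)) <= `|x * h' x| * (t * z0 ^+ 2 + (z x - z0) ^+ 2 / t).
    apply: le_trans (ler_norm _) _; rewrite normrM; exact: ler_wpM2l.
  rewrite mulrDr in n2; lra.
have hy : x * h' x * y x ^+ 2 <= `|x * h' x| * y x ^+ 2.
  by apply: ler_wpM2r => //; exact: ler_norm.
have hk : 2 * (x * k' x) * (z x * y x) <= w * y x ^+ 2 + (x * k' x * z x) ^+ 2 / w.
  by apply: le_trans am; rewrite (_ : 2 * _ * _ = 2 * y x * (x * k' x * z x)) ?ler_norm//; ring.
rewrite /F /c1 -/z0; lra.
Qed.

(** The virial identity on [- r, r], combined with the elliptic bound: up to the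
    boundary term dl, the kinetic energy of z and z(0)^2 vanish. *)
Lemma virial_step (r dl : R) : 1 <= r -> r * (f r + f (- r)) <= dl ->
  600 ^+ 2 * ep ^+ 2 * m <= - Int (- r) r (fun x => x * h' x) ->
  let N := Int (- r) r (fun x => z' x ^+ 2) in
  N + ep ^+ 2 * m * z 0 ^+ 2 <= 9 * B * dl /\
  w / 4 * Int (- r) r (fun x => y x ^+ 2) <= B * dl + 336 * ep ^+ 2 * (z 0 ^+ 2 * m + N).
Proof.
have lam0' := lam0; have := dz; have := dz'; have := dy; have := dy'.
move=> ddy' ddy ddz' ddz r1 hf hI N.
case: rp => m0 wE e0 e1 dh dk ch ck cW W0 W1 IW bh bk bh1 bh2 bk1 bk2 bk3 bk4 _.
have w0 : 0 < w by rewrite wE exprn_gt0.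
have wn : w != 0 by rewrite gt_eqF.
have mn : m != 0 by rewrite gt_eqF.
have r0 : 0 <= r by lra.
have rr : - r <= r by lra.
have cz := der_cont ddz; have cz' := der_cont ddz'.
have cy := der_cont ddy; have cy' := der_cont ddy'.
have ch0 := der_cont dh; have ck0 := der_cont dk.
have cz2 : continuous (fun x => z' x ^+ 2) by ccont.
have cy2 : continuous (fun x => y x ^+ 2) by ccont.
have cxh : continuous (fun x : R => x * h' x) by ccont.
have f0 x : 0 <= f x by rewrite /f !addr_ge0 ?sqr_ge0.
have N0 : 0 <= N by apply: Int_ge0 => // x _; exact: sqr_ge0.
have theta x : - r <= x <= r -> (z x - z 0) ^+ 2 <= `|x| * N.
  by move=> hx; apply: Int_cs0 => //; rewrite ler_norml.
have z02 : 0 <= z 0 ^+ 2 by exact: sqr_ge0.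
have ell : w / 4 * Int (- r) r (fun x => y x ^+ 2) <= B * dl + 336 * ep ^+ 2 * (z 0 ^+ 2 * m + N).
  have ce : continuous e by rewrite /e; ccont.
  have Ie : Int (- r) r e = y r * y' r - y (- r) * y' (- r).
    by rewrite (@IntE _ _ (fun x => y x * y' x)) => // x; rewrite /e; ddat.
  have le1 : Int (- r) r (fun x => w / 4 * y x ^+ 2 - c2 N * W x) <= Int (- r) r e.
    apply: Int_le => //; first by ccont.
    by move=> x /theta hx; exact: elliptic_pointwise.
  have cc2 : 0 <= c2 N.
    rewrite /c2; apply: mulr_ge0; first by rewrite mulr_ge0 ?sqr_ge0.
    by apply: addr_ge0; apply: mulr_ge0; rewrite ?(ltW w0) ?(ltW m0)// mulr_ge0.
  move: le1; rewrite IntB; [|by ccont..]; rewrite !IntZ// Ie => le1.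
  have le2 : c2 N * Int (- r) r W <= 336 * ep ^+ 2 * (z 0 ^+ 2 * m + N).
    apply: (@le_trans _ _ (c2 N * (8 / m))); first by apply: ler_wpM2l => //; exact: IW.
    by rewrite /c2 le_eqVlt; apply/orP; left; apply/eqP; rewrite wE; field.
  have b1 a : y a * y' a <= f a / 2.
    rewrite /f; have := sqr_ge0 (y a - y' a); have := sqr_ge0 (z a); have := sqr_ge0 (z' a); nra.
  have b2 a : - (y a * y' a) <= f a / 2.
    rewrite /f; have := sqr_ge0 (y a + y' a); have := sqr_ge0 (z a); have := sqr_ge0 (z' a); nra.
  have ff : f r + f (- r) <= dl.
    apply: le_trans hf; rewrite ler_peMl// addr_ge0//.
  have dl0 : 0 <= dl by apply: le_trans ff; rewrite addr_ge0.
  have : dl <= B * dl by rewrite ler_peMl// /B; lra.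
  by have := b1 r; have := b2 (- r); lra.
split; last exact: ell.
have t0 : 0 < t by rewrite mulr_gt0// exprn_gt0// ltr0n.
have tn : t != 0 by rewrite gt_eqF.
have en : ep != 0 by rewrite gt_eqF.
have cF : continuous F by rewrite /F; ccont.
have dT : der T F by move=> x; rewrite /T /F; ddat.
have IF : Int (- r) r F = T r - T (- r) by exact: IntE.
have IFle : Int (- r) r F <= B * dl.
  rewrite IF; have B0 : 0 <= B by rewrite /B; lra.
  have hr : 1 <= `|r| by rewrite ger0_norm.
  have hr' : 1 <= `|- r| by rewrite normrN ger0_norm.
  have := virial_boundary hr; have := virial_boundary hr'; rewrite normrN (ger0_norm r0) !ler_norml => /andP[u1 u2] /andP[u3 u4].
  have := ler_wpM2l B0 hf; lra.
have := Int_le rr _ cF (fun x hx => virial_pointwise N0 (theta x hx)); rewrite IF.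
have tV : 0 < t^-1 by rewrite invr_gt0.
have c1p : 0 <= c1 N.
  have [m0' w0' e0' t0'] := And4 (ltW m0) (ltW w0) (ltW e0) (ltW t0).
  rewrite /c1; apply: addr_ge0; first apply: addr_ge0.
  - by apply: mulr_ge0; [apply: mulr_ge0 => //; exact: mulr_ge0|exact: mulr_ge0].
  - apply: mulr_ge0; first by apply: addr_ge0 => //; exact: ltW.
    by apply: mulr_ge0 => //; apply: mulr_ge0 => //; exact: mulr_ge0.
  - apply: mulr_ge0; first by apply: mulr_ge0; [exact: ler0n|exact: sqr_ge0].
    by apply: addr_ge0; apply: mulr_ge0 => //; exact: mulr_ge0.
rewrite !IntD; try by ccont.
rewrite !IntZ; try by ccont.
move=> /(_ _)/wrap[]; first by ccont.
rewrite -/N => H.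
have IW1 : c1 N * Int (- r) r W <= c1 N * (8 / m) by apply: ler_wpM2l => //; exact: IW.
have c1E : c1 N * (8 / m) = 192 * ep * m * t * z 0 ^+ 2 + (1 + t^-1) * (768 * ep) * N +
   3600 * ep ^+ 2 * (z 0 ^+ 2 * m + N).
  by rewrite /c1 wE; field; apply/andP.
have tE : (1 + t^-1) * (768 * ep) * N = 768 * (ep * N) + 768 / 40 ^+ 2 * N.
  by rewrite /t; field.
have hz : z 0 ^+ 2 * (600 ^+ 2 * ep ^+ 2 * m) <= z 0 ^+ 2 * (- Int (- r) r (fun x : R => x * h' x)).
  by apply: ler_wpM2l.
have eN1 : ep * N <= 100^-1 ^+ 2 * N by apply: ler_wpM2r.
have eN2 : ep ^+ 2 * N <= (100^-1 ^+ 2) ^+ 2 * N.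
  by apply: ler_wpM2r => //; apply: lerXn2r; rewrite ?nnegrE ?exprn_ge0// ltW.
have zz : 0 <= ep ^+ 2 * m * z 0 ^+ 2 by rewrite mulr_ge0// mulr_ge0 ?sqr_ge0// ltW.
have tT : 192 * ep * m * t * z 0 ^+ 2 = 192 * 40 ^+ 2 * (ep ^+ 2 * m * z 0 ^+ 2) by rewrite /t; ring.
rewrite IF in IFle; rewrite c1E tT tE in IW1.
clear lam0' r1 hf hI rr r0 theta t0 tn en IF tV c1p c1E tE tT.
lra.
Qed.

End virial.

Section virial_vanish.
Variable R : realType.

Lemma le_all_eps (a b : R) : 0 <= b -> (forall dl, 0 < dl -> a <= b * dl) -> a <= 0.
Proof.
move=> b0 h; rewrite leNgt; apply/negP => a0.
have b1 : 0 < b + 1 by lra.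
have d0 : 0 < a / (b + 1) / 2 by rewrite !divr_gt0.
have := h _ d0; rewrite leNgt => /negP; apply.
rewrite !mulrA !ltr_pdivrMr//; nra.
Qed.

(** Let dl tend to 0 in [virial_step]: first z' = 0 and z(0) = 0, so z = 0, and
    then the elliptic bound gives y = 0. *)
Lemma virial_vanish (h h' k k' W z z' y y' : R -> R) (w m ep lam : R) :
  repulsive h h' k k' W w m ep -> 0 <= lam ->
  der z z' -> der z' (fun x => (h x - (lam - w)) * z x + k x * y x) ->
  der y y' -> der y' (fun x => (h x + (lam + w)) * y x + k x * z x) ->
  (forall dl A, 0 < dl -> exists2 r, A <= r &
     r * ((z r ^+ 2 + z' r ^+ 2 + (y r ^+ 2 + y' r ^+ 2)) +
          (z (- r) ^+ 2 + z' (- r) ^+ 2 + (y (- r) ^+ 2 + y' (- r) ^+ 2))) <= dl) ->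
  (forall x, z x = 0) /\ (forall x, y x = 0).
Proof.
move=> rp lam0 dz dz' dy dy' hr.
have step (A dl : R) : 0 < dl -> exists2 r, Num.max A 0 <= r &
  let N := Int (- r) r (fun x => z' x ^+ 2) in
  N + ep ^+ 2 * m * z 0 ^+ 2 <= 9 * (2 + 3 * w + lam) * dl /\
  w / 4 * Int (- r) r (fun x => y x ^+ 2) <= (2 + 3 * w + lam) * dl + 336 * ep ^+ 2 * (z 0 ^+ 2 * m + N).
  move=> dl0; have [A0 hA0] := rp_int rp.
  have [r + hf] := hr dl (Num.max (Num.max A 0) (Num.max A0 1)) dl0.
  rewrite ge_max => /andP[Ar]; rewrite ge_max => /andP[Ar0 r1].
  exists r => //; exact: (virial_step rp lam0 dz dz' dy dy' r1 hf (hA0 _ Ar0)).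
have m0 := rp_m rp; have w0 : 0 < w by rewrite (rp_w rp) exprn_gt0.
have e0 := rp_ep0 rp.
have cz' := der_cont dz'; have cy := der_cont dy.
have cz2 : continuous (fun x => z' x ^+ 2) by ccont.
have cy2 : continuous (fun x => y x ^+ 2) by ccont.
have B0 : 0 <= 2 + 3 * w + lam by lra.
have B9 : 0 <= 9 * (2 + 3 * w + lam) by lra.
have epm : 0 < ep ^+ 2 * m by rewrite mulr_gt0// exprn_gt0.
have N0 r : 0 <= r -> 0 <= Int (- r) r (fun x => z' x ^+ 2).
  by move=> r0; apply: Int_ge0 => // [|x _]; [lra|exact: sqr_ge0].
have z00 : z 0 = 0.
  have : ep ^+ 2 * m * z 0 ^+ 2 <= 0.
    apply: (le_all_eps B9) => dl dl0; have [r] := step 0 dl dl0.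
    rewrite maxxx => r0 /= [h1 _]; have := N0 r r0; lra.
  by rewrite pmulr_rle0// => h1; apply/eqP; rewrite -sqrf_eq0 eq_le h1 sqr_ge0.
have z'0 x : z' x = 0.
  apply/eqP; rewrite -sqrf_eq0; apply/eqP.
  apply: (Int_eq0 cz2) => [t|r r0]; first exact: sqr_ge0.
  apply: (le_all_eps B9) => dl dl0; have [r1] := step r dl dl0.
  rewrite ge_max => /andP[rr1 _] /= [h1 _].
  have := Int_sub cz2 (fun x => sqr_ge0 (z' x)) r0 rr1.
  by rewrite z00 expr0n mulr0 addr0 in h1; lra.
have zz x : z x = 0.
  rewrite -z00; apply: der0_cst => t; apply: dat_eq; first exact: dz.
  exact: z'0.
split => // x; apply/eqP; rewrite -sqrf_eq0; apply/eqP.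
apply: (Int_eq0 cy2) => [t|r r0]; first exact: sqr_ge0.
have w4 : 0 < w / 4 by lra.
rewrite -(pmulr_rle0 _ w4).
apply: (le_all_eps B0) => dl dl0; have [r1] := step r dl dl0.
rewrite ge_max => /andP[rr1 _] /= [_ h1].
have I0 : Int (- r1) r1 (fun x => z' x ^+ 2) = 0.
  rewrite (@IntE _ _ (fun=> 0)) ?subrr// => t; rewrite z'0 expr0n; exact: dat_cst.
rewrite I0 z00 expr0n mul0r addr0 mulr0 addr0 in h1.
apply: le_trans h1; apply: ler_wpM2l; first exact: ltW.
exact: Int_sub cy2 (fun x => sqr_ge0 (y x)) r0 rr1.
Qed.

End virial_vanish.

(** * The transformed potentials *)

Section potentials.
Variable R : realType.
Variables (g p : R -> R) (w ep : R).
Implicit Types (x a c d t e : R).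
Hypothesis st : setting g p w ep.

Let s x := p x ^+ 2.
Let gs x := g (s x).
Let gps x := gp g (s x).
Let b := logder p.
Let W := weight w.
Let m : R := Num.sqrt w.

Definition Gratio x := primitive g (p x ^+ 2) / p x ^+ 2.
Let Gq := Gratio.

(** The diagonal and coupling parts of the potentials of the transformed system;
    they are linear in g and vanish when g is linear, which makes them smaller
    than the original potentials by a factor ep. *)
Definition pot_h x := - 3 * g (p x ^+ 2) + p x ^+ 2 * gp g (p x ^+ 2) + 4 * Gratio x.
Definition pot_k x := 2 * g (p x ^+ 2) - p x ^+ 2 * gp g (p x ^+ 2) - 2 * Gratio x.

Definition dpot_h x := (s x * gpp g (s x) - 2 * (gps x - gs x / s x) +
  2 * (gs x / s x - 2 * Gq x / s x)) * (2 * b x * s x).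
Definition dpot_k x := (- (s x * gpp g (s x)) + (gps x - gs x / s x) -
  (gs x / s x - 2 * Gq x / s x)) * (2 * b x * s x).

Lemma Gratio_der : der Gq (fun x => 2 * b x * (gs x - Gq x)).
Proof.
move=> x; have d1 := Gs_x_der st; have d2 := s_der st; have sn := sne0 st x.
apply: dat_eq.
  by rewrite /Gq /Gratio; apply: datM; [exact: d1|apply: datV; [exact: sn|exact: d2]].
rewrite /= /Gq /Gratio /b /gs /s; field; exact: (pne0 st).
Qed.

Lemma pot_h_der : der pot_h dpot_h.
Proof.
move=> x; have d1 := gs_x_der st; have d2 := s_der st; have d3 := gps_x_der st.
have d4 : der Gratio _ := Gratio_der; have d5 := p_der st; have sn := sne0 st x.
apply: dat_eq; first by rewrite /pot_h; repeat dat_step.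
rewrite /= /dpot_h /gps /gs /s /Gq /b; field; exact: (pne0 st).
Qed.

Lemma pot_k_der : der pot_k dpot_k.
Proof.
move=> x; have d1 := gs_x_der st; have d2 := s_der st; have d3 := gps_x_der st.
have d4 : der Gratio _ := Gratio_der; have d5 := p_der st; have sn := sne0 st x.
apply: dat_eq; first by rewrite /pot_k; repeat dat_step.
rewrite /= /dpot_k /gps /gs /s /Gq /b; field; exact: (pne0 st).
Qed.

Lemma s_inv_cont : continuous (fun x => (s x)^-1).
Proof. apply: contV; [exact: (sne0 st)|exact: der_cont (s_der st)]. Qed.

Lemma dpots_cont : continuous dpot_h /\ continuous dpot_k.
Proof.
have c1 := s_inv_cont; have c2 := der_cont (s_der st).
have c3 := der_cont (gs_x_der st); have c4 := der_cont (gps_x_der st).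
have c5 := gpps_cont st; have c6 := der_cont Gratio_der.
have c7 : continuous b := der_cont (logder_der st).
have c8 : continuous s := c2. have c9 : continuous gs := c3.
have c10 : continuous gps := c4.
have cA : continuous (fun x => s x * gpp g (s x)) by exact: contM.
have cB : continuous (fun x => gs x / s x) by exact: contM.
have cC : continuous (fun x => 2 * Gq x / s x) by apply: contM => //; apply: contM => //; exact: cont_cst.
split.
  apply: contM; last by ccont.
  apply: contD; last by apply: contM; [exact: cont_cst|exact: contD cB (contN cC)].
  apply: contD => //; apply: contN; apply: contM; [exact: cont_cst|exact: contD c10 (contN cB)].
apply: contM; last by ccont.
apply: contD; last by apply: contN; exact: contD cB (contN cC).
by apply: contD; [exact: contN|exact: contD c10 (contN cB)].
Qed.

(** With D = s g' - g, E = g - 2 G/s and D2 = s g'', the potentials are D - 2 E and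
    - D + E, and their s-derivatives combine D2, D and E again. *)
Lemma pot_parts x : exists D E D2 : R,
  [/\ `|D| <= ep * s x, `|E| <= ep * s x / 2 & `|D2| <= ep] /\
  [/\ pot_h x = D - 2 * E, pot_k x = - D + E,
   dpot_h x = (D2 * s x - 2 * D + 2 * E) * (2 * b x) &
   dpot_k x = (- (D2 * s x) + D - E) * (2 * b x)].
Proof.
have hs := gs_in st x; have sn : s x != 0 := sne0 st x.
have s0 : 0 < s x := gs_s0 st x.
exists (s x * gps x - gs x), (gs x - 2 * Gq x), (s x * gpp g (s x)); split.
  split; [exact: (n0_D (st_near0 st) hs)| |exact: (n0_gpp (st_near0 st) hs)].
  have := n0_E (st_near0 st) hs; rewrite -/(s x) -/(gs x) => h.
  have -> : gs x - 2 * Gq x = (s x * gs x - 2 * primitive g (s x)) / s x.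
    by rewrite /Gq /Gratio -/(s x); field.
  by rewrite normrM normfV (gtr0_norm s0) ler_pdivrMr//; lra.
split.
- by rewrite /pot_h -/Gq /gs /gps /s; ring.
- by rewrite /pot_k -/Gq /gs /gps /s; ring.
- by rewrite /dpot_h; field.
- by rewrite /dpot_k; field.
Qed.

Lemma pots_bound x :
  [/\ `|pot_h x| <= 2 * ep * s x, `|pot_k x| <= 3 / 2 * ep * s x,
   `|dpot_h x| <= 8 * ep * m * s x & `|dpot_k x| <= 5 * ep * m * s x].
Proof.
have [D [E [D2 [[hD hE hD2] [-> -> -> ->]]]]] := pot_parts x.
have s0 : 0 < s x := gs_s0 st x; have e0 := ep_ge0 st.
have hb : `|b x| <= m := logder_le st x.
have m0 : 0 <= m := sqrtr_ge0 w.
have tr (u v : R) : `|u + v| <= `|u| + `|v| := ler_normD u v.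
have hD2s : `|D2 * s x| <= ep * s x.
  by rewrite normrM (gtr0_norm s0); apply: ler_wpM2r => //; exact: ltW.
have h2b : `|2 * b x| <= 2 * m by rewrite normrM (ger0_norm (ler0n R 2)); lra.
have n2 (u : R) : `|2 * u| = 2 * `|u| by rewrite normrM (ger0_norm (ler0n R 2)).
split.
- by apply: le_trans (ler_normB _ _) _; rewrite n2; lra.
- by apply: le_trans (tr _ _) _; rewrite normrN; lra.
- rewrite normrM (_ : 8 * ep * m * s x = (4 * (ep * s x)) * (2 * m)); last by ring.
  apply: ler_pM => //; apply: le_trans (tr _ _) _; rewrite n2.
  by apply: (@le_trans _ _ (`|D2 * s x| + `|2 * D| + 2 * `|E|)); [rewrite lerD2r; exact: ler_normB|rewrite n2; lra].
- rewrite normrM (_ : 5 * ep * m * s x = (5 / 2 * (ep * s x)) * (2 * m)); last by field.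
  apply: ler_pM => //; apply: le_trans (ler_normB _ _) _.
  by apply: (@le_trans _ _ (`|D2 * s x| + `|D| + `|E|)); [rewrite lerD2r -[`|D2 * _|]normrN; exact: ler_normD|lra].
Qed.

Lemma weight_le1 x : W x <= 1.
Proof.
have w0 := st_w0 st; rewrite /W /weight invf_le1.
  by rewrite lerDl divr_ge0// mulr_ge0 ?sqr_ge0// ltW.
by rewrite ltr_pwDl// divr_ge0// mulr_ge0 ?sqr_ge0// ltW.
Qed.

Lemma m_gt0 : 0 < m. Proof. by rewrite sqrtr_gt0 (st_w0 st). Qed.

Lemma m_sq : w = m ^+ 2. Proof. by rewrite sqr_sqrtr// ltW// (st_w0 st). Qed.

Lemma weight_mx x : m * `|x| * W x <= 1.
Proof.
have w0 := st_w0 st; have P := weight_gt0 st x.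
rewrite /W -[leRHS](mulVf (lt0r_neq0 P)); apply: ler_wpM2r; first exact: ltW.
rewrite /weight invrK m_sq -[x ^+ 2]real_normK ?num_real//.
by have := sqr_ge0 (m * `|x| / 2 - 1); lra.
Qed.

Lemma weight_mx2 x : w * x ^+ 2 * W x <= 4.
Proof.
have w0 := st_w0 st; have P := weight_gt0 st x.
have -> : w * x ^+ 2 * W x = 4 * (1 - W x).
  rewrite /W /weight; field; rewrite gt_eqF// .
  have : 0 <= w * x ^+ 2 by rewrite mulr_ge0 ?sqr_ge0// ltW.
  by lra.
by have : 0 <= W x := ltW P; lra.
Qed.

(** The primitive of the weight is an arctangent, and pi/2 < 2. *)
Lemma weight_Int r : 0 <= r -> Int (- r) r W <= 8 / m.
Proof.
move=> r0; have m0 := m_gt0; have mn : m != 0 by rewrite gt_eqF.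
have q0 x : 1 + w * x ^+ 2 / 4 != 0 by have := weight_gt0 st x; rewrite /weight invr_gt0 => /lt0r_neq0.
have cW : continuous W by apply: contV => //; ccont.
rewrite (@IntE _ _ (fun x => 2 / m * atan (m * x / 2)))//; last first.
  move=> x; have da : dat (@atan R) (m * x / 2) (1 + (m * x / 2) ^+ 2)^-1 by exact: is_derive1_atan.
  have d : dat (fun x => atan (m * x / 2)) x ((1 + (m * x / 2) ^+ 2)^-1 * (m / 2)).
    apply: dat_eq; first by apply: (@dat_comp _ (@atan R) (fun x => m * x / 2)); [exact: da|repeat dat_step].
    by rewrite /=; ring.
  apply: dat_eq; first by repeat dat_step.
  rewrite /= /W /weight m_sq; field; rewrite mn andbT gt_eqF//.
  by rewrite ltr_pwDl// sqr_ge0.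
have h1 := atan_ltpi2 (m * r / 2); have h2 := atan_gtNpi2 (m * - r / 2).
have h3 := pihalf_lt2 R.
have h : 2 / m * (atan (m * r / 2) - atan (m * - r / 2)) <= 2 / m * 4.
  by apply: ler_wpM2l; [rewrite divr_ge0// ltW|lra].
lra.
Qed.

End potentials.

Section improper.
Variable R : realType.

Lemma Int_cvg (f : R -> R) : continuous f ->
  (leb R).-integrable setT (EFin \o f) ->
  Int (- n%:R) n%:R f @[n --> \oo] --> \int[leb R]_x f x.
Proof.
move=> cf fi.
have mT : measurable ([set: R] : set (measurableTypeR R)) by [].
have mf : measurable_fun setT f := cont_measurable cf.
pose A (n : nat) : set (measurableTypeR R) := `[- n%:R, n%:R].
have mA n : measurable (A n) by exact: measurable_itv.
have [|||||i1 _ h] := @dominated_convergence _ _ _ (leb R) _ mT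
   (fun n => EFin \o (f \_ (A n))) (EFin \o f) (EFin \o (fun x => `|f x|)).
- move=> n; apply/measurable_EFinP.
  by apply/(measurable_restrictT _ _).1 => //; exact: measurable_funTS.
- exact/measurable_EFinP.
- apply: aeW => x _; apply: cvg_near_cst.
  have [N hN] : exists N : nat, `|x| <= N%:R.
    by exists (Num.truncn `|x|).+1; rewrite ltW// truncnS_gt.
  exists N => // n /= Nn; congr (_%:E); rewrite patchE; case: ifPn => //.
  rewrite notin_setE /A /= in_itv /= -ler_norml => /negP.
  by rewrite (le_trans hN)// ler_nat.
- exact: ig_norm.
- apply: aeW => x n _ /=; rewrite lee_fin patchE; case: ifPn => // _.
  by rewrite normr0.
have -> : (fun n : nat => Int (- n%:R) n%:R f) = (fun n => \int[leb R]_x (f \_ (A n)) x).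
  apply/funext => n; have nn : - n%:R <= n%:R :> R by rewrite (@le_trans _ _ 0)// oppr_le0.
  by rewrite -(Rintegral_Int nn cf) Rintegral_mkcond.
apply: fine_cvg; move: h; rewrite fineK//; exact: integrable_fin_num.
Qed.

End improper.

Section repulsivity.
Variable R : realType.
Variables (g p : R -> R) (w ep : R).
Hypothesis st : setting g p w ep.

Let W := weight w.
Let m : R := Num.sqrt w.

Lemma weight_decr (x r : R) : 0 <= r -> r <= `|x| -> W x <= W r.
Proof.
move=> r0 rx; have w0 := st_w0 st.
have q (y : R) : 0 < 1 + w * y ^+ 2 / 4.
  by rewrite -invr_gt0; exact: (weight_gt0 st y).
rewrite /W /weight lef_pV2 ?posrE//.
have h : r ^+ 2 <= x ^+ 2.
  by rewrite -[x ^+ 2]real_normK ?num_real//; apply: lerXn2r; rewrite ?nnegrE.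
by have := ler_wpM2l (ltW w0) h; lra.
Qed.

Lemma pot_h_weight x : `|pot_h g p x| <= 6 * ep * w * (W x * W x).
Proof.
have [h _ _ _] := pots_bound st x; have d := decay st x; have e0 := ep_ge0 st.
apply: le_trans h _.
have : 2 * ep * p x ^+ 2 <= 2 * ep * (3 * w * W x ^+ 2) by apply: ler_wpM2l => //; lra.
by rewrite expr2; lra.
Qed.

Lemma pot_tail r r' : 0 <= r -> r <= r' ->
  Int r r' (pot_h g p) + Int (- r') (- r) (pot_h g p) <= 48 * ep * m * W r.
Proof.
move=> r0 rr'; have w0 := st_w0 st; have e0 := ep_ge0 st.
have ch := der_cont (pot_h_der st); have m0 : 0 < m := m_gt0 st.
have P2 : 0 < W r := weight_gt0 st r.
have cW : continuous W.
  apply: contV => [x|]; last by ccont.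
  by have := weight_gt0 st x; rewrite invr_gt0 => /lt0r_neq0.
pose c := 6 * ep * w * W r.
have c0 : 0 <= c by rewrite !mulr_ge0// ltW.
have cc : continuous (fun x => c * W x) by ccont.
have bnd x : r <= `|x| -> pot_h g p x <= c * W x.
  move=> rx; apply: le_trans (ler_norm _) _; apply: le_trans (pot_h_weight x) _.
  rewrite /c -[leRHS]mulrA; apply: ler_wpM2l; first by rewrite !mulr_ge0// ltW.
  by apply: ler_wpM2r; [exact: ltW (weight_gt0 st x)|exact: weight_decr].
have b1 : Int r r' (pot_h g p) <= Int r r' (fun x => c * W x).
  by apply: Int_le => // x /andP[rx _]; apply: bnd; rewrite (le_trans rx)// ler_norm.
have b2 : Int (- r') (- r) (pot_h g p) <= Int (- r') (- r) (fun x => c * W x).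
  apply: Int_le => // [|x /andP[_ xr]]; first by rewrite lerN2.
  by apply: bnd; rewrite -normrN; apply: le_trans (ler_norm _); rewrite lerNr.
have r'0 : 0 <= r' by lra.
have I1 : Int (- r') r' W <= 8 / m := weight_Int st r'0.
have I2 : 0 <= Int (- r) r W.
  by apply: Int_ge0 => // [|x _]; [lra|exact: ltW (weight_gt0 st x)].
rewrite !IntZ// in b1 b2.
have I3 : Int r r' W + Int (- r') (- r) W <= 8 / m.
  by move: I1; rewrite (IntC _ (- r') (- r) r') (IntC _ (- r) r r'); lra.
have : c * (Int r r' W + Int (- r') (- r) W) <= c * (8 / m) by exact: ler_wpM2l.
have -> : c * (8 / m) = 48 * ep * m * W r.
  by rewrite /c (m_sq st) -/m; field; rewrite gt_eqF.
lra.
Qed.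

Lemma pot_h_integrable : (leb R).-integrable setT (EFin \o (pot_h g p)).
Proof.
case: (st_gs st) => -[lp _] _ _ _ _.
have h : (leb R).-integrable setT (EFin \o (fun x => 2 * ep * p x ^+ 2)).
  exact: igZ (Lfun2_integrable_sqr lp).
have mT : measurable ([set: R] : set (measurableTypeR R)) by [].
apply: le_integrable h => //.
  by apply/measurable_EFinP; exact: cont_measurable (der_cont (pot_h_der st)).
move=> x _ /=; rewrite lee_fin; have [k _ _ _] := pots_bound st x.
exact: le_trans k (ler_norm _).
Qed.

(** Integrate by parts: - int x h' = int h - [x h].  The boundary term and the tail
    of int h are bounded by ep sqrt w W(r), which is less than a small multiple
    of ep^2 sqrt w for r large; they use up the unit added to 600^2. *)
Lemma pot_int_lower :
  0 < ep -> (600 ^+ 2 + 1) * ep ^+ 2 * m <= \int[leb R]_x pot_h g p x ->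
  exists A, forall r, A <= r ->
     600 ^+ 2 * ep ^+ 2 * m <= - Int (- r) r (fun x => x * dpot_h g p x).
Proof.
move=> e0 hI; have w0 := st_w0 st; have m0 : 0 < m := m_gt0 st.
have ch := der_cont (pot_h_der st); have [cdh _] := dpots_cont st.
have cx : continuous (fun x : R => x * dpot_h g p x) by apply: contM => //; exact: cont_id.
pose A := 1 + 60 * 4 / (w * ep).
have q0 : 0 < 60 * 4 / (w * ep) by rewrite divr_gt0 ?mulr_gt0.
exists A => r Ar.
have r1 : 1 <= r by rewrite /A in Ar; lra.
have r0 : 0 <= r by lra.
have Wr : W r <= ep / 60.
  have := weight_mx2 st r; rewrite -/W => h.
  have P2 : 0 < W r := weight_gt0 st r.
  have rq : 60 * 4 / (w * ep) <= r ^+ 2.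
    by apply: (@le_trans _ _ r); [rewrite /A in Ar; lra|rewrite expr2 ler_peMl].
  rewrite ler_pdivrMr ?mulr_gt0// in rq.
  have : 60 * 4 * W r <= r ^+ 2 * (w * ep) * W r by apply: ler_wpM2r => //; exact: ltW.
  have : ep * (w * r ^+ 2 * W r) <= ep * 4 by apply: ler_wpM2l => //; exact: ltW.
  lra.
have lim := Int_cvg ch pot_h_integrable.
have low : \int[leb R]_x pot_h g p x <= Int (- r) r (pot_h g p) + 48 * ep * m * W r.
  apply: (cvgr_to_le lim).
  near=> n.
  have rn : r <= n%:R by near: n; exact: nbhs_infty_ger.
  have := pot_tail r0 rn; rewrite (IntC _ (- n%:R) (- r) n%:R) (IntC _ (- r) r n%:R); lra.
have parts : - Int (- r) r (fun x => x * dpot_h g p x) =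
   Int (- r) r (pot_h g p) - r * (pot_h g p r + pot_h g p (- r)).
  have d := pot_h_der st.
  have e : Int (- r) r (fun x => pot_h g p x + x * dpot_h g p x) =
     r * pot_h g p r - (- r) * pot_h g p (- r).
    rewrite (@IntE _ _ (fun x => x * pot_h g p x)); [by []|exact: contD|].
    by move=> x; ddat.
  rewrite IntD// in e; lra.
have bd x : `|x| = r -> r * pot_h g p x <= 6 * ep * m * W r.
  move=> xr; have Wx : W x = W r.
    by rewrite /W /weight -xr real_normK ?num_real.
  have h1 : pot_h g p x <= 6 * ep * w * (W r * W r).
    by apply: le_trans (ler_norm _) _; rewrite -Wx; exact: pot_h_weight.
  have := weight_mx st r; rewrite -/m -/W (ger0_norm r0) => h2.
  have h3 : r * pot_h g p x <= r * (6 * ep * w * (W r * W r)) by exact: ler_wpM2l.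
  have h4 : 6 * ep * m * W r * (m * r * W r) <= 6 * ep * m * W r * 1.
    by apply: ler_wpM2l => //; rewrite !mulr_ge0 ?(ltW e0) ?(ltW m0)//; exact: ltW (weight_gt0 st r).
  by apply: le_trans h3 _; rewrite (m_sq st) -/m; lra.
have b1 := bd r (ger0_norm r0).
have b2 : r * pot_h g p (- r) <= 6 * ep * m * W r by apply: bd; rewrite normrN ger0_norm.
have : 60 * ep * m * W r <= ep ^+ 2 * m.
  have : 60 * (ep * m) * W r <= 60 * (ep * m) * (ep / 60).
    by apply: ler_wpM2l => //; rewrite !mulr_ge0// ltW.
  by lra.
rewrite parts mulrDr; lra.
Unshelve. all: by end_near. Qed.

Lemma pot_repulsive :
  0 < ep -> (600 ^+ 2 + 1) * ep ^+ 2 * m <= \int[leb R]_x pot_h g p x ->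
  repulsive (pot_h g p) (dpot_h g p) (pot_k g p) (dpot_k g p) W w m ep.
Proof.
move=> e0 hI; have w0 := st_w0 st; have m0 : 0 < m := m_gt0 st.
have e1 := st_ep st.
have [cdh cdk] := dpots_cont st.
have cW : continuous W.
  apply: contV => [x|]; last by ccont.
  by have := weight_gt0 st x; rewrite invr_gt0 => /lt0r_neq0.
have W0 x : 0 < W x := weight_gt0 st x.
have W1 x : W x <= 1 := weight_le1 st x.
have sW x : p x ^+ 2 <= 3 * w * (W x * W x) by rewrite -expr2; exact: (decay st x).
have s3 x : p x ^+ 2 <= 3 * w by exact: ltW (gs_s3w st x).
have u1 x : m * `|x| * W x <= 1 := weight_mx st x.
have u2 x : w * x ^+ 2 * W x <= 4 := weight_mx2 st x.
have wE := m_sq st.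
have em : 0 <= ep * m by rewrite mulr_ge0// ltW.
have WW x : W x * W x <= W x by rewrite ger_pMr.
have nx x : 0 <= `|x| := normr_ge0 x.
have hh1 x : `|x| * `|dpot_h g p x| <= 24 * ep * w * W x * (m * `|x| * W x).
  have [_ _ h _] := pots_bound st x; rewrite -/m in h.
  have : 8 * ep * m * p x ^+ 2 <= 8 * ep * m * (3 * w * (W x * W x)).
    by apply: ler_wpM2l => //; rewrite -mulrA mulr_ge0.
  move=> h2; have : `|x| * `|dpot_h g p x| <= `|x| * (8 * ep * m * (3 * w * (W x * W x))).
    by apply: ler_wpM2l => //; exact: le_trans h h2.
  lra.
have kk1 x : `|x| * `|dpot_k g p x| <= 15 * ep * w * W x * (m * `|x| * W x).
  have [_ _ _ h] := pots_bound st x; rewrite -/m in h.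
  have : 5 * ep * m * p x ^+ 2 <= 5 * ep * m * (3 * w * (W x * W x)).
    by apply: ler_wpM2l => //; rewrite -mulrA mulr_ge0.
  move=> h2; have : `|x| * `|dpot_k g p x| <= `|x| * (5 * ep * m * (3 * w * (W x * W x))).
    by apply: ler_wpM2l => //; exact: le_trans h h2.
  lra.
have kk0 x : pot_k g p x ^+ 2 <= 21 * ep ^+ 2 * w ^+ 2 * (W x * W x).
  have [_ h _ _] := pots_bound st x.
  have h2 : `|pot_k g p x| <= 9 / 2 * ep * w * W x.
    apply: le_trans h _; have : ep * p x ^+ 2 <= ep * (3 * w * (W x * W x)).
      by apply: ler_wpM2l => //; exact: ltW.
    have : ep * (3 * w * (W x * W x)) <= ep * (3 * w * W x).
      by apply: ler_wpM2l; [exact: ltW|apply: ler_wpM2l => //; rewrite mulr_ge0// ltW].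
    lra.
  have : `|pot_k g p x| ^+ 2 <= (9 / 2 * ep * w * W x) ^+ 2.
    by apply: lerXn2r; rewrite ?nnegrE// !mulr_ge0// ltW.
  rewrite real_normK ?num_real// => h3; apply: le_trans h3 _.
  have : 0 <= (ep * w * W x) ^+ 2 by exact: sqr_ge0.
  rewrite !exprMn; lra.
have xkk x : (x * dpot_k g p x) ^+ 2 <= 225 * ep ^+ 2 * w ^+ 2 * (W x * W x).
  rewrite -[_ ^+ 2]real_normK ?num_real// normrM.
  have h2 : `|x| * `|dpot_k g p x| <= 15 * ep * w * W x.
    apply: le_trans (kk1 x) _; rewrite ler_piMr// !mulr_ge0// ltW//.
  have : (`|x| * `|dpot_k g p x|) ^+ 2 <= (15 * ep * w * W x) ^+ 2.
    have n1 : 0 <= 15 * ep * w * W x by rewrite !mulr_ge0// ltW.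
    by apply: lerXn2r; rewrite ?nnegrE//; exact: mulr_ge0.
  rewrite !exprMn; lra.
have c1 x (C : R) : 0 <= C -> `|x| * (C * w ^+ 2 * (W x * W x)) <= C * (w * m) * W x.
  move=> C0.
  have : C * (w * m) * W x * (m * `|x| * W x) <= C * (w * m) * W x * 1.
    by apply: ler_wpM2l => //; rewrite !mulr_ge0// ltW.
  rewrite mulr1 => h; apply: le_trans h; rewrite le_eqVlt; apply/orP; left; apply/eqP.
  by rewrite -/m in wE; rewrite [w ^+ 2]expr2 {2}wE; ring.
have e2 : 0 <= ep ^+ 2 by exact: sqr_ge0.
have w2 : 0 <= w ^+ 2 by exact: sqr_ge0.
have n21 : 0 <= 21 * ep ^+ 2 by apply: mulr_ge0 e2; exact: ler0n.
have n225 : 0 <= 225 * ep ^+ 2 by apply: mulr_ge0 e2; exact: ler0n.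
have n24 x : 0 <= 24 * ep * w * W x by rewrite !mulr_ge0// ltW.
split; [exact: m0|exact: wE|exact: e0|exact: e1|exact: (pot_h_der st)|exact: (pot_k_der st)|
  exact: cdh|exact: cdk|exact: cW|by move=> x; exact: ltW|exact: W1|..].
- by move=> r r0; exact: (weight_Int st r0).
- move=> x; have [h _ _ _] := pots_bound st x; apply: le_trans h _.
  have : ep * p x ^+ 2 <= 100^-1 ^+ 2 * (3 * w) by apply: ler_pM => //; [exact: ltW|exact: sqr_ge0].
  lra.
- move=> x; have [_ h _ _] := pots_bound st x; apply: le_trans h _.
  have : ep * p x ^+ 2 <= 100^-1 ^+ 2 * (3 * w) by apply: ler_pM => //; [exact: ltW|exact: sqr_ge0].
  lra.
- by move=> x; rewrite normrM; apply: le_trans (hh1 x) _; rewrite ler_piMr.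
- move=> x; rewrite normrM.
  have : `|x| * (`|x| * `|dpot_h g p x|) <= `|x| * (24 * ep * w * W x * (m * `|x| * W x)).
    by apply: ler_wpM2l.
  have : 24 * ep * m * W x * (w * x ^+ 2 * W x) <= 24 * ep * m * W x * 4.
    by apply: ler_wpM2l => //; rewrite !mulr_ge0// ltW.
  by rewrite -[x ^+ 2]real_normK ?num_real//; lra.
- by move=> x; apply: le_trans (kk0 x) _; apply: ler_wpM2l (WW x); exact: mulr_ge0.
- by move=> x; apply: le_trans (c1 x (21 * ep ^+ 2) n21); apply: ler_wpM2l.
- by move=> x; apply: le_trans (xkk x) _; apply: ler_wpM2l (WW x); exact: mulr_ge0.
- by move=> x; apply: le_trans (c1 x (225 * ep ^+ 2) n225); apply: ler_wpM2l.
- exact: pot_int_lower.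
Qed.

End repulsivity.

(** * The Darboux transformation *)

Section transform.
Variable R : realType.
Variables (g p : R -> R) (w ep : R).
Hypothesis st : setting g p w ep.

Let b : R -> R := logder p.

Definition Vminus w x := w - p x ^+ 2 + g (p x ^+ 2).
Definition Vplus w x :=
  w - 3 * p x ^+ 2 + g (p x ^+ 2) + 2 * p x ^+ 2 * gp g (p x ^+ 2).

Definition dlogder x : R := - p x ^+ 2 / 2 + g (p x ^+ 2) - Gratio g p x.
Let db := dlogder.

Lemma logder_der' : der b db.
Proof. exact: (logder_der st). Qed.

Lemma riccati x : w = b x ^+ 2 + p x ^+ 2 / 2 - Gratio g p x.
Proof. by have := logder_sq st x; rewrite -/b -/(Gratio g p x) => ->; ring. Qed.

(** The transformation acts on a function and its derivative.  [sop] is the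
    operator S u = u' - (p'/p) u, [zop] is S^2 X, simplified by X'' = V_- X - P,
    and [uop] is 2 (Y p'' - Y' p')/p - Q. *)
Definition sop (X X' : R -> R) x := X' x - logder p x * X x.
Definition zop (X X' P : R -> R) x := - 2 * logder p x * sop X X' x - P x.
Definition zop' (X X' P P' : R -> R) x :=
  - 2 * dlogder x * sop X X' x - 2 * logder p x * (- logder p x * sop X X' x - P x) - P' x.
Definition uop (Y Y' Q : R -> R) x := 2 * Vminus w x * Y x - 2 * logder p x * Y' x - Q x.
Definition uop' (Y Y' Q Q' : R -> R) x :=
  - logder p x * uop Y Y' Q x - sop Q Q' x.

Lemma g_der : der (fun x => g (p x ^+ 2)) (fun x => gp g (p x ^+ 2) * (2 * b x * p x ^+ 2)).
Proof. exact: (gs_x_der st). Qed.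

Lemma sop_der (X X' P : R -> R) :
  der X X' -> der X' (fun x => Vminus w x * X x - P x) ->
  der (sop X X') (fun x => - b x * sop X X' x - P x).
Proof.
move=> dX dX' x; have d1 : der (logder p) db := logder_der'.
apply: dat_eq; first by rewrite /sop; repeat dat_step.
by rewrite /= /sop /Vminus /db /dlogder /b (riccati x) /b; field.
Qed.

Lemma zop_der (X X' P P' : R -> R) :
  der X X' -> der X' (fun x => Vminus w x * X x - P x) -> der P P' ->
  der (zop X X' P) (zop' X X' P P').
Proof.
move=> dX dX' dP x; have d1 : der (logder p) db := logder_der'.
have d2 := sop_der dX dX'.
apply: dat_eq; first by rewrite /zop; repeat dat_step.
by rewrite /= /zop' /db /b; ring.
Qed.

(** The right-hand side is linear in the same transforms of P and its source Q,
    so the transformation is compatible with the coupling. *)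
Lemma zop'_der (X X' P P' Q : R -> R) :
  der X X' -> der X' (fun x => Vminus w x * X x - P x) ->
  der P P' -> der P' (fun x => Vplus w x * P x - Q x) ->
  der (zop' X X' P P')
    (fun x => (w + pot_h g p x - pot_k g p x) * zop X X' P x - uop P P' Q x).
Proof.
move=> dX dX' dP dP' x; have d1 : der (logder p) db := logder_der'.
have d2 := sop_der dX dX'.
have d3 := p_der st; have d4 := g_der; have d5 := Gratio_der st.
have d6 : der dlogder (fun x => - b x * p x ^+ 2 + gp g (p x ^+ 2) * (2 * b x * p x ^+ 2) -
    2 * b x * (g (p x ^+ 2) - Gratio g p x)).
  move=> y; apply: dat_eq; first by rewrite /dlogder; repeat dat_step.
  by rewrite /= /b; field.
apply: dat_eq; first by rewrite /zop'; repeat dat_step.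
rewrite /= /zop /uop /Vminus /Vplus /pot_h /pot_k /db /dlogder /b (riccati x) /b.
by field.
Qed.

Lemma uop_der (Y Y' Q Q' : R -> R) :
  der Y Y' -> der Y' (fun x => Vplus w x * Y x - Q x) -> der Q Q' ->
  der (uop Y Y' Q) (uop' Y Y' Q Q').
Proof.
move=> dY dY' dQ x; have d1 : der (logder p) db := logder_der'.
have d3 := p_der st; have d4 := g_der.
apply: dat_eq; first by rewrite /uop /Vminus; repeat dat_step.
by rewrite /= /uop' /uop /sop /Vminus /Vplus /db /dlogder /b (riccati x) /b; field.
Qed.

Lemma uop'_der (Y Y' Q Q' P : R -> R) :
  der Y Y' -> der Y' (fun x => Vplus w x * Y x - Q x) ->
  der Q Q' -> der Q' (fun x => Vminus w x * Q x - P x) ->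
  der (uop' Y Y' Q Q')
    (fun x => (w + pot_h g p x + pot_k g p x) * uop Y Y' Q x - zop Q Q' P x).
Proof.
move=> dY dY' dQ dQ' x; have d1 : der (logder p) db := logder_der'.
have d2 := uop_der dY dY' dQ; have d3 := sop_der dQ dQ'.
apply: dat_eq; first by rewrite /uop'; repeat dat_step.
rewrite /= /zop /uop' /pot_h /pot_k /db /dlogder /b.
rewrite [in RHS](riccati x) /b; by field.
Qed.

End transform.

(** * Vanishing of the transformed system *)

Section recurrence.
Variable R : realType.

Lemma Int_le_Rintegral (F : R -> R) r : 0 <= r -> continuous F -> (forall x, 0 <= F x) ->
  (leb R).-integrable setT (EFin \o F) -> Int (- r) r F <= \int[leb R]_x F x.
Proof.
move=> r0 cF F0 iF; have rr : - r <= r by lra.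
have lim := Int_cvg cF iF.
apply: (cvgr_to_ge lim); near=> n.
by apply: Int_sub => //; near: n; exact: nbhs_infty_ger.
Unshelve. all: by end_near. Qed.

(** Otherwise F(r) + F(- r) > dl/r for all large r, and the integral of F up to
    exp t would grow like dl t. *)
Lemma integrable_recurrent (F : R -> R) : continuous F -> (forall x, 0 <= F x) ->
  (leb R).-integrable setT (EFin \o F) ->
  forall dl A, 0 < dl -> exists2 r, A <= r & r * (F r + F (- r)) <= dl.
Proof.
move=> cF F0 iF dl A dl0; apply: contrapT => hn.
have hr r : A <= r -> dl < r * (F r + F (- r)).
  by move=> Ar; rewrite ltNge; apply/negP => h; apply: hn; exists r.
have dp := prim_der cF.
pose T := `|A|.
have eT t : T <= t -> A <= expR t.
  move=> Tt; apply: le_trans (ler_norm A) _; apply: le_trans Tt _.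
  by apply: le_trans (expR_ge1Dx t); rewrite lerDr.
have [I I0 up] : exists2 I : R, 0 <= I &
    forall t, prim F (expR t) - prim F (- expR t) <= I.
  exists (\int[leb R]_x F x); first exact: Rintegral_ge0.
  by move=> t; exact: (Int_le_Rintegral (expR_ge0 t)).
pose t1 := T + (I + 1) / dl.
have Tt1 : T <= t1 by rewrite lerDl divr_ge0 ?ltW//; lra.
pose G t := prim F (expR t) - prim F (- expR t) - dl * t.
have dG : der G (fun t => expR t * (F (expR t) + F (- expR t)) - dl).
  move=> t.
  have de : dat (fun t => expR t) t (expR t) := dat_exp t.
  have d1 : dat (fun t => prim F (expR t)) t (F (expR t) * expR t).
    by apply: (@dat_comp _ (prim F) (@expR R)); [exact: dp|exact: dat_exp].
  have d2 : dat (fun t => prim F (- expR t)) t (F (- expR t) * - expR t).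
    by apply: (@dat_comp _ (prim F) (fun t => - expR t)); [exact: dp|apply: datN; exact: dat_exp].
  apply: dat_eq; first by rewrite /G; repeat first [exact: d1 | exact: d2 | dat_step].
  by rewrite /=; ring.
have : G T <= G t1.
  apply: (@der_ge0_le _ G _ _ _ Tt1 (fun t _ => dG t)) => t /andP[Tt _].
  by rewrite subr_ge0 ltW// hr// eT.
have low : 0 <= prim F (expR T) - prim F (- expR T).
  apply: Int_ge0 => //; have := expR_ge0 T; lra.
rewrite /G; have := up t1.
have -> : dl * t1 = dl * T + (I + 1) by rewrite /t1; field; rewrite gt_eqF.
move: low; move: (prim F _) (prim F _) (prim F _) (prim F _) (dl * T) => a b c d e.
by clear; lra.
Qed.

End recurrence.

Section system_vanish.
Variable R : realType.
Variables (h h' k k' W : R -> R) (w m ep : R).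
Hypothesis rp : repulsive h h' k k' W w m ep.
Variables (U U' Z Z' u u' z z' : R -> R) (al be : R).
Hypothesis dU : der U U'.
Hypothesis dU' : der U' (fun x => (w + h x + k x) * U x - (al * Z x - be * z x)).
Hypothesis du : der u u'.
Hypothesis du' : der u' (fun x => (w + h x + k x) * u x - (al * z x + be * Z x)).
Hypothesis dZ : der Z Z'.
Hypothesis dZ' : der Z' (fun x => (w + h x - k x) * Z x - (al * U x - be * u x)).
Hypothesis dz : der z z'.
Hypothesis dz' : der z' (fun x => (w + h x - k x) * z x - (al * u x + be * U x)).

Let f x := U x ^+ 2 + U' x ^+ 2 + (u x ^+ 2 + u' x ^+ 2) +
  (Z x ^+ 2 + Z' x ^+ 2 + (z x ^+ 2 + z' x ^+ 2)).

Hypothesis rec : forall dl A, 0 < dl ->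
  exists2 r, A <= r & r * (f r + f (- r)) <= dl.

(** In complex notation, with (U, u) and (Z, z) real and imaginary parts: the real
    part of the energy identity equates the integral of the positive form
    [Pos] with 2 al j, up to boundary terms, where j is the integral of
    Re (U conj Z); the imaginary part gives be j = 0. *)
Lemma system_vanish_complex : be != 0 ->
  forall x, U x ^+ 2 + u x ^+ 2 + (Z x ^+ 2 + z x ^+ 2) = 0.
Proof.
move=> be0.
have [ddU ddU' ddu ddu'] := And4 dU dU' du du'.
have [ddZ ddZ' ddz ddz'] := And4 dZ dZ' dz dz'.
have cU := der_cont ddU; have cU' := der_cont ddU'.
have cu := der_cont ddu; have cu' := der_cont ddu'.
have cZ := der_cont ddZ; have cZ' := der_cont ddZ'.
have cz := der_cont ddz; have cz' := der_cont ddz'.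
have ch := der_cont (rp_dh rp); have ck := der_cont (rp_dk rp).
have w0 : 0 < w by rewrite (rp_w rp) exprn_gt0// (rp_m rp).
pose q x := U x ^+ 2 + u x ^+ 2 + (Z x ^+ 2 + z x ^+ 2).
have cq : continuous q by rewrite /q; ccont.
have q0 x : 0 <= q x by rewrite /q !addr_ge0 ?sqr_ge0.
pose j x := U x * Z x + u x * z x.
have cj : continuous j by rewrite /j; ccont.
pose Pos x := U' x ^+ 2 + u' x ^+ 2 + (Z' x ^+ 2 + z' x ^+ 2) +
  (w + h x + k x) * (U x ^+ 2 + u x ^+ 2) + (w + h x - k x) * (Z x ^+ 2 + z x ^+ 2).
have cPos : continuous Pos by rewrite /Pos; ccont.
have Posq x : w / 2 * q x <= Pos x.
  have := rp_h rp x; have := rp_k rp x; rewrite !ler_norml => /andP[k1 k2] /andP[h1 h2].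
  have a1 : 0 <= (w / 2 + h x + k x) * (U x ^+ 2 + u x ^+ 2).
    by apply: mulr_ge0; [lra|rewrite addr_ge0 ?sqr_ge0].
  have a2 : 0 <= (w / 2 + h x - k x) * (Z x ^+ 2 + z x ^+ 2).
    by apply: mulr_ge0; [lra|rewrite addr_ge0 ?sqr_ge0].
  have a3 : 0 <= U' x ^+ 2 + u' x ^+ 2 + (Z' x ^+ 2 + z' x ^+ 2).
    by rewrite !addr_ge0 ?sqr_ge0.
  by rewrite /Pos /q; lra.
pose B1 x := U x * U' x + u x * u' x + (Z x * Z' x + z x * z' x).
pose B2 x := u' x * U x - U' x * u x + (z' x * Z x - Z' x * z x).
have ab (c d : R) : `|c * d| <= (c ^+ 2 + d ^+ 2) / 2.
  by have := sqr_ge0 (c - d); have := sqr_ge0 (c + d); rewrite ler_norml => ? ?; apply/andP; split; nra.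
have b1 x : `|B1 x| <= f x.
  have := ab (U x) (U' x); have := ab (u x) (u' x); have := ab (Z x) (Z' x); have := ab (z x) (z' x).
  have := sqr_ge0 (U x); have := sqr_ge0 (u x); have := sqr_ge0 (Z x); have := sqr_ge0 (z x).
  have := sqr_ge0 (U' x); have := sqr_ge0 (u' x); have := sqr_ge0 (Z' x); have := sqr_ge0 (z' x).
  rewrite /B1 /f !ler_norml => ? ? ? ? ? ? ? ? /andP[? ?] /andP[? ?] /andP[? ?] /andP[? ?].
  by apply/andP; split; lra.
have b2 x : `|B2 x| <= f x.
  have := ab (u' x) (U x); have := ab (U' x) (u x); have := ab (z' x) (Z x); have := ab (Z' x) (z x).
  have := sqr_ge0 (U x); have := sqr_ge0 (u x); have := sqr_ge0 (Z x); have := sqr_ge0 (z x).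
  have := sqr_ge0 (U' x); have := sqr_ge0 (u' x); have := sqr_ge0 (Z' x); have := sqr_ge0 (z' x).
  rewrite /B2 /f !ler_norml => ? ? ? ? ? ? ? ? /andP[? ?] /andP[? ?] /andP[? ?] /andP[? ?].
  by apply/andP; split; lra.
have dB1 : der B1 (fun x => Pos x + (- (2 * al)) * j x).
  by move=> x; rewrite /B1 /Pos /j; ddat.
have dB2 : der B2 (fun x => (- (2 * be)) * j x).
  by move=> x; rewrite /B2 /j; ddat.
have f0 x : 0 <= f x by rewrite /f !addr_ge0 ?sqr_ge0.
apply: (Int_eq0 cq q0) => r0 r00.
have w2 : 0 < w / 2 by lra.
rewrite -(pmulr_rle0 _ w2).
have C0 : 0 <= 1 + `|al| / `|be| by rewrite addr_ge0// divr_ge0.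
apply: (le_all_eps C0) => dl dl0.
have [r] := rec (Num.max r0 1) dl0; rewrite ge_max => /andP[rr0 r1] hf.
have r0' : - r <= r by lra.
have ff : f r + f (- r) <= dl by apply: le_trans hf; rewrite ler_peMl// addr_ge0.
have I2 : Int (- r) r (fun x => (- (2 * be)) * j x) = B2 r - B2 (- r).
  by apply: IntE => //; ccont.
have I1 : Int (- r) r (fun x => Pos x + (- (2 * al)) * j x) = B1 r - B1 (- r).
  by apply: IntE => //; ccont.
rewrite IntZ// in I2; rewrite IntD ?IntZ// in I1; last by ccont.
have e1 : `|B1 r - B1 (- r)| <= dl.
  by apply: le_trans (ler_normB _ _) _; have := b1 r; have := b1 (- r); lra.
have e2 : `|B2 r - B2 (- r)| <= dl.
  by apply: le_trans (ler_normB _ _) _; have := b2 r; have := b2 (- r); lra.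
have bp : 0 < `|be| by rewrite normr_gt0.
have J : `|2 * al * Int (- r) r j| <= `|al| / `|be| * dl.
  have -> : 2 * al * Int (- r) r j = - (al / be) * (B2 r - B2 (- r)).
    by rewrite -I2; field.
  rewrite normrM normrN normrM normfV; apply: ler_wpM2l => //.
have le1 : w / 2 * Int (- r) r q <= Int (- r) r Pos.
  rewrite -IntZ//; apply: Int_le => //; by ccont.
have le2 : w / 2 * Int (- r0) r0 q <= w / 2 * Int (- r) r q.
  by apply: ler_wpM2l; [exact: ltW|exact: Int_sub].
move: e1 J; rewrite !ler_norml => /andP[_ e1] /andP[_ J].
rewrite mulrDl mul1r; lra.
Qed.

(** Real and imaginary parts decouple; U + Z and U - Z, exchanged when al < 0,
    solve the system of [virial_vanish]. *)
Lemma system_vanish_real : be = 0 ->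
  forall x, U x ^+ 2 + u x ^+ 2 + (Z x ^+ 2 + z x ^+ 2) = 0.
Proof.
move=> be0.
have main (V V' Y Y' : R -> R) : der V V' -> der Y Y' ->
   der V' (fun x => (w + h x + k x) * V x - al * Y x) ->
   der Y' (fun x => (w + h x - k x) * Y x - al * V x) ->
   (forall x, V x ^+ 2 + V' x ^+ 2 + (Y x ^+ 2 + Y' x ^+ 2) <= f x) ->
   forall x, V x = 0 /\ Y x = 0.
  move=> dV dY dV' dY' bf.
  have recp (e : R) : e ^+ 2 = 1 -> forall dl A, 0 < dl -> exists2 r, A <= r &
     r * (((V r + e * Y r) ^+ 2 + (V' r + e * Y' r) ^+ 2 + ((V r - e * Y r) ^+ 2 + (V' r - e * Y' r) ^+ 2)) +
          ((V (- r) + e * Y (- r)) ^+ 2 + (V' (- r) + e * Y' (- r)) ^+ 2 +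
           ((V (- r) - e * Y (- r)) ^+ 2 + (V' (- r) - e * Y' (- r)) ^+ 2))) <= dl.
    move=> e1 dl A dl0; have dl2 : 0 < dl / 2 by lra.
    have [r] := rec (Num.max A 0) dl2; rewrite ge_max => /andP[Ar r0] hf; exists r => //.
    have sq (c d : R) : (c + e * d) ^+ 2 + (c - e * d) ^+ 2 = 2 * c ^+ 2 + 2 * d ^+ 2.
      by transitivity (2 * c ^+ 2 + 2 * (e ^+ 2) * d ^+ 2); [ring|rewrite e1 mulr1].
    have S (t : R) : (V t + e * Y t) ^+ 2 + (V' t + e * Y' t) ^+ 2 + ((V t - e * Y t) ^+ 2 + (V' t - e * Y' t) ^+ 2)
       <= 2 * f t.
      by have := bf t; have := sq (V t) (Y t); have := sq (V' t) (Y' t); lra.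
    apply: (@le_trans _ _ (r * (2 * (f r + f (- r))))); last by lra.
    by apply: ler_wpM2l => //; have := S r; have := S (- r); lra.
  have [al0|/ltW al0] := leP 0 al.
    have [|||||zz yy] := @virial_vanish _ h h' k k' W (fun x => V x + 1 * Y x) (fun x => V' x + 1 * Y' x)
      (fun x => V x - 1 * Y x) (fun x => V' x - 1 * Y' x) w m ep al rp al0.
    - by move=> x; ddat.
    - by move=> x; ddat.
    - by move=> x; ddat.
    - by move=> x; ddat.
    - by apply: recp; rewrite expr1n.
    by move=> x; have := zz x; have := yy x; split; lra.
  have al1 : 0 <= - al by rewrite oppr_ge0.
  have [|||||zz yy] := @virial_vanish _ h h' k k' W (fun x => V x + (-1) * Y x) (fun x => V' x + (-1) * Y' x)
    (fun x => V x - (-1) * Y x) (fun x => V' x - (-1) * Y' x) w m ep (- al) rp al1.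
  - by move=> x; ddat.
  - by move=> x; ddat.
  - by move=> x; ddat.
  - by move=> x; ddat.
  - by apply: recp; rewrite sqrrN expr1n.
  by move=> x; have := zz x; have := yy x; split; lra.
have dU1 := dU'; have du1 := du'; have dZ1 := dZ'; have dz1 := dz'.
have sub (X X' F G : R -> R) : der X F -> (forall x, F x = G x) -> der X G.
  by move=> d e x; apply: dat_eq; [exact: d|exact: e].
have r1 x : U x = 0 /\ Z x = 0.
  apply: (main U U' Z Z') => //.
  - by apply: (sub _ U _ _ dU1) => t; rewrite be0; ring.
  - by apply: (sub _ U _ _ dZ1) => t; rewrite be0; ring.
  - move=> t; rewrite /f; have := sqr_ge0 (u t); have := sqr_ge0 (u' t).
    by have := sqr_ge0 (z t); have := sqr_ge0 (z' t); lra.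
have r2 x : u x = 0 /\ z x = 0.
  apply: (main u u' z z') => //.
  - by apply: (sub _ U _ _ du1) => t; rewrite be0; ring.
  - by apply: (sub _ U _ _ dz1) => t; rewrite be0; ring.
  - move=> t; rewrite /f; have := sqr_ge0 (U t); have := sqr_ge0 (U' t).
    by have := sqr_ge0 (Z t); have := sqr_ge0 (Z' t); lra.
by move=> x; have [-> ->] := r1 x; have [-> ->] := r2 x; rewrite expr0n /= !addr0.
Qed.

Lemma system_vanish x : [/\ U x = 0, u x = 0, Z x = 0 & z x = 0].
Proof.
have e : U x ^+ 2 + u x ^+ 2 + (Z x ^+ 2 + z x ^+ 2) = 0.
  have [/system_vanish_real->//|/system_vanish_complex->//] := eqVneq be 0.
have := sqr_ge0 (U x); have := sqr_ge0 (u x); have := sqr_ge0 (Z x); have := sqr_ge0 (z x).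
move=> h1 h2 h3 h4.
by split; apply/eqP; rewrite -sqrf_eq0; apply/eqP; lra.
Qed.

End system_vanish.

(** * Classical solutions are distributional solutions *)

Section converse.
Variable R : realType.

Lemma weak_eq_of_classical (u ut p pt q qt V u1 : R -> R) (a b : R) :
  measurable_fun setT u -> measurable_fun setT p -> measurable_fun setT q ->
  {ae leb R, forall x, u x = ut x} -> {ae leb R, forall x, p x = pt x} ->
  {ae leb R, forall x, q x = qt x} ->
  continuous V -> continuous pt -> continuous qt -> der ut u1 ->
  der u1 (fun x => V x * ut x - (a * pt x + b * qt x)) ->
  forall psi, test_function psi ->
   - (\int[leb R]_x (u x * (psi^`(2))%classic x)) + \int[leb R]_x (V x * u x * psi x) =
   a * (\int[leb R]_x (p x * psi x)) + b * (\int[leb R]_x (q x * psi x)).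
Proof.
move=> mu mp mq uut ppt qqt cV cp cq dut du1 psi tpsi.
have [dp0 dp1 cp2] := test_function_der tpsi; have cpsi := der_cont dp0.
have cut := der_cont dut.
have c2 : continuous (fun x => V x * ut x - (a * pt x + b * qt x)) by ccont.
have aeM (f ft e : R -> R) : measurable_fun setT f -> continuous ft -> continuous e ->
    {ae leb R, forall x, f x = ft x} ->
    \int[leb R]_x (f x * e x) = \int[leb R]_x (ft x * e x).
  move=> mf cf ce ff; apply: ae_Rintegral => //.
  - by apply: measurable_funM => //; exact: cont_measurable.
  - by apply: cont_measurable; exact: contM.
  - by apply: ae_impl ff => x ->.
rewrite (aeM _ _ _ mu cut cp2 uut) (aeM _ _ _ mp cp cpsi ppt) (aeM _ _ _ mq cq cpsi qqt).
have -> : \int[leb R]_x (V x * u x * psi x) = \int[leb R]_x (V x * ut x * psi x).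
  apply: (aeM (fun x => V x * u x) (fun x => V x * ut x)) => //.
  - by apply: measurable_funM => //; exact: cont_measurable.
  - exact: contM.
  - by apply: ae_impl uut => x ->.
rewrite (weak_of_classical dut du1 c2 tpsi).
have [r r0 h0] := test_function_bounded tpsi.
have out (f : R -> R) x : ~ (- r <= x <= r) -> f x * psi x = 0.
  by move=> h; rewrite h0 ?mulr0// => /andP[? ?]; apply: h; rewrite !ltW.
have rr : - r <= r by lra.
rewrite !(@Rintegral_supp _ (fun x => _ * psi x) (- r) r); try exact: out.
have cVu : continuous (fun x => V x * ut x * psi x) by ccont.
have cpp : continuous (fun x => pt x * psi x) by ccont.
have cqq : continuous (fun x => qt x * psi x) by ccont.
rewrite !Rintegral_Int//; last by exact: contM.
have -> : Int (- r) r (fun x => (V x * ut x - (a * pt x + b * qt x)) * psi x) =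
    Int (- r) r (fun x => V x * ut x * psi x) + ((- a) * Int (- r) r (fun x => pt x * psi x) +
      (- b) * Int (- r) r (fun x => qt x * psi x)).
  rewrite -!IntZ -?IntD//; try by ccont.
  by congr Int; apply/funext => x; ring.
lra.
Qed.

Lemma eigen_of_classical (X Y : R -> R[i]) (al be : R) (Vm Vp : R -> R)
    (X1 X1' X2 X2' Y1 Y1' Y2 Y2' : R -> R) :
  sobolev_H1C X -> sobolev_H1C Y -> continuous Vm -> continuous Vp ->
  {ae leb R, forall x, complex.Re (X x) = X1 x} ->
  {ae leb R, forall x, complex.Im (X x) = X2 x} ->
  {ae leb R, forall x, complex.Re (Y x) = Y1 x} ->
  {ae leb R, forall x, complex.Im (Y x) = Y2 x} ->
  der X1 X1' -> der X2 X2' -> der Y1 Y1' -> der Y2 Y2' ->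
  der X1' (fun x => Vm x * X1 x - (al * Y1 x + (- be) * Y2 x)) ->
  der X2' (fun x => Vm x * X2 x - (al * Y2 x + be * Y1 x)) ->
  der Y1' (fun x => Vp x * Y1 x - (al * X1 x + (- be) * X2 x)) ->
  der Y2' (fun x => Vp x * Y2 x - (al * X2 x + be * X1 x)) ->
  forall psi, test_function psi ->
    (schrodinger Vm X psi = (al +i* be) * pairing Y psi /\
    schrodinger Vp Y psi = (al +i* be) * pairing X psi)%C.
Proof.
move=> [[lX1 _] [lX2 _]] [[lY1 _] [lY2 _]] cm cp aX1 aX2 aY1 aY2 dX1 dX2 dY1 dY2 dX1' dX2' dY1' dY2' psi tpsi.
have mX1 := Lfun2_measurable lX1; have mX2 := Lfun2_measurable lX2.
have mY1 := Lfun2_measurable lY1; have mY2 := Lfun2_measurable lY2.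
have cX1 := der_cont dX1; have cX2 := der_cont dX2.
have cY1 := der_cont dY1; have cY2 := der_cont dY2.
split; apply: complex_ext.
- rewrite schrodinger_Re (weak_eq_of_classical mX1 mY1 mY2 aX1 aY1 aY2 cm cY1 cY2 dX1 dX1' tpsi).
  by rewrite /=; ring.
- rewrite schrodinger_Im (weak_eq_of_classical mX2 mY2 mY1 aX2 aY2 aY1 cm cY2 cY1 dX2 dX2' tpsi).
  by rewrite /=; ring.
- rewrite schrodinger_Re (weak_eq_of_classical mY1 mX1 mX2 aY1 aX1 aX2 cp cX1 cX2 dY1 dY1' tpsi).
  by rewrite /=; ring.
- rewrite schrodinger_Im (weak_eq_of_classical mY2 mX2 mX1 aY2 aX2 aX1 cp cX2 cX1 dY2 dY2' tpsi).
  by rewrite /=; ring.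
Qed.

End converse.

(** * Transformed solutions and classification *)

Section classification.
Variable R : realType.
Variables (g p : R -> R) (w ep : R).
Hypothesis st : setting g p w ep.

Lemma dlogder_bound x : `|dlogder g p x| <= 3 * w.
Proof.
have h1 := Gs_bound st x; have h2 := n0_g (st_near0 st) (gs_in st x).
have s0 := gs_s0 st x; have s3 := gs_s3w st x.
rewrite -/(Gratio g p x) in h1; rewrite /dlogder.
move: h1 h2 s0 s3; move: (Gratio g p x) (g (p x ^+ 2)) (p x ^+ 2) => a c t.
rewrite !ler_norml => /andP[? ?] /andP[? ?] ? ?; apply/andP; split; lra.
Qed.

Lemma Vminus_logder x : Vminus g p w x = logder p x ^+ 2 + dlogder g p x.
Proof. by rewrite /Vminus /dlogder [in LHS](riccati st x); field. Qed.

Lemma Vminus_bound x : `|Vminus g p w x| <= 4 * w.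
Proof.
rewrite Vminus_logder; apply: le_trans (ler_normD _ _) _.
have h1 := dlogder_bound x; have h2 := logder_sq_le st x.
by rewrite [`|_ ^+ 2|]ger0_norm ?sqr_ge0//; lra.
Qed.

Section ops_bound.
Variables (M S x : R).
Hypotheses (M1 : 1 <= M) (S0 : 0 <= S).
Hypothesis bM : `|logder p x| <= M.
Hypothesis dM : `|dlogder g p x| <= M.
Hypothesis vM : `|Vminus g p w x| <= M.
Variables (X X' P P' : R -> R).
Hypotheses (hX : `|X x| <= S) (hX' : `|X' x| <= S).
Hypotheses (hP : `|P x| <= M * S) (hP' : `|P' x| <= M * S).

Let absM (a c A C : R) : `|a| <= A -> `|c| <= C -> `|a * c| <= A * C.
Proof. by move=> h1 h2; rewrite normrM ler_pM. Qed.

Let absB (a c A C : R) : `|a| <= A -> `|c| <= C -> `|a - c| <= A + C.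
Proof. by move=> h1 h2; apply: le_trans (ler_normB _ _) _; rewrite lerD. Qed.

Let abs2 (a A : R) : `|a| <= A -> `|2 * a| <= 2 * A.
Proof. by move=> h; rewrite normrM ger0_norm// ler_wpM2l. Qed.

Let absN2 (a A : R) : `|a| <= A -> `|- 2 * a| <= 2 * A.
Proof. by move=> h; rewrite mulNr normrN; exact: abs2. Qed.

Lemma sop_bound : `|sop p X X' x| <= 2 * M * S.
Proof.
have M1' := M1; have S0' := S0.
apply: le_trans (absB hX' (absM bM hX)) _.
have : 0 <= (M - 1) * S by rewrite mulr_ge0// subr_ge0.
by lra.
Qed.

Lemma zuop_bound :
  [/\ `|zop p X X' P x| <= 11 * M ^+ 3 * S, `|zop' g p X X' P P' x| <= 11 * M ^+ 3 * S &
   `|uop g p w X X' P x| <= 11 * M ^+ 3 * S].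
Proof.
have M1' := M1; have S0' := S0.
have MS : 0 <= M * S by rewrite mulr_ge0//; lra.
have m1 : S <= M * S by rewrite ler_peMl.
have m2 : M * S <= M * (M * S) by rewrite ler_peMl.
have m3 : M * (M * S) <= M * (M * (M * S)) by rewrite ler_peMl// mulr_ge0//; lra.
have e3 : M ^+ 3 * S = M * (M * (M * S)) by ring.
have A := sop_bound.
have z1 := absB (absM (absN2 bM) A) hP.
have B : `|- logder p x * sop p X X' x - P x| <= M * (2 * M * S) + M * S.
  by apply: absB => //; apply: absM => //; rewrite normrN.
have z2 := absB (absB (absM (absN2 dM) A) (absM (abs2 bM) B)) hP'.
have z3 := absB (absB (absM (abs2 vM) hX) (absM (abs2 bM) hX')) hP.
split; [apply: le_trans z1 _|apply: le_trans z2 _|apply: le_trans z3 _]; lra.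
Qed.

Lemma uop'_bound (Q Q' : R -> R) : `|Q x| <= M * S -> `|Q' x| <= M * S ->
  `|uop' g p w X X' Q Q' x| <= 11 * M ^+ 3 * S.
Proof.
move=> hQ hQ'; have M1' := M1; have S0' := S0.
have MS : 0 <= M * S by rewrite mulr_ge0//; lra.
have m1 : S <= M * S by rewrite ler_peMl.
have m2 : M * S <= M * (M * S) by rewrite ler_peMl.
have m3 : M * (M * S) <= M * (M * (M * S)) by rewrite ler_peMl// mulr_ge0//; lra.
have e3 : M ^+ 3 * S = M * (M * (M * S)) by ring.
have bN : `|- logder p x| <= M by rewrite normrN.
have u := absB (absB (absM (abs2 vM) hX) (absM (abs2 bM) hX')) hQ.
have s := absB hQ' (absM bM hQ).
apply: le_trans (absB (absM bN u) s) _; lra.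
Qed.

End ops_bound.

Variables (X1 X1' X2 X2' Y1 Y1' Y2 Y2' : R -> R) (al be : R).

Let P1 x := al * Y1 x + (- be) * Y2 x.
Let P1' x := al * Y1' x + (- be) * Y2' x.
Let P2 x := al * Y2 x + be * Y1 x.
Let P2' x := al * Y2' x + be * Y1' x.
Let Q1 x := al * X1 x + (- be) * X2 x.
Let Q1' x := al * X1' x + (- be) * X2' x.
Let Q2 x := al * X2 x + be * X1 x.
Let Q2' x := al * X2' x + be * X1' x.

Hypothesis dX1 : der X1 X1'.
Hypothesis dX2 : der X2 X2'.
Hypothesis dY1 : der Y1 Y1'.
Hypothesis dY2 : der Y2 Y2'.
Hypothesis dX1' : der X1' (fun x => Vminus g p w x * X1 x - P1 x).
Hypothesis dX2' : der X2' (fun x => Vminus g p w x * X2 x - P2 x).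
Hypothesis dY1' : der Y1' (fun x => Vplus g p w x * Y1 x - Q1 x).
Hypothesis dY2' : der Y2' (fun x => Vplus g p w x * Y2 x - Q2 x).

Let F x := X1 x ^+ 2 + X1' x ^+ 2 + (X2 x ^+ 2 + X2' x ^+ 2) +
  (Y1 x ^+ 2 + Y1' x ^+ 2 + (Y2 x ^+ 2 + Y2' x ^+ 2)).
Hypothesis iF : (leb R).-integrable setT (EFin \o F).

Let U1 := uop g p w Y1 Y1' Q1.
Let U1' := uop' g p w Y1 Y1' Q1 Q1'.
Let U2 := uop g p w Y2 Y2' Q2.
Let U2' := uop' g p w Y2 Y2' Q2 Q2'.
Let Z1 := zop p X1 X1' P1.
Let Z1' := zop' g p X1 X1' P1 P1'.
Let Z2 := zop p X2 X2' P2.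
Let Z2' := zop' g p X2 X2' P2 P2'.

Let f x := U1 x ^+ 2 + U1' x ^+ 2 + (U2 x ^+ 2 + U2' x ^+ 2) +
  (Z1 x ^+ 2 + Z1' x ^+ 2 + (Z2 x ^+ 2 + Z2' x ^+ 2)).

(** The transformation has bounded coefficients, so it preserves the smallness
    along a sequence of radii. *)
Lemma transformed_bound : exists2 C, 0 < C & forall x, f x <= C * F x.
Proof.
have cs (a c : R) : (a + c) ^+ 2 <= 2 * a ^+ 2 + 2 * c ^+ 2 by have := sqr_ge0 (a - c); nra.
have w0 := st_w0 st.
pose M := 1 + Num.sqrt w + 4 * w + (`|al| + `|be|).
have M1 : 1 <= M by have := sqrtr_ge0 w; have := normr_ge0 al; have := normr_ge0 be; rewrite /M; lra.
have ab1 : `|al| + `|be| <= M by have := sqrtr_ge0 w; rewrite /M; lra.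
have mM : Num.sqrt w <= M by have := normr_ge0 al; have := normr_ge0 be; rewrite /M; lra.
have wM : 4 * w <= M by have := sqrtr_ge0 w; have := normr_ge0 al; have := normr_ge0 be; rewrite /M; lra.
clearbody M.
pose C := 8 * (11 * M ^+ 3) ^+ 2 * 8.
have M0 : 0 < M ^+ 3 by rewrite exprn_gt0//; lra.
have M0' : 0 < (11 * M ^+ 3) ^+ 2 by rewrite exprn_gt0//; lra.
have C0 : 0 < C by rewrite /C; move: M0'; move: ((11 * M ^+ 3) ^+ 2) => K; lra.
exists C => // x.
pose S := `|X1 x| + `|X1' x| + (`|X2 x| + `|X2' x|) + (`|Y1 x| + `|Y1' x| + (`|Y2 x| + `|Y2' x|)).
have [n1 n2 n3 n4] := And4 (normr_ge0 (X1 x)) (normr_ge0 (X1' x)) (normr_ge0 (X2 x)) (normr_ge0 (X2' x)).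
have [n5 n6 n7 n8] := And4 (normr_ge0 (Y1 x)) (normr_ge0 (Y1' x)) (normr_ge0 (Y2 x)) (normr_ge0 (Y2' x)).
have S0 : 0 <= S by rewrite /S; lra.
have [s1 s2 s3 s4] : [/\ `|X1 x| <= S, `|X1' x| <= S, `|X2 x| <= S & `|X2' x| <= S].
  by rewrite /S; split; lra.
have [s5 s6 s7 s8] : [/\ `|Y1 x| <= S, `|Y1' x| <= S, `|Y2 x| <= S & `|Y2' x| <= S].
  by rewrite /S; split; lra.
have lin (c d : R) : `|c| <= S -> `|d| <= S -> forall e, `|e| = `|be| -> `|al * c + e * d| <= M * S.
  move=> hc hd e he; apply: le_trans (ler_normD _ _) _; rewrite !normrM he.
  apply: (@le_trans _ _ ((`|al| + `|be|) * S)); last exact: ler_wpM2r.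
  by rewrite mulrDl lerD// ler_wpM2l.
have nbe := normrN be.
have bM : `|logder p x| <= M by apply: le_trans (logder_le st x) _.
have dM : `|dlogder g p x| <= M by apply: le_trans (dlogder_bound x) _; lra.
have vM : `|Vminus g p w x| <= M by apply: le_trans (Vminus_bound x) _.
have [z1 z1' _] := zuop_bound M1 S0 bM dM vM s1 s2 (lin _ _ s5 s7 _ nbe : `|P1 x| <= _) (lin _ _ s6 s8 _ nbe : `|P1' x| <= _).
have [z2 z2' _] := zuop_bound M1 S0 bM dM vM s3 s4 (lin _ _ s7 s5 _ erefl : `|P2 x| <= _) (lin _ _ s8 s6 _ erefl : `|P2' x| <= _).
have [_ _ u1] := zuop_bound M1 S0 bM dM vM s5 s6 (lin _ _ s1 s3 _ nbe : `|Q1 x| <= _) (lin _ _ s2 s4 _ nbe : `|Q1' x| <= _).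
have [_ _ u2] := zuop_bound M1 S0 bM dM vM s7 s8 (lin _ _ s3 s1 _ erefl : `|Q2 x| <= _) (lin _ _ s4 s2 _ erefl : `|Q2' x| <= _).
have u1' := uop'_bound M1 S0 bM vM s5 s6 (lin _ _ s1 s3 _ nbe : `|Q1 x| <= _) (lin _ _ s2 s4 _ nbe : `|Q1' x| <= _).
have u2' := uop'_bound M1 S0 bM vM s7 s8 (lin _ _ s3 s1 _ erefl : `|Q2 x| <= _) (lin _ _ s4 s2 _ erefl : `|Q2' x| <= _).
have sq (c : R) : `|c| <= 11 * M ^+ 3 * S -> c ^+ 2 <= (11 * M ^+ 3) ^+ 2 * S ^+ 2.
  move=> hc; rewrite -exprMn -[c ^+ 2]real_normK ?num_real//.
  by apply: lerXn2r; rewrite ?nnegrE//; apply: le_trans hc.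
have S2 : S ^+ 2 <= 8 * F x.
  have r (a : R) : `|a| ^+ 2 = a ^+ 2 by rewrite real_normK ?num_real.
  have := cs (`|X1 x| + `|X1' x| + (`|X2 x| + `|X2' x|)) (`|Y1 x| + `|Y1' x| + (`|Y2 x| + `|Y2' x|)).
  have := cs (`|X1 x| + `|X1' x|) (`|X2 x| + `|X2' x|).
  have := cs (`|Y1 x| + `|Y1' x|) (`|Y2 x| + `|Y2' x|).
  have := cs `|X1 x| `|X1' x|; have := cs `|X2 x| `|X2' x|.
  have := cs `|Y1 x| `|Y1' x|; have := cs `|Y2 x| `|Y2' x|.
  rewrite !r -/S /F; move: (S ^+ 2) => T.
  clear M1 ab1 mM wM M0 M0' C0 s1 s2 s3 s4 s5 s6 s7 s8 nbe bM dM vM n1 n2 n3 n4 n5 n6 n7 n8 S0 lin u1 u1' u2 u2' z1 z1' z2 z2' sq cs r.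
  by lra.
have K0 : 0 <= (11 * M ^+ 3) ^+ 2 by exact: sqr_ge0.
have := ler_wpM2l K0 S2.
have := sq _ u1; have := sq _ u1'; have := sq _ u2; have := sq _ u2'.
have := sq _ z1; have := sq _ z1'; have := sq _ z2; have := sq _ z2'.
rewrite /f /C /U1 /U1' /U2 /U2' /Z1 /Z1' /Z2 /Z2'.
move: ((11 * M ^+ 3) ^+ 2) => K.
clear M1 ab1 mM wM M0 M0' C0 s1 s2 s3 s4 s5 s6 s7 s8 nbe bM dM vM n1 n2 n3 n4 n5 n6 n7 n8 S0 lin u1 u1' u2 u2' z1 z1' z2 z2' sq S2.
by lra.
Qed.

Hypothesis e0 : 0 < ep.
Hypothesis hI : (600 ^+ 2 + 1) * ep ^+ 2 * Num.sqrt w <= \int[leb R]_x pot_h g p x.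

Lemma transformed_vanish x : [/\ U1 x = 0, U2 x = 0, Z1 x = 0 & Z2 x = 0].
Proof.
have [ddX1 ddX1' ddX2 ddX2'] := And4 dX1 dX1' dX2 dX2'.
have [ddY1 ddY1' ddY2 ddY2'] := And4 dY1 dY1' dY2 dY2'.
have dP1 : der P1 P1' by move=> t; rewrite /P1 /P1'; ddat.
have dP2 : der P2 P2' by move=> t; rewrite /P2 /P2'; ddat.
have dQ1 : der Q1 Q1' by move=> t; rewrite /Q1 /Q1'; ddat.
have dQ2 : der Q2 Q2' by move=> t; rewrite /Q2 /Q2'; ddat.
have dP1' : der P1' (fun x => Vplus g p w x * P1 x - (al * Q1 x + (- be) * Q2 x)).
  by move=> t; rewrite /P1' /P1; ddat.
have dP2' : der P2' (fun x => Vplus g p w x * P2 x - (al * Q2 x + be * Q1 x)).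
  by move=> t; rewrite /P2' /P2; ddat.
have dQ1' : der Q1' (fun x => Vminus g p w x * Q1 x - (al * P1 x + (- be) * P2 x)).
  by move=> t; rewrite /Q1' /Q1; ddat.
have dQ2' : der Q2' (fun x => Vminus g p w x * Q2 x - (al * P2 x + be * P1 x)).
  by move=> t; rewrite /Q2' /Q2; ddat.
have conv (V G H : R -> R) : der V G -> (forall t, G t = H t) -> der V H.
  by move=> d e t; apply: dat_eq; [exact: d|exact: e].
have dU1 : der U1 U1' := uop_der st dY1 dY1' dQ1.
have dU2 : der U2 U2' := uop_der st dY2 dY2' dQ2.
have dZ1 : der Z1 Z1' := zop_der st dX1 dX1' dP1.
have dZ2 : der Z2 Z2' := zop_der st dX2 dX2' dP2.
have dU1' : der U1' (fun x => (w + pot_h g p x + pot_k g p x) * U1 x - (al * Z1 x - be * Z2 x)).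
  by apply: conv (uop'_der st dY1 dY1' dQ1 dQ1') _ => t; rewrite /Z1 /Z2 /U1 /zop /sop /Q1 /Q1'; ring.
have dU2' : der U2' (fun x => (w + pot_h g p x + pot_k g p x) * U2 x - (al * Z2 x + be * Z1 x)).
  by apply: conv (uop'_der st dY2 dY2' dQ2 dQ2') _ => t; rewrite /Z1 /Z2 /U2 /zop /sop /Q2 /Q2'; ring.
have dZ1' : der Z1' (fun x => (w + pot_h g p x - pot_k g p x) * Z1 x - (al * U1 x - be * U2 x)).
  by apply: conv (zop'_der st dX1 dX1' dP1 dP1') _ => t; rewrite /U1 /U2 /Z1 /uop /P1 /P1'; ring.
have dZ2' : der Z2' (fun x => (w + pot_h g p x - pot_k g p x) * Z2 x - (al * U2 x + be * U1 x)).
  by apply: conv (zop'_der st dX2 dX2' dP2 dP2') _ => t; rewrite /U1 /U2 /Z2 /uop /P2 /P2'; ring.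
apply: (system_vanish (pot_repulsive st e0 hI) dU1 dU1' dU2 dU2' dZ1 dZ1' dZ2 dZ2').
move=> dl A dl0; have [C C0 hC] := transformed_bound.
have cF : continuous F.
  have cX1 := der_cont ddX1; have cX2 := der_cont ddX2.
  have cY1 := der_cont ddY1; have cY2 := der_cont ddY2.
  have cX1' := der_cont ddX1'; have cX2' := der_cont ddX2'.
  have cY1' := der_cont ddY1'; have cY2' := der_cont ddY2'.
  by rewrite /F; ccont.
have F0 t : 0 <= F t by rewrite /F !addr_ge0 ?sqr_ge0.
have dC : 0 < dl / C by rewrite divr_gt0.
have [r] := integrable_recurrent cF F0 iF (Num.max A 0) dC.
rewrite ge_max => /andP[Ar r0] hr; exists r => //.
rewrite ler_pdivlMr// in hr; apply: le_trans hr.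
rewrite -mulrA; apply: ler_wpM2l => //.
have := hC r; have := hC (- r); rewrite /f; lra.
Qed.

End classification.

Section kernels.
Variable R : realType.
Variables (g p : R -> R) (w ep : R).
Hypothesis st : setting g p w ep.

Lemma der_zero (F F' : R -> R) : der F F' -> (forall x, F x = 0) -> forall x, F' x = 0.
Proof.
move=> d e x; apply: (dat_unique (d x)).
have -> : F = fun=> 0 by exact/funext.
exact: dat_cst.
Qed.

Lemma sop_eq0 (X X' : R -> R) : der X X' -> (forall x, sop p X X' x = 0) ->
  exists c, forall x, X x = c * p x.
Proof.
move=> dX A0; have pn := pne0 st; have dp := p_der st.
have d : der (fun x => X x * (p x)^-1) (fun=> 0).
  move=> x; apply: dat_eq; first by apply: datM; [exact: dX|apply: datV; [exact: pn|exact: dp]].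
  by have := A0 x; rewrite /sop => /subr0_eq ->; field; exact: pn.
exists (X 0 * (p 0)^-1) => x; have /= <- := der0_cst x 0 d.
by rewrite divfK.
Qed.

Lemma p_der2 : der (fun x => logder p x * p x) (fun x => Vminus g p w x * p x).
Proof.
have e : (p^`())%classic = fun x => logder p x * p x by apply/funext => x; exact: (p'E st).
by have := gs_der2' st; rewrite e.
Qed.

Lemma p_der3 : der (fun x => Vminus g p w x * p x) (fun x => Vplus g p w x * (logder p x * p x)).
Proof.
move=> x; have d := p_der st; have d' := g_der st.
by apply: dat_eq; [rewrite /Vminus; repeat dat_step|rewrite /= /Vplus; ring].
Qed.

Lemma Vplus_cont : continuous (Vplus g p w).
Proof.
have d4 := gps_x_der st.
have c := der_cont (p_der st); have c1 := der_cont (g_der st); have c2 := der_cont d4.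
rewrite /Vplus; ccont.
Qed.

Lemma Vminus_cont : continuous (Vminus g p w).
Proof.
have c := der_cont (p_der st); have c1 := der_cont (g_der st).
rewrite /Vminus; ccont.
Qed.

(** Here b S X = 0 with S X constant; b has no zero besides 0. *)
Lemma kernel_minus (X X' P : R -> R) : der X X' ->
  der X' (fun x => Vminus g p w x * X x - P x) -> (forall x, P x = 0) ->
  (forall x, zop p X X' P x = 0) -> exists c, forall x, X x = c * p x.
Proof.
move=> dX dX' P0 z0.
have bA x : logder p x * sop p X X' x = 0 by have := z0 x; rewrite /zop P0; lra.
have dA : der (sop p X X') (fun=> 0).
  move=> x; apply: dat_eq; first exact: (sop_der st dX dX').
  by rewrite P0 mulNr bA; lra.
apply: (sop_eq0 dX) => x; rewrite (der0_cst x 1 dA).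
have b1 : logder p 1 != 0 by apply: (logder_neq0 st); exact: oner_neq0.
by apply/eqP; have /eqP := bA 1; rewrite mulf_eq0 (negbTE b1).
Qed.

(** At 0, where b vanishes, U = 0 gives V_-(0) Y(0) = 0, and V_-(0) is the
    derivative of b at 0, which is negative.  So Y and a multiple of p' have the
    same Cauchy data at 0. *)
Lemma kernel_plus (Y Y' Q : R -> R) : der Y Y' ->
  der Y' (fun x => Vplus g p w x * Y x - Q x) -> (forall x, Q x = 0) ->
  (forall x, uop g p w Y Y' Q x = 0) -> exists d, forall x, Y x = d * (logder p x * p x).
Proof.
move=> dY dY' Q0 u0; have b0 := logder0 st; have pn := pne0 st 0.
have v0 : Vminus g p w 0 != 0.
  by rewrite (Vminus_logder st) b0 expr0n /= add0r lt_eqF// (logder_dec st).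
have Y0 : Y 0 = 0.
  have : Vminus g p w 0 * Y 0 = 0 by have := u0 0; rewrite /uop Q0 b0; lra.
  by move=> /eqP; rewrite mulf_eq0 (negbTE v0) => /eqP.
pose d := Y' 0 / (Vminus g p w 0 * p 0).
exists d => x; apply/eqP; rewrite -subr_eq0; apply/eqP.
have [d1 d2] := conj p_der2 p_der3.
have dy : der (fun x => Y x - d * (logder p x * p x)) (fun x => Y' x - d * (Vminus g p w x * p x)).
  by move=> t; apply: dat_eq; [repeat first [exact: d1|dat_step]|rewrite /=; ring].
apply: (@linear_ode_zero _ _ _ _ Vplus_cont dy _ 0) => [t||].
- by apply: dat_eq; [repeat first [exact: d2|dat_step]|rewrite /= Q0; ring].
- by rewrite Y0 b0; ring.
- by rewrite /d divfK ?subrr// mulf_neq0.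
Qed.

Lemma rotation_eq0 (al be u v : R) : (al, be) != (0, 0) ->
  al * u - be * v = 0 -> al * v + be * u = 0 -> u = 0 /\ v = 0.
Proof.
move=> ab h1 h2.
have n0 : al ^+ 2 + be ^+ 2 != 0.
  by apply: contra ab; rewrite paddr_eq0 ?sqr_ge0// !sqrf_eq0 => /andP[/eqP-> /eqP->].
split; apply: (mulfI n0); rewrite mulr0.
  by transitivity (al * (al * u - be * v) + be * (al * v + be * u)); [ring|rewrite h1 h2; ring].
by transitivity (al * (al * v + be * u) - be * (al * u - be * v)); [ring|rewrite h1 h2; ring].
Qed.

Variables (X1 X1' X2 X2' Y1 Y1' Y2 Y2' : R -> R) (al be : R).
Hypothesis dX1 : der X1 X1'.
Hypothesis dX2 : der X2 X2'.
Hypothesis dY1 : der Y1 Y1'.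
Hypothesis dY2 : der Y2 Y2'.
Hypothesis dX1' : der X1' (fun x => Vminus g p w x * X1 x - (al * Y1 x + (- be) * Y2 x)).
Hypothesis dX2' : der X2' (fun x => Vminus g p w x * X2 x - (al * Y2 x + be * Y1 x)).
Hypothesis dY1' : der Y1' (fun x => Vplus g p w x * Y1 x - (al * X1 x + (- be) * X2 x)).
Hypothesis dY2' : der Y2' (fun x => Vplus g p w x * Y2 x - (al * X2 x + be * X1 x)).
Hypothesis iF : (leb R).-integrable setT (EFin \o (fun x =>
  X1 x ^+ 2 + X1' x ^+ 2 + (X2 x ^+ 2 + X2' x ^+ 2) +
  (Y1 x ^+ 2 + Y1' x ^+ 2 + (Y2 x ^+ 2 + Y2' x ^+ 2)))).
Hypothesis e0 : 0 < ep.
Hypothesis hI : (600 ^+ 2 + 1) * ep ^+ 2 * Num.sqrt w <= \int[leb R]_x pot_h g p x.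

(** If lam <> 0: from U' = - b U - S Q, the vanishing of U gives S Q = 0, that is
    S X = 0; then Z = 0 reads P = 0, that is Y = 0, and U = 0 reads Q = 0.  The
    case lam = 0 is that of the two kernels. *)
Lemma classify :
  (forall x, [/\ X1 x = 0, X2 x = 0, Y1 x = 0 & Y2 x = 0]) \/
  (al = 0 /\ be = 0) /\ exists c1 c2 d1 d2, forall x,
    [/\ X1 x = c1 * p x, X2 x = c2 * p x,
        Y1 x = d1 * (logder p x * p x) & Y2 x = d2 * (logder p x * p x)].
Proof.
have V := transformed_vanish st dX1 dX2 dY1 dY2 dX1' dX2' dY1' dY2' iF e0 hI.
have [ab|ab] := eqVneq (al, be) (0, 0).
  case: ab => al0 be0; right; split => //.
  have [||c1 h1] := kernel_minus dX1 dX1' _ _.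
  - by move=> x; rewrite al0 be0; ring.
  - by move=> x; case: (V x).
  have [||c2 h2] := kernel_minus dX2 dX2' _ _.
  - by move=> x; rewrite al0 be0; ring.
  - by move=> x; case: (V x).
  have [||d1 h3] := kernel_plus dY1 dY1' _ _.
  - by move=> x; rewrite al0 be0; ring.
  - by move=> x; case: (V x).
  have [||d2 h4] := kernel_plus dY2 dY2' _ _.
  - by move=> x; rewrite al0 be0; ring.
  - by move=> x; case: (V x).
  by exists c1, c2, d1, d2.
left.
have [ddX1 ddX2 ddY1 ddY2] := And4 dX1 dX2 dY1 dY2.
have dQ1 : der (fun x => al * X1 x + (- be) * X2 x) (fun x => al * X1' x + (- be) * X2' x).
  by move=> t; ddat.
have dQ2 : der (fun x => al * X2 x + be * X1 x) (fun x => al * X2' x + be * X1' x).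
  by move=> t; ddat.
have U1 x : uop' g p w Y1 Y1' (fun x => al * X1 x + (- be) * X2 x) (fun x => al * X1' x + (- be) * X2' x) x = 0.
  by apply: (der_zero (uop_der st dY1 dY1' dQ1)) => t; case: (V t).
have U2 x : uop' g p w Y2 Y2' (fun x => al * X2 x + be * X1 x) (fun x => al * X2' x + be * X1' x) x = 0.
  by apply: (der_zero (uop_der st dY2 dY2' dQ2)) => t; case: (V t).
have A x : sop p X1 X1' x = 0 /\ sop p X2 X2' x = 0.
  have [v1 v2 _ _] := V x; apply: (rotation_eq0 ab).
    by have := U1 x; rewrite /uop' v1 /sop; lra.
  by have := U2 x; rewrite /uop' v2 /sop; lra.
have Y0 x : Y1 x = 0 /\ Y2 x = 0.
  have [_ _ z1 z2] := V x; have [a1 a2] := A x.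
  apply: (rotation_eq0 ab).
    by move: z1; rewrite /zop a1; lra.
  by move: z2; rewrite /zop a2; lra.
move=> x; have [y1 y2] := Y0 x; rewrite y1 y2.
have y1' := der_zero dY1 (fun t => proj1 (Y0 t)) x.
have y2' := der_zero dY2 (fun t => proj2 (Y0 t)) x.
have [v1 v2 _ _] := V x.
have [-> ->] // : X1 x = 0 /\ X2 x = 0.
apply: (rotation_eq0 ab).
  by move: v1; rewrite /uop y1 y1'; lra.
by move: v2; rewrite /uop y2 y2'; lra.
Qed.

End kernels.

(** * Small frequencies *)

Section final.
Variable R : realType.

Lemma eps_bound (g : R -> R) (w e : R) : 0 < w ->
  (forall s, 0 < s <= 3 * w -> `|s * gpp g s| <= e) ->
  eps g w <= e /\ (forall s, 0 < s <= 3 * w -> `|s * gpp g s| <= eps g w).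
Proof.
move=> w0 h; pose A := [set `|s * (g^`(2) s)%classic| | s in `[0, 3 * w]].
have e0 : 0 <= e.
  by apply: le_trans (h (3 * w) _); [exact: normr_ge0|rewrite lexx andbT; lra].
have ub : ubound A e.
  move=> _ [s + <-]; rewrite /= in_itv /= => /andP[s0 s3].
  have [->|sn] := eqVneq s 0; first by rewrite mul0r normr0.
  by apply: h; rewrite s3 lt_neqAle eq_sym sn s0.
have A0 : A !=set0.
  by exists `|0 * (g^`(2) 0)%classic|, 0 => //; rewrite /= in_itv /= lexx; lra.
split; first exact: ge_sup.
move=> s /andP[s0 s3]; apply: ub_le_sup; first by exists e.
by exists s => //; rewrite /= in_itv /= ltW.
Qed.

(** (H2) also provides 0 < eps g w: if it vanished, its inverse would be 0 and so
    would the product in (H2). *)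
Lemma setting_near (g : R -> R) (phi : R -> R -> R) :
  (\forall w \near 0^'+, ground_state g w (phi w)) -> hyp_H1 g -> hyp_H2 g phi ->
  exists2 r : R, 0 < r & forall w, 0 < w < r ->
   [/\ setting g (phi w) w (eps g w), 0 < eps g w &
     (600 ^+ 2 + 1) * eps g w ^+ 2 * Num.sqrt w <= \int[leb R]_x pot_h g (phi w) x].
Proof.
move=> hphi h1 h2.
have [S0 S00 hS] := near0_of_bound h1.
have e0 : 0 < 100^-1 ^+ 2 :> R by rewrite exprn_gt0// invr_gt0.
have [s0 s00 hs] := hyp_H1_small h1 e0.
have h2' : \forall w \near 0^'+, 600 ^+ 2 + 1 <= (eps g w ^+ 2 * Num.sqrt w)^-1 *
   \int[leb R]_x pot_h g (phi w) x.
  by move/cvgryPge : h2; exact.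
have [r r0 hr] : exists2 r : R, 0 < r & forall w, 0 < w < r -> ground_state g w (phi w) /\
   600 ^+ 2 + 1 <= (eps g w ^+ 2 * Num.sqrt w)^-1 * \int[leb R]_x pot_h g (phi w) x.
  have [r /= r0 hr] : \forall w \near 0^'+, ground_state g w (phi w) /\
   600 ^+ 2 + 1 <= (eps g w ^+ 2 * Num.sqrt w)^-1 * \int[leb R]_x pot_h g (phi w) x.
    by near=> w; split; near: w.
  exists r => // w /andP[w0 wr]; apply: hr => //=.
  by rewrite sub0r normrN gtr0_norm.
pose r1 := Num.min r (Num.min (S0 / 3) (s0 / 3)).
have r10 : 0 < r1 by rewrite !lt_min r0 !divr_gt0.
exists r1 => // w /andP[w0]; rewrite !lt_min => /and3P[wr wS ws].
have wS' : 0 < 3 * w < S0 by apply/andP; split; lra.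
have bd s : 0 < s <= 3 * w -> `|s * gpp g s| <= 100^-1 ^+ 2.
  by move=> /andP[a b]; have [|_ _ //] := hs s; apply/andP; split; lra.
have wr' : 0 < w < r by rewrite w0.
have [gs hi] := hr w wr'.
have [ep1 ep2] := eps_bound w0 bd.
have nb := hS _ _ wS' ep2.
have epp : 0 < eps g w.
  rewrite lt_neqAle (n0_ep nb) andbT eq_sym; apply/eqP => z.
  by move: hi; rewrite z expr0n /= mul0r invr0 mul0r; lra.
have sw : 0 < Num.sqrt w by rewrite sqrtr_gt0.
split => //.
have pp : 0 < eps g w ^+ 2 * Num.sqrt w by apply: mulr_gt0 => //; exact: exprn_gt0.
by rewrite -mulrA -ler_pdivlMr// mulrC.
Unshelve. all: by end_near. Qed.

End final.

Unset Implicit Arguments.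

Local Open Scope complex_scope.

Theorem theorem1 (R : realType) (g : R -> R) (phi : R -> R -> R)
    (hphi : \forall w \near 0^'+, ground_state g w (phi w))
    (h1 : hyp_H1 g) (h2 : hyp_H2 g phi) :
  exists2 wstar : R, 0 < wstar &
    forall w : R, 0 < w < wstar ->
    forall (X Y : R -> R[i]) (lam : R[i]),
      sobolev_H1C X -> sobolev_H1C Y ->
      (eigen_system g w (phi w) X Y lam <->
       ({ae leb R, forall x, X x = 0} /\ {ae leb R, forall x, Y x = 0}) \/
       [/\ lam = 0, ae_span (phi w) X & ae_span (phi w)^`() Y]).
Proof.
have [r r0 hr] := setting_near hphi h1 h2.
exists r => // w hw X Y lam hX hY; have [st e0 hI] := hr w hw.
have cm := Vminus_cont st; have cp := Vplus_cont st.
have p'E x : ((phi w)^`() x)%classic = logder (phi w) x * phi w x by exact: (p'E st).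
split.
  move=> heq.
  have [X1 [X1' [X2 [X2' [Y1 [Y1' [Y2 [Y2' H]]]]]]]] := eigen_classical hX hY cm cp heq.
  case: H => -[aX1 aX2] [aY1 aY2] [dX1 dX2 dY1 dY2] [dX1' dX2' dY1' dY2'] iF.
  have [Z|[[al0 be0] [c1 [c2 [d1 [d2 Z]]]]]] :=
    classify st dX1 dX2 dY1 dY2 dX1' dX2' dY1' dY2' iF e0 hI.
    left; split.
      by apply: ae_impl2 aX1 aX2 => x e1 e2; apply: complex_ext; rewrite ?e1 ?e2; case: (Z x).
    by apply: ae_impl2 aY1 aY2 => x e1 e2; apply: complex_ext; rewrite ?e1 ?e2; case: (Z x).
  right; split; first exact: complex_ext.
    exists (c1 +i* c2); apply: ae_impl2 aX1 aX2 => x e1 e2; have [z1 z2 _ _] := Z x.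
    by apply: complex_ext; rewrite /= ?e1 ?e2 ?z1 ?z2; ring.
  exists (d1 +i* d2); apply: ae_impl2 aY1 aY2 => x e1 e2; have [_ _ z1 z2] := Z x.
  by apply: complex_ext; rewrite p'E /= ?e1 ?e2 ?z1 ?z2; ring.
case=> [[aX aY]|[lam0 [[c1 c2] aX] [[d1 d2] aY]]].
  have -> : lam = complex.Re lam +i* complex.Im lam by case: lam.
  move=> psi tpsi.
  have dz : der (fun=> 0 : R) (fun=> 0) by move=> x; exact: dat_cst.
  apply: (@eigen_of_classical _ _ _ (complex.Re lam) (complex.Im lam) (Vminus g (phi w) w) (Vplus g (phi w) w)
    (fun=> 0) (fun=> 0) (fun=> 0) (fun=> 0) (fun=> 0) (fun=> 0) (fun=> 0) (fun=> 0) hX hY cm cp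
    _ _ _ _ dz dz dz dz _ _ _ _ psi tpsi).
  - by apply: ae_impl aX => x ->.
  - by apply: ae_impl aX => x ->.
  - by apply: ae_impl aY => x ->.
  - by apply: ae_impl aY => x ->.
  - by move=> x; apply: dat_eq; [exact: dat_cst|ring].
  - by move=> x; apply: dat_eq; [exact: dat_cst|ring].
  - by move=> x; apply: dat_eq; [exact: dat_cst|ring].
  - by move=> x; apply: dat_eq; [exact: dat_cst|ring].
have dp := p_der st; have dp2 := p_der2 st; have dp3 := p_der3 st.
have dc (k : R) : der (fun x => k * phi w x) (fun x => k * (logder (phi w) x * phi w x)).
  by move=> x; apply: dat_eq; [repeat dat_step|rewrite /=; ring].
have dc1 (k : R) : der (fun x => k * (logder (phi w) x * phi w x)) (fun x => k * (Vminus g (phi w) w x * phi w x)).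
  by move=> x; apply: dat_eq; [repeat first [exact: dp2|dat_step]|rewrite /=; ring].
have dc2 (k : R) : der (fun x => k * (Vminus g (phi w) w x * phi w x)) (fun x => k * (Vplus g (phi w) w x * (logder (phi w) x * phi w x))).
  by move=> x; apply: dat_eq; [repeat first [exact: dp3|dat_step]|rewrite /=; ring].
move=> psi tpsi; rewrite lam0; apply: (eigen_of_classical (al := 0) (be := 0) hX hY cm cp _ _ _ _ (dc c1) (dc c2)
  (dc1 d1) (dc1 d2)
  _ _ _ _ tpsi).
- by apply: ae_impl aX => x ->; rewrite /=; ring.
- by apply: ae_impl aX => x ->; rewrite /=; ring.
- by apply: ae_impl aY => x ->; rewrite p'E /=; ring.
- by apply: ae_impl aY => x ->; rewrite p'E /=; ring.
- by move=> x; apply: dat_eq; [exact: dc1|ring].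
- by move=> x; apply: dat_eq; [exact: dc1|ring].
- by move=> x; apply: dat_eq; [exact: dc2|ring].
- by move=> x; apply: dat_eq; [exact: dc2|ring].
Qed.
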